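(* Let $z\in\mathbb{C}$, $z\neq0$, $|\arg z|<\pi$, and let $\nu>0$ be real with $\nu\notin\mathbb{Z}$. Then $$\begin{aligned}\int_z^\infty\frac{I_\nu(t)K_\nu(t)}{t}\,dt=\frac1{2\nu}\Biggl[&\frac{\pi\csc(\pi\nu)\,(z/2)^{2\nu}}{2\,\Gamma^2(\nu+1)}\,{}_2F_3\left(\left.\begin{array}{c}\nu,\ \nu+\frac12\\ \nu+1,\ \nu+1,\ 2\nu+1\end{array}\right|z^2\right)\\&-\frac{z^2}{4(1-\nu^2)}\,{}_3F_4\left(\left.\begin{array}{c}1,\ 1,\ \frac32\\ 2,\ 2,\ 2-\nu,\ 2+\nu\end{array}\right|z^2\right)+\log\left(\frac2z\right)+\psi(\nu)+\frac1{2\nu}\Biggr].\end{aligned}$$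
   Context: Powers and logarithms take their principal values. $I_\nu(z)=(z/2)^\nu\sum_{k\ge0}\frac{(z/2)^{2k}}{k!\,\Gamma(\nu+k+1)}$ and, for $\nu\notin\mathbb{Z}$, $K_\nu(z)=\frac\pi2\frac{I_{-\nu}(z)-I_\nu(z)}{\sin\pi\nu}$. $\psi=\Gamma'/\Gamma$ is the digamma function. ${}_pF_q\left(\left.\begin{array}{c}a_1,\dots,a_p\\ b_1,\dots,b_q\end{array}\right|x\right)=\sum_{k\ge0}\frac{(a_1)_k\cdots(a_p)_k}{(b_1)_k\cdots(b_q)_k}\frac{x^k}{k!}$ with $(\alpha)_k=\alpha(\alpha+1)\cdots(\alpha+k-1)$. The integral $\int_z^\infty$ is along a path in $\mathbb{C}\setminus(-\infty,0]$ from $z$ ending at $+\infty$ along the positive real axis. *)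

(* Defs.v *)
From Stdlib Require Import Reals ZArith List.
From Coquelicot Require Import Coquelicot.
Import ListNotations.
Open Scope R_scope.

(** * Elementary functions on [C] *)

Definition Cexp (z : C) : C :=
  (exp (Re z) * cos (Im z), exp (Re z) * sin (Im z)).

(** Principal argument, in [(-PI, PI]]; the value at [0] is irrelevant. *)
Definition Carg (z : C) : R :=
  if Rle_dec 0 (Im z) then acos (Re z / Cmod z) else - acos (Re z / Cmod z).

Definition Clog (z : C) : C := (ln (Cmod z), Carg z).

(** Principal power, for [z <> 0]. *)
Definition Cpower (z s : C) : C := Cexp (s * Clog z)%C.

(** Sum of a complex series, meaningful when real and imaginary parts both
    converge. *)
Definition CSeries (a : nat -> C) : C :=
  (Series (fun k => Re (a k)), Series (fun k => Im (a k))).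

(** * Gamma and digamma functions on the real line *)

Fixpoint pochhammer (a : R) (k : nat) : R :=
  match k with
  | O => 1
  | S k => pochhammer a k * (a + INR k)
  end.

Definition Gamma_integral (x : R) : R :=
  RInt_gen (fun t => Rpower t (x - 1) * exp (- t))
    (at_right 0) (Rbar_locally p_infty).

(** Euler's integral for [x > 0], where the shift is [0], continued to negative
    non-integers by [Gamma x = Gamma (x + n) / (x)_n]. At the poles the value is
    [0] by the convention [/ 0 = 0]. *)
Definition Gamma (x : R) : R :=
  let n := Z.to_nat (up (- x)) in
  Gamma_integral (x + INR n) / pochhammer x n.

Definition digamma (x : R) : R := Derive Gamma x / Gamma x.

(** * Modified Bessel functions of real order *)

Definition BesselI (nu : R) (z : C) : C :=
  (Cpower (z / 2) nu *
   CSeries (fun k =>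
     (z / 2) ^ (2 * k) / RtoC (INR (fact k) * Gamma (nu + INR k + 1))))%C.

(** Only for [nu] not an integer. *)
Definition BesselK (nu : R) (z : C) : C :=
  (PI / 2 * ((BesselI (- nu) z - BesselI nu z) / sin (PI * nu)))%C.

(** * Generalized hypergeometric series with real parameters *)

Definition pochhammer_prod (a : list R) (k : nat) : R :=
  fold_right Rmult 1 (map (fun x => pochhammer x k) a).

Definition pFq (a b : list R) (x : C) : C :=
  CSeries (fun k =>
    (RtoC (pochhammer_prod a k / pochhammer_prod b k) *
     (x ^ k / INR (fact k)))%C).

(** * Path integrals from a point to [+oo] in the cut plane *)

Definition cut_plane (z : C) : Prop := ~ (Im z = 0 /\ Re z <= 0).

Definition path_deriv (g : R -> C) (t : R) : C :=
  (Derive (fun u => Re (g u)) t, Derive (fun u => Im (g u)) t).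

(** [S] contains the break points; at every point of [[a,b]] the derivative has
    finite one-sided limits from within [[a,b]]. *)
Definition piecewise_C1 (g : R -> C) (a b : R) : Prop :=
  (forall t, a <= t <= b ->
     filterlim g (within (fun u => a <= u <= b) (locally t)) (locally (g t))) /\
  exists S : list R,
    (forall t, a < t < b -> ~ In t S ->
       ex_derive (fun u => Re (g u)) t /\ ex_derive (fun u => Im (g u)) t /\
       continuous (path_deriv g) t) /\
    (forall t, a <= t < b ->
       exists l : C, filterlim (path_deriv g) (at_right t) (locally l)) /\
    (forall t, a < t <= b ->
       exists l : C, filterlim (path_deriv g) (at_left t) (locally l)).

(** A path parametrized by [[0, +oo)], eventually lying on the real axis and
    tending to [+oo] there. *)
Definition path_to_infinity (z : C) (g : R -> C) : Prop :=
  g 0 = z /\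
  (forall b, 0 < b -> piecewise_C1 g 0 b) /\
  (forall t, 0 <= t -> cut_plane (g t)) /\
  Rbar_locally p_infty (fun t => Im (g t) = 0) /\
  is_lim (fun t => Re (g t)) p_infty p_infty.

Definition is_path_integral (f : C -> C) (g : R -> C) (l : C) : Prop :=
  @is_RInt_gen C_R_NormedModule
    (fun t => (f (g t) * path_deriv g t)%C)
    (at_point 0) (Rbar_locally p_infty) l.

(* Main.v *)
(** Along the path the integrand has an explicit primitive: multiplying the power series of the Bessel
    functions (Vandermonde) and integrating term by term gives, up to sign, the right-hand side, where
    the reflection formula for [Gamma] makes the constant term of [I_nu I_(-nu)] integrate to the
    logarithm. So it remains to see that this primitive tends to [0] at [+oo] on the real axis, i.e. to
    identify the constant [psi(nu) + 1/(2 nu)].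

    Write [p_nu = I_nu K_nu] and let [Phi_nu] be the primitive of [- 2 nu p_nu / x] that is [log (2/x) + o(1)]
    at [0]. The recurrences of the Bessel functions give
    [Phi_nu - Phi_(nu+1) + p_nu + p_(nu+1) = const = 1/(2 nu) + 1/(2 nu + 2)], and [p_nu -> 0] at infinity, so
    the limits of [Phi_nu] and of [- psi(nu) - 1/(2 nu)] have the same increments in [nu]. For large [mu], Riccati
    comparison of [x I'/I] and [- x K'/K] with [sqrt (x^2 + mu^2)] gives
    [Phi_mu(x) = arsinh (mu/x) - log mu + O(1/mu)] uniformly in [x], while [psi(mu) - log mu -> 0]. That [K_nu],
    defined by its series, is the recessive solution amounts to [I_(-nu) / I_nu -> 1], which follows from
    Wendel's inequality for [Gamma] applied term by term. *)

Require Import Defs.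
From Stdlib Require Import Reals ZArith List Lra Lia Psatz.
From Coquelicot Require Import Coquelicot.
Import ListNotations.
Open Scope R_scope.
Set Bullet Behavior "Strict Subproofs".

(** The limit at infinity cannot be read off the series: both series in the primitive grow
    exponentially and only their difference stays bounded. No asymptotic expansion is used.
    Constants are fixed at whichever end of the positive axis they are explicit, and a derivative of
    known sign carries them across. Writing x = 2 e^s turns x d/dx into d/ds and the two ends into s
    -> -oo and s -> +oo.

    Beyond the functional equation, the one analytic fact about Gamma is Wendel's inequality, the
    weighted arithmetic-geometric mean inequality integrated against Euler's density. It serves
    three times: for the limit defining psi, for the limit in the reflection formula, and for I_nu
    at orders that differ by a fraction.

    A termwise comparison needs positive coefficients, which the order -nu does not provide. So I_nu
    is first compared with I_(nu+d), where 0 <= d <= 1 and -nu = nu + d - n, and the three-term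
    recurrence then descends from nu + d to -nu. *)

Notation lim_minfty f l := (filterlim f (Rbar_locally m_infty) (locally l)).
Notation lim_pinfty f l := (filterlim f (Rbar_locally p_infty) (locally l)).

Lemma Rabs_ball (x e y : R) : Rabs (y - x) < e -> ball x e y.
Proof. trivial. Qed.

Lemma ball_Rabs (x e y : R) : ball x e y -> Rabs (y - x) < e.
Proof. trivial. Qed.

Lemma continuous_derivable (f : R -> R) (a : R) : ex_derive f a -> continuous f a.
Proof. apply (@ex_derive_continuous R_AbsRing R_NormedModule). Qed.

Lemma ex_series_le_Rabs (a b : nat -> R) : (forall k, Rabs (a k) <= b k) -> ex_series b -> ex_series a.
Proof. apply (ex_series_le (V := R_CompleteNormedModule)). Qed.

(** * Euler's integral and the Gamma function *)

Definition gamma_density (x t : R) : R := Rpower t (x - 1) * exp (- t).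

Lemma gamma_density_pos (x t : R) : 0 < gamma_density x t.
Proof. apply Rmult_lt_0_compat; apply exp_pos. Qed.

Lemma gamma_density_continuous (x t : R) : 0 < t -> continuous (gamma_density x) t.
Proof.
  intros Ht. apply continuous_derivable.
  unfold gamma_density, Rpower. auto_derive. exact Ht.
Qed.

Lemma gamma_density_succ (x t : R) : 0 < t ->
  gamma_density (x + 1) t = t * gamma_density x t.
Proof.
  intros Ht. unfold gamma_density.
  replace (x + 1 - 1) with (x - 1 + 1) by ring.
  rewrite Rpower_plus, Rpower_1 by easy. ring.
Qed.

Lemma positive_integrand_interval (f : R -> R) (a b : R) :
  (forall t, 0 < t -> continuous f t) -> 0 < a -> 0 < b -> ex_RInt f a b.
Proof.
  intros Hc Ha Hb. apply (@ex_RInt_continuous R_CompleteNormedModule). intros t [Ht _]. apply Hc.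
  apply Rlt_le_trans with (2 := Ht). apply Rmin_case; assumption.
Qed.

Lemma RInt_pos_mono (f : R -> R) (a a' b' b : R) :
  (forall t, 0 < t -> continuous f t) -> (forall t, 0 < t -> 0 <= f t) ->
  0 < a <= a' -> a' <= b' <= b -> RInt f a' b' <= RInt f a b.
Proof.
  intros Hc Hp Ha Hb.
  assert (E : RInt f a b = RInt f a a' + RInt f a' b' + RInt f b' b).
  { rewrite <- (RInt_Chasles f a b' b); try (apply positive_integrand_interval; trivial; lra).
    rewrite <- (RInt_Chasles f a a' b'); try (apply positive_integrand_interval; trivial; lra).
    reflexivity. }
  assert (0 <= RInt f a a').
  { apply RInt_ge_0; try lra. apply positive_integrand_interval; trivial; lra.
    intros; apply Hp; lra. }
  assert (0 <= RInt f b' b).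
  { apply RInt_ge_0; try lra. apply positive_integrand_interval; trivial; lra.
    intros; apply Hp; lra. }
  lra.
Qed.

Lemma filter_prod_zero_infty (P : R * R -> Prop) (a b : R) :
  0 < a -> (forall s t, 0 < s < a -> b < t -> P (s, t)) ->
  filter_prod (at_right 0) (Rbar_locally p_infty) P.
Proof.
  intros Ha H. apply Filter_prod with (fun s => 0 < s < a) (fun t => b < t).
  - exists (mkposreal a Ha). intros s Hs Hs0. change (0 < s) in Hs0. split; trivial.
    apply ball_Rabs in Hs; simpl in Hs.
    apply Rabs_def2 in Hs. lra.
  - exists b. trivial.
  - intros s t Hs Ht. apply H; trivial.
Qed.

(** For a nonnegative function the supremum of the proper integrals is the improper one, so
    boundedness alone settles both ends. The second conclusion is kept because it yields lower
    bounds such as [Gamma_integral_pos]. *)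
Lemma is_RInt_gen_bounded_pos (f : R -> R) (M : R) :
  (forall t, 0 < t -> continuous f t) -> (forall t, 0 < t -> 0 <= f t) ->
  (forall a b, 0 < a <= b -> RInt f a b <= M) ->
  exists l, is_RInt_gen f (at_right 0) (Rbar_locally p_infty) l /\
    (forall a b, 0 < a <= b -> RInt f a b <= l).
Proof.
  intros Hc Hp HM.
  destruct (completeness (fun y => exists a b, 0 < a <= b /\ y = RInt f a b)) as [l [Hub Hl]].
  - exists M. intros y (a & b & Hab & ->). auto.
  - exists (RInt f 1 1), 1, 1. split; [lra | reflexivity].
  - assert (Hle : forall a b, 0 < a <= b -> RInt f a b <= l).
    { intros a b Hab. apply Hub. exists a, b. auto. }
    exists l. split; trivial.
    intros P [eps HP].
    assert (Hex : exists a b, 0 < a <= b /\ l - eps < RInt f a b).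
    { apply Classical_Prop.NNPP. intros Hn.
      assert (l <= l - eps); [| pose proof (cond_pos eps); lra].
      apply Hl. intros y (a & b & Hab & ->).
      apply Rnot_lt_le. intros Hlt. apply Hn. exists a, b. auto. }
    destruct Hex as (a0 & b0 & Hab0 & Hlt).
    apply filter_prod_zero_infty with a0 b0; [lra|].
    intros s t Hs Ht. exists (RInt f s t). split.
    + apply (RInt_correct f). apply positive_integrand_interval; trivial; simpl; lra.
    + apply HP. apply Rabs_ball; simpl.
      assert (RInt f a0 b0 <= RInt f s t) by (apply RInt_pos_mono; trivial; lra).
      assert (RInt f s t <= l) by (apply Hle; lra).
      pose proof (cond_pos eps).
      apply Rabs_def1; lra.
Qed.

Lemma ln_le_sub_1 (y : R) : 0 < y -> ln y <= y - 1.
Proof.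
  intros Hy. pose proof (exp_ineq1_le (ln y)). rewrite exp_ln in H by easy. lra.
Qed.

(** Apply ln y <= y - 1 at y = t / (2 x). The rate 1/2 leaves a factor e^(-t/2) of the density for
    decay. *)
Lemma Rpower_le_exp_half (x t : R) : 0 < x -> 0 < t ->
  Rpower t x <= exp (x * ln (2 * x)) * exp (t / 2).
Proof.
  intros Hx Ht. unfold Rpower. rewrite <- exp_plus.
  assert (H : ln t <= t / (2 * x) + ln (2 * x)).
  { replace t with (t / (2 * x) * (2 * x)) at 1 by (field; lra).
    rewrite ln_mult; [| apply Rdiv_lt_0_compat; lra | lra].
    pose proof (ln_le_sub_1 (t / (2 * x)) ltac:(apply Rdiv_lt_0_compat; lra)). lra. }
  apply Rmult_le_compat_l with (r := x) in H; [| lra].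
  assert (E : x * (t / (2 * x) + ln (2 * x)) = x * ln (2 * x) + t / 2) by (field; lra).
  rewrite E in H. destruct H as [H | H].
  - left. apply exp_increasing, H.
  - rewrite H. lra.
Qed.

(* The density is dominated by a multiple of [- d/dt (1 / (1 + t ^ x))], whose integral over any
   interval is at most 1; this treats both ends of [(0, +oo)] at once. *)
Lemma gamma_density_integral_bounded (x : R) : 0 < x ->
  exists M, forall a b, 0 < a <= b -> RInt (gamma_density x) a b <= M.
Proof.
  intros Hx. set (C := exp (x * ln (2 * x))).
  assert (HC : 0 < C) by apply exp_pos.
  exists ((1 + C) ^ 2 / x). intros a b Hab.
  set (H := fun t => - ((1 + C) ^ 2 / x) / (1 + Rpower t x)).
  set (h := fun t => (1 + C) ^ 2 * Rpower t (x - 1) / (1 + Rpower t x) ^ 2).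
  assert (Hd : forall t, 0 < t -> is_derive H t (h t)).
  { intros t Ht. unfold H, h. assert (0 < Rpower t x) by apply exp_pos.
    replace (Rpower t (x - 1)) with (Rpower t x / t).
    2: { unfold Rminus. rewrite Rpower_plus, Rpower_Ropp, Rpower_1 by easy. reflexivity. }
    unfold Rpower in *. auto_derive; [split; lra|].
    field. lra. }
  assert (Hi : is_RInt h a b (minus (H b) (H a))).
  { apply (is_RInt_derive H h).
    - intros t Ht. rewrite Rmin_left, Rmax_right in Ht by lra. apply Hd. lra.
    - intros t Ht. rewrite Rmin_left, Rmax_right in Ht by lra.
      apply continuous_derivable. unfold h.
      assert (0 < Rpower t x) by apply exp_pos.
      unfold Rpower in *. auto_derive. repeat split; try lra. apply Rgt_not_eq. nra. }
  apply Rle_trans with (RInt h a b).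
  - apply RInt_le; try lra.
    + apply positive_integrand_interval; try lra. apply gamma_density_continuous.
    + eexists; exact Hi.
    + intros t Ht. unfold gamma_density, h.
      unfold Rdiv. rewrite (Rmult_comm ((1 + C) ^ 2)), Rmult_assoc.
      apply Rmult_le_compat_l; [left; apply exp_pos|].
      assert (0 < Rpower t x) by apply exp_pos.
      assert (Hp : Rpower t x <= C * exp (t / 2)) by (apply Rpower_le_exp_half; lra).
      assert (He : 1 < exp (t / 2)).
      { rewrite <- exp_0. apply exp_increasing. lra. }
      assert (Hee : exp (- t) = / (exp (t / 2)) ^ 2).
      { rewrite exp_Ropp. f_equal. simpl. rewrite Rmult_1_r, <- exp_plus. f_equal. lra. }
      rewrite Hee.
      (* Since 1 < e^(t/2) and t^x <= C e^(t/2), squaring gives e^(-t) <= (1 + C)^2 / (1 + t^x)^2;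
         this is where the constant in [h] comes from. *)
      assert (Hq : (1 + Rpower t x) ^ 2 <= ((1 + C) * exp (t / 2)) ^ 2).
      { apply pow_incr. nra. }
      rewrite Rpow_mult_distr in Hq.
      assert (0 < (1 + Rpower t x) ^ 2) by (apply pow_lt; lra).
      assert (0 < exp (t / 2) ^ 2) by (apply pow_lt; lra).
      apply Rmult_le_reg_r with (exp (t / 2) ^ 2); trivial.
      rewrite Rinv_l by lra.
      apply Rmult_le_reg_r with ((1 + Rpower t x) ^ 2); trivial.
      field_simplify; lra.
  - rewrite (is_RInt_unique _ _ _ _ Hi). unfold minus, plus, opp, H; simpl.
    assert (0 < Rpower a x) by apply exp_pos. assert (0 < Rpower b x) by apply exp_pos.
    set (D := (1 + C) * ((1 + C) * 1) / x).
    assert (HD : 0 < D) by (apply Rdiv_lt_0_compat; nra).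
    assert (0 < / (1 + Rpower b x)) by (apply Rinv_0_lt_compat; lra).
    assert (/ (1 + Rpower a x) <= 1).
    { rewrite <- Rinv_1 at 2. apply Rinv_le_contravar; lra. }
    unfold Rdiv. nra.
Qed.

Lemma Gamma_integral_correct (x : R) : 0 < x ->
  is_RInt_gen (gamma_density x) (at_right 0) (Rbar_locally p_infty) (Gamma_integral x) /\
  (forall a b, 0 < a <= b -> RInt (gamma_density x) a b <= Gamma_integral x).
Proof.
  intros Hx. destruct (gamma_density_integral_bounded x Hx) as [M HM].
  destruct (is_RInt_gen_bounded_pos (gamma_density x) M) as [l [Hl Hb]]; trivial.
  - apply gamma_density_continuous.
  - intros t _. left. apply gamma_density_pos.
  - assert (E : Gamma_integral x = l) by exact (is_RInt_gen_unique (gamma_density x) l Hl).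
    rewrite E. auto.
Qed.

Lemma Gamma_integral_pos (x : R) : 0 < x -> 0 < Gamma_integral x.
Proof.
  intros Hx. apply Rlt_le_trans with (RInt (gamma_density x) 1 2).
  - apply RInt_gt_0; try lra. intros; apply gamma_density_pos.
    intros. apply gamma_density_continuous. lra.
  - apply Gamma_integral_correct; lra.
Qed.

Lemma is_RInt_gen_le_pos (f h : R -> R) (lf lh : R) :
  (forall t, 0 < t -> f t <= h t) ->
  is_RInt_gen f (at_right 0) (Rbar_locally p_infty) lf ->
  is_RInt_gen h (at_right 0) (Rbar_locally p_infty) lh -> lf <= lh.
Proof.
  intros Hle Hf Hh.
  assert (Hd : is_RInt_gen (fun t => minus (h t) (f t)) (at_right 0) (Rbar_locally p_infty) (minus lh lf)).
  { exact (is_RInt_gen_minus h f lh lf Hh Hf). }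
  assert (0 <= minus lh lf); [| unfold minus, plus, opp in H; simpl in H; lra].
  apply Rnot_lt_le. intros Hneg.
  destruct (Hd (fun y => y < 0)) as [Q T HQ HT HQT].
  { exists (mkposreal (- (minus lh lf)) ltac:(lra)). intros y Hy.
    apply ball_Rabs in Hy; simpl in Hy.
    unfold minus, plus, opp in Hneg, Hy; simpl in Hneg, Hy. apply Rabs_def2 in Hy. lra. }
  destruct (filter_ex (F := at_right 0) (fun s => Q s /\ 0 < s < 1)) as [s [Hs Hs1]].
  { apply filter_and; trivial. exists (mkposreal 1 Rlt_0_1). intros s Hs Hs0. split; trivial.
    apply ball_Rabs in Hs; simpl in Hs.
    apply Rabs_def2 in Hs. lra. }
  destruct (filter_ex (F := Rbar_locally p_infty) (fun t => T t /\ 1 < t)) as [t [Ht Ht1]].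
  { apply filter_and; trivial. exists 1. trivial. }
  destruct (HQT s t Hs Ht) as [y [Hy Hy0]]. simpl in Hy.
  assert (0 <= y); [| lra].
  apply (is_RInt_ge_0 (fun t => minus (h t) (f t)) s t); trivial; [lra|].
  intros u Hu. unfold minus, plus, opp; simpl. specialize (Hle u ltac:(lra)). lra.
Qed.

Lemma continuous_at_right (f : R -> R) (x : R) : continuous f x ->
  filterlim f (at_right x) (locally (f x)).
Proof.
  intros H. intros P HP. apply filter_le_within. apply H, HP.
Qed.

Lemma Rpower_0_right (x : R) : 0 < x -> filterlim (fun t => Rpower t x) (at_right 0) (locally 0).
Proof.
  intros Hx P [eps HP]. exists (mkposreal (Rpower eps (/ x)) (exp_pos _)).
  intros t Ht Ht0. apply HP. change (0 < t) in Ht0.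
  apply ball_Rabs in Ht. apply Rabs_ball. simpl in Ht. rewrite Rminus_0_r in *. rewrite Rabs_pos_eq in Ht by lra.
  rewrite Rabs_pos_eq by (left; apply exp_pos).
  pose proof (cond_pos eps).
  replace (pos eps) with (Rpower (Rpower eps (/ x)) x).
  - apply Rlt_Rpower_l; lra.
  - rewrite Rpower_mult, Rinv_l, Rpower_1 by lra. reflexivity.
Qed.

Lemma Rpower_exp_infty (x : R) : 0 < x ->
  lim_pinfty (fun t => Rpower t x * exp (- t)) 0.
Proof.
  intros Hx P [eps HP]. set (C := exp (x * ln (2 * x))).
  assert (HC : 0 < C) by apply exp_pos. pose proof (cond_pos eps) as He.
  assert (HeC : 0 < eps / C) by (apply Rdiv_lt_0_compat; lra).
  exists (Rmax 0 (-2 * ln (eps / C))). intros t Ht. apply HP.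
  pose proof (Rmax_l 0 (-2 * ln (eps / C))). pose proof (Rmax_r 0 (-2 * ln (eps / C))).
  apply Rabs_ball; simpl.
  rewrite Rminus_0_r.
  rewrite Rabs_pos_eq by (left; apply Rmult_lt_0_compat; apply exp_pos).
  apply Rle_lt_trans with (C * exp (t / 2) * exp (- t)).
  - apply Rmult_le_compat_r; [left; apply exp_pos |].
    apply Rpower_le_exp_half; lra.
  - rewrite Rmult_assoc, <- exp_plus.
    apply Rlt_le_trans with (C * exp (ln (eps / C))).
    + apply Rmult_lt_compat_l; trivial. apply exp_increasing. lra.
    + rewrite exp_ln by easy. right. field. lra.
Qed.

Lemma is_RInt_gen_antiderivative (H h : R -> R) (l0 l1 : R) :
  (forall t, 0 < t -> is_derive H t (h t)) -> (forall t, 0 < t -> continuous h t) ->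
  filterlim H (at_right 0) (locally l0) -> lim_pinfty H l1 ->
  is_RInt_gen h (at_right 0) (Rbar_locally p_infty) (l1 - l0).
Proof.
  intros Hd Hc H0 H1.
  assert (Hpos : forall P : R -> Prop, (forall t, 0 < t -> P t) ->
    filter_prod (at_right 0) (Rbar_locally p_infty) (fun ab : R * R =>
     forall x : R, Rmin (fst ab) (snd ab) <= x <= Rmax (fst ab) (snd ab) -> P x)).
  { intros P HP. apply filter_prod_zero_infty with 1 1; [lra|].
    intros s t Hs Ht x Hx. simpl in Hx. rewrite Rmin_left in Hx by lra. apply HP. lra. }
  apply is_RInt_gen_ext with (f := Derive H); try typeclasses eauto.
  - apply filter_prod_zero_infty with 1 1; [lra|].
    intros s t Hs Ht x Hx. simpl in Hx. rewrite Rmin_left in Hx by lra.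
    apply is_derive_unique, Hd. lra.
  - apply is_RInt_gen_Derive; trivial; try typeclasses eauto.
    + apply Hpos. intros t Ht. eexists. apply Hd, Ht.
    + apply Hpos. intros t Ht. apply continuous_ext_loc with h; [| apply Hc, Ht].
      exists (mkposreal t Ht). intros y Hy. symmetry. apply is_derive_unique, Hd.
      apply ball_Rabs in Hy; simpl in Hy.
      apply Rabs_def2 in Hy. lra.
Qed.

(** Integration by parts: the boundary term t^x e^(-t) is an antiderivative of the difference of the
    two densities and vanishes at both ends. *)
Lemma Gamma_integral_succ (x : R) : 0 < x ->
  Gamma_integral (x + 1) = x * Gamma_integral x.
Proof.
  intros Hx.
  destruct (Gamma_integral_correct x Hx) as [H0 _].
  destruct (Gamma_integral_correct (x + 1) ltac:(lra)) as [H1 _].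
  pose proof (is_RInt_gen_scal _ x _ H0) as H2.
  pose proof (is_RInt_gen_minus _ _ _ _ H2 H1) as H3.
  assert (H4 : is_RInt_gen (fun t => minus (scal x (gamma_density x t)) (gamma_density (x + 1) t))
    (at_right 0) (Rbar_locally p_infty) (0 - 0)).
  { apply is_RInt_gen_antiderivative with (H := fun t => Rpower t x * exp (- t)).
    - intros t Ht. rewrite gamma_density_succ by easy. unfold gamma_density.
      replace (Rpower t (x - 1)) with (Rpower t x / t).
      2: { unfold Rminus. rewrite Rpower_plus, Rpower_Ropp, Rpower_1 by easy. reflexivity. }
      unfold Rpower, minus, scal, plus, opp, mult; simpl; unfold mult; simpl. auto_derive; [easy|]. field. lra.
    - intros t Ht.
      apply (continuous_minus (fun t => scal x (gamma_density x t)) (gamma_density (x + 1))).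
      + apply (continuous_scal_r x (gamma_density x)), gamma_density_continuous, Ht.
      + apply gamma_density_continuous, Ht.
    - replace 0 with (mult (K := R_AbsRing) 0 (exp (- 0))) at 2
        by (unfold mult; simpl; unfold mult; simpl; ring).
      eapply (filterlim_comp_2 (G := locally 0) (H := locally (exp (- 0)))).
      + apply Rpower_0_right, Hx.
      + apply (continuous_at_right (fun t => exp (- t)) 0).
        apply (continuous_derivable (fun t => exp (- t))). auto_derive. easy.
      + apply (@filterlim_mult R_AbsRing 0 (exp (- 0))).
    - apply Rpower_exp_infty, Hx. }
  pose proof (eq_trans (eq_sym (is_RInt_gen_unique _ _ H3)) (is_RInt_gen_unique _ _ H4)) as E3.
  unfold minus, scal, plus, opp, mult in E3; simpl in E3; unfold mult in E3; simpl in E3. lra.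
Qed.

Lemma Gamma_integral_1 : Gamma_integral 1 = 1.
Proof.
  destruct (Gamma_integral_correct 1 Rlt_0_1) as [H0 _].
  assert (H1 : is_RInt_gen (gamma_density 1) (at_right 0) (Rbar_locally p_infty) (0 - (- 1))).
  { assert (Hc : forall t, 0 < t -> is_derive (fun t => - exp (- t)) t (gamma_density 1 t)).
    { intros t Ht. unfold gamma_density. rewrite Rminus_diag, Rpower_O by easy.
      auto_derive; [easy | ring]. }
    apply is_RInt_gen_antiderivative with (H := fun t => - exp (- t)); trivial.
    - intros t Ht. apply gamma_density_continuous, Ht.
    - replace (- 1) with (- exp (- 0)) by (rewrite Ropp_0, exp_0; ring).
      apply (continuous_at_right (fun t => - exp (- t)) 0).
      apply (continuous_derivable (fun t => - exp (- t))). auto_derive. easy.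
    - intros P [eps HP]. exists (- ln eps). intros t Ht. apply HP.
      apply Rabs_ball; simpl.
      rewrite Rminus_0_r, Rabs_Ropp, Rabs_pos_eq by (left; apply exp_pos).
      rewrite <- (exp_ln eps) by apply cond_pos. apply exp_increasing. lra. }
  pose proof (eq_trans (eq_sym (is_RInt_gen_unique _ _ H0)) (is_RInt_gen_unique _ _ H1)) as E0. lra.
Qed.

(** Weighted arithmetic-geometric mean inequality. With L = ln y, add 1 - d times e^(-dL) >= 1 - dL
    and d times e^((1-d)L) >= 1 + (1-d)L, both multiplied by e^(dL); the terms linear in L
    cancel. *)
Lemma Rpower_le_affine (y d : R) : 0 < y -> 0 <= d <= 1 -> Rpower y d <= 1 - d + d * y.
Proof.
  intros Hy Hd. unfold Rpower. set (L := ln y).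
  assert (Ey : y = exp L) by (symmetry; apply exp_ln, Hy). clearbody L.
  pose proof (exp_ineq1_le (- (d * L))) as H0.
  pose proof (exp_ineq1_le ((1 - d) * L)) as H1.
  pose proof (exp_pos (d * L)) as Hp.
  apply Rmult_le_compat_l with (r := exp (d * L)) in H0; [|lra].
  apply Rmult_le_compat_l with (r := exp (d * L)) in H1; [|lra].
  rewrite <- exp_plus in H0, H1.
  replace (d * L + - (d * L)) with 0 in H0 by ring. rewrite exp_0 in H0.
  replace (d * L + (1 - d) * L) with L in H1 by ring.
  apply Rmult_le_compat_l with (r := 1 - d) in H0; [|lra].
  apply Rmult_le_compat_l with (r := d) in H1; [|lra]. rewrite Ey. nra.
Qed.

(** Wendel's inequality: integrate (t/x)^d <= 1 - d + d t/x against the density of order x. Since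
    Gamma(x+1) = x Gamma(x), the right side integrates to Gamma(x). *)
Lemma Gamma_integral_upper (x d : R) : 0 < x -> 0 <= d <= 1 ->
  Gamma_integral (x + d) <= Rpower x d * Gamma_integral x.
Proof.
  intros Hx Hd.
  destruct (Gamma_integral_correct x Hx) as [H0 _].
  destruct (Gamma_integral_correct (x + 1) ltac:(lra)) as [H1 _].
  destruct (Gamma_integral_correct (x + d) ltac:(lra)) as [H2 _].
  pose proof (is_RInt_gen_scal _ (Rpower x d * (1 - d)) _ H0) as H3.
  pose proof (is_RInt_gen_scal _ (Rpower x d * d / x) _ H1) as H4.
  pose proof (is_RInt_gen_plus _ _ _ _ H3 H4) as H5.
  eapply is_RInt_gen_le_pos in H5; [| | exact H2].
  - unfold scal, plus, mult in H5; simpl in H5; unfold mult in H5; simpl in H5.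
    rewrite Gamma_integral_succ in H5 by easy.
    eapply Rle_trans; [exact H5|]. right. field. lra.
  - intros t Ht. rewrite gamma_density_succ by easy.
    unfold scal, plus, mult; simpl; unfold mult; simpl.
    replace (gamma_density (x + d) t) with (Rpower t d * gamma_density x t).
    2: { unfold gamma_density. replace (x + d - 1) with (d + (x - 1)) by ring.
      rewrite Rpower_plus. ring. }
    replace (_ + _) with (Rpower x d * (1 - d + d * (t / x)) * gamma_density x t) by (field; lra).
    apply Rmult_le_compat_r; [left; apply gamma_density_pos|].
    replace t with (x * (t / x)) at 1 by (field; lra).
    rewrite <- Rpower_mult_distr by (try apply Rdiv_lt_0_compat; lra).
    apply Rmult_le_compat_l; [left; apply exp_pos|].
    apply Rpower_le_affine; trivial. apply Rdiv_lt_0_compat; lra.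
Qed.

(** * Pochhammer symbols and Gamma off its poles *)

Lemma pochhammer_add (a : R) (m n : nat) :
  pochhammer a (m + n) = pochhammer a m * pochhammer (a + INR m) n.
Proof.
  induction n as [|n IH].
  - rewrite Nat.add_0_r. simpl. ring.
  - rewrite Nat.add_succ_r. simpl pochhammer. rewrite IH, plus_INR. ring.
Qed.

Lemma pochhammer_pos (a : R) (k : nat) : 0 < a -> 0 < pochhammer a k.
Proof.
  intros Ha. induction k as [|k IH]; simpl; [lra|].
  pose proof (pos_INR k). apply Rmult_lt_0_compat; lra.
Qed.

Lemma Gamma_integral_shift (x : R) (n : nat) : 0 < x ->
  Gamma_integral (x + INR n) = pochhammer x n * Gamma_integral x.
Proof.
  intros Hx. induction n as [|n IH].
  - simpl. rewrite Rplus_0_r. ring.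
  - rewrite S_INR. simpl pochhammer. rewrite <- Rplus_assoc, Gamma_integral_succ, IH. ring.
    pose proof (pos_INR n). lra.
Qed.

Lemma Gamma_pos_integral (x : R) : 0 < x -> Gamma x = Gamma_integral x.
Proof.
  intros Hx. unfold Gamma.
  replace (Z.to_nat (up (- x))) with 0%nat.
  - simpl. rewrite Rplus_0_r. field.
  - destruct (archimed (- x)) as [_ H].
    assert (H1 : IZR (up (- x)) < IZR 1) by (simpl; lra).
    apply lt_IZR in H1. lia.
Qed.

Definition Gamma_pole (x : R) : Prop := exists n : nat, x = - INR n.

Lemma pochhammer_neq_0 (x : R) (k : nat) : ~ Gamma_pole x -> pochhammer x k <> 0.
Proof.
  intros Hx. induction k as [|k IH]; simpl; [lra|].
  apply Rmult_integral_contrapositive_currified; trivial.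
  intros H. apply Hx. exists k. lra.
Qed.

(** Independence of the shift chosen in the definition of [Gamma]: two admissible shifts are
    compared through their sum. *)
Lemma Gamma_eq_shift (x : R) (n : nat) : ~ Gamma_pole x -> 0 < x + INR n ->
  Gamma x = Gamma_integral (x + INR n) / pochhammer x n.
Proof.
  intros Hx Hn. unfold Gamma. set (m := Z.to_nat (up (- x))).
  assert (Hm : 0 < x + INR m).
  { destruct (archimed (- x)) as [H _]. unfold m. rewrite INR_IZR_INZ.
    assert (IZR (up (- x)) <= IZR (Z.of_nat (Z.to_nat (up (- x))))) by (apply IZR_le; lia).
    lra. }
  clearbody m.
  assert (Hw : forall i j, 0 < x + INR i ->
    Gamma_integral (x + INR i) / pochhammer x i = Gamma_integral (x + INR (i + j)) / pochhammer x (i + j)).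
  { intros i j Hi. rewrite plus_INR, <- Rplus_assoc, (Gamma_integral_shift (x + INR i) j), pochhammer_add by easy.
    field. split; [| apply pochhammer_neq_0, Hx].
    apply Rgt_not_eq, pochhammer_pos, Hi. }
  rewrite (Hw m n), (Hw n m), Nat.add_comm by easy. reflexivity.
Qed.

Lemma Gamma_pole_succ (x : R) : ~ Gamma_pole x -> ~ Gamma_pole (x + 1).
Proof. intros H [n Hn]. apply H. exists (S n). rewrite S_INR. lra. Qed.

Lemma Gamma_pole_add (x : R) (n : nat) : ~ Gamma_pole x -> ~ Gamma_pole (x + INR n).
Proof. intros H [k Hk]. apply H. exists (n + k)%nat. rewrite plus_INR. lra. Qed.

Lemma Gamma_pole_pos (x : R) : 0 < x -> ~ Gamma_pole x.
Proof. intros H [n Hn]. pose proof (pos_INR n). lra. Qed.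

Lemma exists_nat_add_pos (x : R) : exists n, 0 < x + INR n.
Proof.
  destruct (INR_unbounded (- x)) as [n Hn]. exists n. lra.
Qed.

Lemma Gamma_succ (x : R) : ~ Gamma_pole x -> Gamma (x + 1) = x * Gamma x.
Proof.
  intros Hx. destruct (exists_nat_add_pos x) as [n Hn].
  rewrite (Gamma_eq_shift x (S n)) by (trivial; rewrite S_INR; lra).
  rewrite (Gamma_eq_shift (x + 1) n) by (try lra; apply Gamma_pole_succ, Hx).
   change (S n) with (1 + n)%nat. rewrite (pochhammer_add x 1 n). change (1 + n)%nat with (S n). simpl (pochhammer x 1). rewrite S_INR. change (INR 1) with 1.
    replace (x + 1 + INR n) with (x + (INR n + 1)) by ring.
    field. split.
    + apply pochhammer_neq_0, Gamma_pole_succ, Hx.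
    + intros H. apply Hx. exists 0%nat. simpl. lra.
Qed.

Lemma Gamma_shift (x : R) (n : nat) : ~ Gamma_pole x ->
  Gamma (x + INR n) = pochhammer x n * Gamma x.
Proof.
  intros Hx. induction n as [|n IH].
  - simpl. rewrite Rplus_0_r. ring.
  - rewrite S_INR. simpl pochhammer. rewrite <- Rplus_assoc, Gamma_succ, IH. ring.
    apply Gamma_pole_add, Hx.
Qed.

Lemma Gamma_pos (x : R) : 0 < x -> 0 < Gamma x.
Proof. intros Hx. rewrite Gamma_pos_integral by easy. apply Gamma_integral_pos, Hx. Qed.

Lemma Gamma_neq_0 (x : R) : ~ Gamma_pole x -> Gamma x <> 0.
Proof.
  intros Hx. destruct (exists_nat_add_pos x) as [n Hn].
  pose proof (Gamma_shift x n Hx) as E. pose proof (Gamma_pos _ Hn). intros H0.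
  rewrite H0, Rmult_0_r in E. lra.
Qed.

Lemma Gamma_1 : Gamma 1 = 1.
Proof. rewrite Gamma_pos_integral by lra. apply Gamma_integral_1. Qed.

Lemma Gamma_upper (x d : R) : 0 < x -> 0 <= d <= 1 -> Gamma (x + d) <= Rpower x d * Gamma x.
Proof.
  intros Hx Hd. rewrite !Gamma_pos_integral by lra. apply Gamma_integral_upper; trivial.
Qed.

(** The upper bound, started at x + d and run over the remaining distance 1 - d to x + 1. *)
Lemma Gamma_lower (x d : R) : 0 < x -> 0 <= d <= 1 ->
  x * Gamma x <= Rpower (x + d) (1 - d) * Gamma (x + d).
Proof.
  intros Hx Hd. rewrite <- Gamma_succ by (apply Gamma_pole_pos; lra).
  replace (x + 1) with (x + d + (1 - d)) by ring. apply Gamma_upper; lra.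
Qed.

(** * The digamma function *)

Fixpoint harmonic (x : R) (n : nat) : R :=
  match n with
  | O => 0
  | S n => harmonic x n + / (x + INR n)
  end.

(** For x > 0 this is the logarithm of the Pochhammer symbol, kept as a sum so that it
    differentiates termwise to [harmonic]. *)
Fixpoint sum_ln (x : R) (n : nat) : R :=
  match n with
  | O => 0
  | S n => sum_ln x n + ln (x + INR n)
  end.

Lemma is_derive_sum_ln (x : R) (n : nat) : 0 < x ->
  is_derive (fun y => sum_ln y n) x (harmonic x n).
Proof.
  intros Hx. induction n as [|n IH]; simpl.
  - apply (@is_derive_const R_AbsRing R_NormedModule).
  - apply (is_derive_plus (fun y => sum_ln y n) (fun y => ln (y + INR n))); trivial.
    pose proof (pos_INR n). auto_derive; [lra | field; lra].
Qed.

Lemma ln_le_tangent (y z : R) : 0 < y -> 0 < z -> ln z <= ln y + (z - y) / y.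
Proof.
  intros Hy Hz. replace z with (y * (z / y)) at 1 by (field; lra).
  assert (0 < z / y) by (apply Rdiv_lt_0_compat; lra).
  rewrite ln_mult by easy. pose proof (ln_le_sub_1 (z / y) ltac:(easy)).
  replace ((z - y) / y) with (z / y - 1) by (field; lra). lra.
Qed.

Lemma ln_Gamma_shift (x : R) (n : nat) : 0 < x ->
  ln (Gamma (x + INR n)) = ln (Gamma x) + sum_ln x n.
Proof.
  intros Hx. induction n as [|n IH]; simpl sum_ln.
  - simpl. rewrite !Rplus_0_r. reflexivity.
  - pose proof (pos_INR n).
    rewrite S_INR, <- Rplus_assoc, Gamma_succ by (apply Gamma_pole_pos; lra).
    rewrite ln_mult, IH by (try apply Gamma_pos; lra). ring.
Qed.

(** Logarithms of the two Wendel bounds; the term - h / y pays for replacing ln (y + h) by ln y. *)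
Lemma ln_Gamma_increment (y h : R) : 0 < y -> 0 < h < 1 ->
  h * (ln y - / y) <= ln (Gamma (y + h)) - ln (Gamma y) <= h * ln y.
Proof.
  intros Hy Hh. pose proof (Gamma_pos y Hy) as Hg. pose proof (Gamma_pos (y + h) ltac:(lra)) as Hgh.
  split.
  - pose proof (Gamma_lower y h Hy ltac:(lra)) as H.
    apply ln_le in H; [| apply Rmult_lt_0_compat; lra].
    rewrite !ln_mult in H by (trivial; apply exp_pos). unfold Rpower in H. rewrite ln_exp in H.
    pose proof (ln_le_tangent y (y + h) Hy ltac:(lra)) as Ht.
    replace ((y + h - y) / y) with (h * / y) in Ht by (field; lra).
    pose proof (Rinv_0_lt_compat y Hy).
    apply Rmult_le_compat_l with (r := 1 - h) in Ht; [|lra]. nra.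
  - pose proof (Gamma_upper y h Hy ltac:(lra)) as H.
    apply ln_le in H; [|easy].
    rewrite ln_mult in H by (trivial; apply exp_pos). unfold Rpower in H. rewrite ln_exp in H. lra.
Qed.

(** The error does not depend on h, so it survives h -> 0. For negative h the increment starts at y
    + h >= y / 2, which is what raises the constant to 4. *)
Lemma ln_Gamma_quotient (y h : R) : 0 < y -> h <> 0 -> Rabs h < 1 -> Rabs h <= y / 2 ->
  Rabs ((ln (Gamma (y + h)) - ln (Gamma y)) / h - ln y) <= 4 / y.
Proof.
  intros Hy Hh H1 H2. unfold Rdiv. pose proof (Rinv_0_lt_compat y Hy) as Hi.
  destruct (Rdichotomy _ _ Hh) as [Hn | Hp].
  - rewrite Rabs_left in H1, H2 by easy. set (e := - h) in *.
    destruct (ln_Gamma_increment (y + h) e) as [Hl Hu]; [unfold e in *; lra..|].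
    replace (y + h + e) with y in Hl, Hu by (unfold e; ring).
    replace ((ln (Gamma (y + h)) - ln (Gamma y)) * / h) with ((ln (Gamma y) - ln (Gamma (y + h))) / e)
      by (unfold e; field; lra).
    assert (He : 0 < e) by (unfold e; lra).
    assert (Hl' : ln (y + h) - / (y + h) <= (ln (Gamma y) - ln (Gamma (y + h))) / e).
    { apply Rmult_le_reg_l with e; trivial. eapply Rle_trans; [exact Hl|]. right. field. lra. }
    assert (Hu' : (ln (Gamma y) - ln (Gamma (y + h))) / e <= ln (y + h)).
    { apply Rmult_le_reg_l with e; trivial. eapply Rle_trans; [|exact Hu]. right. field. lra. }
    assert (Hyh : y / 2 <= y + h) by (unfold e in *; lra).
    assert (Hii : / (y + h) <= 2 * / y).
    { replace (2 * / y) with (/ (y / 2)) by (field; lra). apply Rinv_le_contravar; lra. }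
    assert (Hlo : ln (y + h) <= ln y) by (apply ln_le; unfold e in *; lra).
    pose proof (ln_le_tangent (y + h) y ltac:(lra) Hy) as Ht.
    replace ((y - (y + h)) / (y + h)) with (e * / (y + h)) in Ht by (unfold e; field; lra).
    assert (e * / (y + h) <= 1 * / (y + h)).
    { apply Rmult_le_compat_r; [left; apply Rinv_0_lt_compat|]; lra. }
    apply Rabs_le. lra.
  - rewrite Rabs_right in H1, H2 by lra.
    destruct (ln_Gamma_increment y h) as [Hl Hu]; [lra..|].
    assert (Hl' : ln y - / y <= (ln (Gamma (y + h)) - ln (Gamma y)) / h).
    { apply Rmult_le_reg_l with h; trivial. eapply Rle_trans; [exact Hl|]. right. field. lra. }
    assert (Hu' : (ln (Gamma (y + h)) - ln (Gamma y)) / h <= ln y).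
    { apply Rmult_le_reg_l with h; trivial. eapply Rle_trans; [|exact Hu]. right. field. lra. }
    unfold Rdiv in *. apply Rabs_le. lra.
Qed.

Lemma Rabs_lt_half_pos (x h : R) : 0 < x -> Rabs h < x / 2 -> 0 < x + h.
Proof. intros Hx H. apply Rabs_def2 in H. lra. Qed.

(** Shifting by n moves the estimate to x + n, where the error 4 / (x + n) tends to 0; one more 1 /
    (x + n) is spent on the difference quotient of [sum_ln]. *)
Lemma ln_Gamma_quotient_approx (x : R) (n : nat) : 0 < x ->
  exists d : posreal, forall h, h <> 0 -> Rabs h < d ->
    Rabs ((ln (Gamma (x + h)) - ln (Gamma x)) / h - (ln (x + INR n) - harmonic x n))
      <= 5 / (x + INR n).
Proof.
  intros Hx. pose proof (pos_INR n) as Hn.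
  assert (Hy : 0 < / (x + INR n)) by (apply Rinv_0_lt_compat; lra).
  pose proof (is_derive_sum_ln x n Hx) as Hd. apply is_derive_Reals in Hd.
  destruct (Hd _ Hy) as [d Hdd].
  assert (Hmin : 0 < Rmin d (Rmin 1 (x / 2))).
  { pose proof (cond_pos d). repeat apply Rmin_case; lra. }
  exists (mkposreal _ Hmin). simpl. intros h Hh Hhd.
  pose proof (Rmin_l d (Rmin 1 (x / 2))). pose proof (Rmin_r d (Rmin 1 (x / 2))).
  pose proof (Rmin_l 1 (x / 2)). pose proof (Rmin_r 1 (x / 2)).
  assert (Hxh : 0 < x + h) by (apply Rabs_lt_half_pos; lra).
  specialize (Hdd h Hh ltac:(lra)).
  pose proof (ln_Gamma_quotient (x + INR n) h ltac:(lra) Hh ltac:(lra) ltac:(lra)) as Hq.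
  replace (x + INR n + h) with (x + h + INR n) in Hq by ring.
  rewrite !ln_Gamma_shift in Hq by easy.
  replace (_ / h - (_ - _)) with
    (((ln (Gamma (x + h)) + sum_ln (x + h) n - (ln (Gamma x) + sum_ln x n)) / h - ln (x + INR n))
     - ((sum_ln (x + h) n - sum_ln x n) / h - harmonic x n)) by (field; easy).
  eapply Rle_trans; [apply Rabs_triang|]. rewrite Rabs_Ropp.
  unfold Rdiv in *. lra.
Qed.

Lemma is_lim_seq_div_shift (c x : R) : 0 < x -> is_lim_seq (fun n => c / (x + INR n)) 0.
Proof.
  intros Hx. replace (Finite 0) with (Rbar_mult c (Finite 0)) by (simpl; f_equal; ring).
  apply (is_lim_seq_scal_l (fun n => / (x + INR n)) c 0).
  apply (is_lim_seq_inv _ p_infty); [| easy].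
  apply (is_lim_seq_plus (fun _ => x) INR x p_infty); [apply is_lim_seq_const | apply is_lim_seq_INR | easy].
Qed.

(* Both sequence members approximate the same difference quotient of [ln Gamma]. *)
Lemma digamma_seq_cauchy (x : R) (n m : nat) : 0 < x ->
  Rabs ((ln (x + INR n) - harmonic x n) - (ln (x + INR m) - harmonic x m))
    <= 5 / (x + INR n) + 5 / (x + INR m).
Proof.
  intros Hx. destruct (ln_Gamma_quotient_approx x n Hx) as [d1 H1].
  destruct (ln_Gamma_quotient_approx x m Hx) as [d2 H2].
  set (h := Rmin d1 d2 / 2).
  assert (Hh : 0 < Rmin d1 d2) by (apply Rmin_case; apply cond_pos).
  pose proof (Rmin_l d1 d2). pose proof (Rmin_r d1 d2).
  assert (Rabs h = h) by (apply Rabs_pos_eq; unfold h; lra).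
  specialize (H1 h ltac:(unfold h; lra) ltac:(rewrite H3; unfold h; lra)).
  specialize (H2 h ltac:(unfold h; lra) ltac:(rewrite H3; unfold h; lra)).
  rewrite Rabs_minus_sym in H1.
  replace (_ - _) with
   ((ln (x + INR n) - harmonic x n - (ln (Gamma (x + h)) - ln (Gamma x)) / h)
     + ((ln (Gamma (x + h)) - ln (Gamma x)) / h - (ln (x + INR m) - harmonic x m))) by ring.
  eapply Rle_trans; [apply Rabs_triang|]. lra.
Qed.

(** Differentiability of Gamma comes out of the proof: the sequence is Cauchy, and because the
    approximation holds for all small h, its limit is the derivative of ln Gamma. *)
Lemma digamma_limit (x : R) : 0 < x ->
  is_lim_seq (fun n => ln (x + INR n) - harmonic x n) (digamma x).
Proof.
  intros Hx. set (L := fun n => ln (x + INR n) - harmonic x n).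
  assert (Hc : ex_finite_lim_seq L).
  { apply ex_lim_seq_cauchy_corr. intros eps.
    assert (He : 0 < eps / 2) by (pose proof (cond_pos eps); lra).
    destruct (proj2 (is_lim_seq_spec _ _) (is_lim_seq_div_shift 5 x Hx) (mkposreal _ He)) as [N HN].
    exists N. intros n m Hn Hm.
    pose proof (HN n Hn) as E1. pose proof (HN m Hm) as E2. simpl in E1, E2.
    rewrite Rminus_0_r in E1, E2.
    eapply Rle_lt_trans; [apply digamma_seq_cauchy, Hx|].
    pose proof (Rle_abs (5 / (x + INR n))). pose proof (Rle_abs (5 / (x + INR m))). lra. }
  destruct Hc as [l Hl].
  assert (Hd : is_derive (fun y => ln (Gamma y)) x l).
  { apply is_derive_Reals. intros eps Heps.
    destruct (proj2 (is_lim_seq_spec _ _) (is_lim_seq_div_shift 5 x Hx) (mkposreal (eps / 2) ltac:(lra))) as [N HN].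
    destruct (proj2 (is_lim_seq_spec _ _) Hl (mkposreal (eps / 2) ltac:(lra))) as [M HM].
    set (n := max N M). specialize (HN n ltac:(lia)). specialize (HM n ltac:(lia)). simpl in HN, HM.
    rewrite Rminus_0_r in HN. pose proof (Rle_abs (5 / (x + INR n))).
    destruct (ln_Gamma_quotient_approx x n Hx) as [d Hdd]. exists d. intros h Hh Hhd.
    specialize (Hdd h Hh Hhd). fold (L n) in Hdd.
    replace (_ - l) with (((ln (Gamma (x + h)) - ln (Gamma x)) / h - L n) + (L n - l)) by ring.
    eapply Rle_lt_trans; [apply Rabs_triang|]. lra. }
  assert (Hg : is_derive Gamma x (Gamma x * l)).
  { apply is_derive_ext_loc with (fun y => exp (ln (Gamma y))).
    - exists (mkposreal x Hx). intros y Hy. apply exp_ln, Gamma_pos.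
      apply ball_Rabs in Hy; simpl in Hy.
      apply Rabs_def2 in Hy. lra.
    - replace (Gamma x * l) with (scal l (exp (ln (Gamma x)))).
      + apply (is_derive_comp exp (fun y => ln (Gamma y))); trivial. apply is_derive_exp.
      + rewrite exp_ln by apply Gamma_pos, Hx. unfold scal; simpl; unfold mult; simpl. ring. }
  unfold digamma. rewrite (is_derive_unique _ _ _ Hg).
  replace (Gamma x * l / Gamma x) with l by (field; apply Rgt_not_eq, Gamma_pos, Hx).
  exact Hl.
Qed.

(** * The reflection formula *)

(* Integration by parts relates [cos_moment (S m) x] to [cos_moment m x]; this recursion produces the
   factors of Euler's product for the sine. *)
Definition cos_moment (m : nat) (x : R) : R :=
  RInt (fun t => cos t ^ (2 * m) * cos (2 * x * t)) 0 (PI / 2).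

Lemma ex_RInt_derivable (f : R -> R) (a b : R) : (forall t, ex_derive f t) -> ex_RInt f a b.
Proof.
  intros H. apply (@ex_RInt_continuous R_CompleteNormedModule). intros t _.
  apply continuous_derivable, H.
Qed.

Lemma cos_moment_correct (m : nat) (x : R) :
  is_RInt (fun t => cos t ^ (2 * m) * cos (2 * x * t)) 0 (PI / 2) (cos_moment m x).
Proof. apply (RInt_correct (V := R_CompleteNormedModule)), ex_RInt_derivable. intros t. auto_derive. easy. Qed.

(** Two integrations by parts of cos^n t cos 2xt, with n = k + 2, packed into a single
    antiderivative. It vanishes at 0 and at pi/2. *)
Lemma is_derive_cos_pow_sin (k : nat) (n x t : R) : INR k = n - 2 ->
  is_derive (fun t => n * (cos t ^ S k * sin t * cos (2 * x * t)) - 2 * x * (cos t ^ S (S k) * sin (2 * x * t)))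
    t ((n ^ 2 - 4 * x ^ 2) * (cos t ^ S (S k) * cos (2 * x * t)) - n * (n - 1) * (cos t ^ k * cos (2 * x * t))).
Proof.
  intros Hk. auto_derive; [easy|].
  change (match k with 0%nat => 1 | S _ => INR k + 1 end) with (INR (S k)).
  rewrite S_INR, Hk. pose proof (sin2_cos2 t) as Hs. unfold Rsqr in Hs. simpl pow.
  transitivity ((n ^ 2 * cos t * cos t - 4 * x ^ 2 * cos t * cos t) * cos t ^ k * cos (2 * x * t)
    - n * (n - 1) * cos t ^ k * (cos (2 * x * t)) * (sin t * sin t + cos t * cos t)); [ring|].
  rewrite Hs. ring.
Qed.

Lemma cos_moment_succ (m : nat) (x : R) :
  2 * ((INR m + 1) ^ 2 - x ^ 2) * cos_moment (S m) x = (INR m + 1) * (2 * INR m + 1) * cos_moment m x.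
Proof.
  set (n := 2 * (INR m + 1)).
  set (H := fun t => n * (cos t ^ (S (2 * m)) * sin t * cos (2 * x * t))
     - 2 * x * (cos t ^ (S (S (2 * m))) * sin (2 * x * t))).
  assert (E1 : is_RInt (fun t => (n ^ 2 - 4 * x ^ 2) * (cos t ^ (2 * S m) * cos (2 * x * t))
     - n * (n - 1) * (cos t ^ (2 * m) * cos (2 * x * t))) 0 (PI / 2) (minus (H (PI / 2)) (H 0))).
  { apply (is_RInt_derive H).
    - intros t _. unfold H. replace (2 * S m)%nat with (S (S (2 * m))) by lia.
      apply is_derive_cos_pow_sin. rewrite mult_INR. simpl INR. unfold n. ring.
    - intros t _. apply continuous_derivable. auto_derive. easy. }
  pose proof (is_RInt_scal _ _ _ (n ^ 2 - 4 * x ^ 2) _ (cos_moment_correct (S m) x)) as E2.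
  pose proof (is_RInt_scal _ _ _ (n * (n - 1)) _ (cos_moment_correct m x)) as E3.
  pose proof (is_RInt_minus _ _ _ _ _ _ E2 E3) as E4.
  pose proof (eq_trans (eq_sym (is_RInt_unique _ _ _ _ E1)) (is_RInt_unique _ _ _ _ E4)) as E5.
  unfold H in E5. rewrite cos_PI2, sin_0 in E5. rewrite !pow_i in E5 by lia.
  rewrite !Rmult_0_r, sin_0 in E5.
  unfold minus, plus, opp, scal in E5; simpl in E5; unfold mult in E5; simpl in E5.
  unfold n in E5. nra.
Qed.

Lemma cos_moment_0 (x : R) : x <> 0 -> cos_moment 0 x = sin (PI * x) / (2 * x).
Proof.
  intros Hx. apply is_RInt_unique.
  replace (sin (PI * x) / (2 * x)) with
    (minus (sin (2 * x * (PI / 2)) / (2 * x)) (sin (2 * x * 0) / (2 * x))).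
  - apply (is_RInt_derive (fun t => sin (2 * x * t) / (2 * x))).
    + intros t _. auto_derive; [lra|]. simpl. field. exact Hx.
    + intros t _. apply continuous_derivable. auto_derive. easy.
  - rewrite Rmult_0_r, sin_0. replace (2 * x * (PI / 2)) with (PI * x) by field.
    unfold minus, plus, opp; simpl. field. exact Hx.
Qed.

Lemma cos_moment_0_0 : cos_moment 0 0 = PI / 2.
Proof.
  unfold cos_moment. rewrite (RInt_ext _ (fun _ => 1)).
  - rewrite RInt_const. unfold scal; simpl; unfold mult; simpl. ring.
  - intros t _. rewrite Rmult_0_r, Rmult_0_l, cos_0. simpl. ring.
Qed.

Lemma cos_moment_pos (m : nat) : 0 < cos_moment m 0.
Proof.
  induction m as [|m IH].
  - rewrite cos_moment_0_0. pose proof PI_RGT_0. lra.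
  - pose proof (cos_moment_succ m 0) as E. pose proof (pos_INR m) as Hm.
    assert (0 < (INR m + 1) * (2 * INR m + 1) * cos_moment m 0) by (repeat apply Rmult_lt_0_compat; lra).
    assert (0 < 2 * ((INR m + 1) ^ 2 - 0 ^ 2)) by nra.
    apply Rnot_le_lt. intros Hle. nra.
Qed.

Lemma mul_cos_le_sin (t : R) : 0 <= t -> t <= PI / 2 -> t * cos t <= sin t.
Proof.
  intros H0 H1.
  destruct (MVT_gen (fun u => sin u - u * cos u) 0 t (fun u => u * sin u)) as [c [Hc E]].
  - intros u _. auto_derive; [easy | ring].
  - intros u _. apply derivable_continuous_pt. auto_derive_fun (fun u => sin u - u * cos u); intros HH.
    exists (1 * cos u - (1 * cos u + u * (1 * - sin u))). apply is_derive_Reals. auto_derive; [easy | ring].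
  - rewrite Rmin_left, Rmax_right in Hc by lra.
    rewrite sin_0 in E. assert (0 <= sin c) by (apply sin_ge_0; lra).
    assert (0 <= c * sin c * (t - 0)) by (apply Rmult_le_pos; [apply Rmult_le_pos|]; lra). lra.
Qed.

Lemma cos_sub_1_bound (a : R) : 0 <= 1 - cos (2 * a) <= 2 * a ^ 2.
Proof.
  rewrite cos_2a_sin. replace (1 - (1 - 2 * sin a * sin a)) with (2 * (sin a) ^ 2) by ring.
  assert (sin a ^ 2 <= a ^ 2).
  { rewrite <- (pow2_abs (sin a)), <- (pow2_abs a). apply pow_incr. split; [apply Rabs_pos|].
    destruct (Rle_or_lt 0 a) as [Ha | Ha].
    - rewrite (Rabs_pos_eq a) by easy. apply Rabs_le.
      destruct (Req_dec a 0) as [-> | Hn]; [rewrite sin_0; lra|].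
      pose proof (sin_lt_x a ltac:(lra)). split; [|lra].
      destruct (Rle_or_lt a PI) as [Hp | Hp].
      + pose proof (sin_ge_0 a Ha Hp). lra.
      + pose proof (SIN_bound a). pose proof PI2_1. lra.
    - rewrite (Rabs_left a) by easy. rewrite <- Rabs_Ropp, <- sin_neg. apply Rabs_le.
      pose proof (sin_lt_x (- a) ltac:(lra)). split; [|lra].
      destruct (Rle_or_lt (- a) PI) as [Hp | Hp].
      + pose proof (sin_ge_0 (- a) ltac:(lra) Hp). lra.
      + pose proof (SIN_bound (- a)). pose proof PI2_1. lra. }
  pose proof (pow2_ge_0 (sin a)). lra.
Qed.

(** Use 1 - cos 2xt <= 2 x^2 t^2, then trade t^2 cos^2 t for sin^2 t = 1 - cos^2 t. This expresses
    the error through moments at x = 0, whose ratio the recursion gives exactly. *)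
Lemma cos_moment_diff (m : nat) (x : R) :
  Rabs (cos_moment (S m) x - cos_moment (S m) 0) <= 2 * x ^ 2 * (cos_moment m 0 - cos_moment (S m) 0).
Proof.
  pose proof (is_RInt_minus _ _ _ _ _ _ (cos_moment_correct (S m) x) (cos_moment_correct (S m) 0)) as H1.
  pose proof (is_RInt_scal _ _ _ (2 * x ^ 2) _
    (is_RInt_minus _ _ _ _ _ _ (cos_moment_correct m 0) (cos_moment_correct (S m) 0))) as H2.
  apply (norm_RInt_le (V := R_NormedModule)) with (3 := H1) (4 := H2).
  - pose proof PI_RGT_0. lra.
  - intros t Ht. unfold norm, minus, plus, opp, scal; simpl; unfold abs; simpl; unfold mult; simpl.
    rewrite !Rmult_0_r, !Rmult_0_l, cos_0.
    replace (m + S (m + 0))%nat with (S (m + (m + 0))) by lia. simpl.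
    set (c := cos t ^ _).
    replace (cos t * (cos t * c) * cos (2 * x * t) + - (cos t * (cos t * c) * 1))
      with (- (cos t * cos t * c * (1 - cos (2 * (x * t))))).
    2: { replace (2 * (x * t)) with (2 * x * t) by ring. ring. }
    assert (Hc : 0 <= c).
    { unfold c. replace (m + (m + 0))%nat with (2 * m)%nat by lia. rewrite pow_mult.
      apply pow_le, pow2_ge_0. }
    pose proof (cos_sub_1_bound (x * t)) as Hb. pose proof (Rle_0_sqr (cos t)) as Hcc. unfold Rsqr in Hcc.
    rewrite Rabs_Ropp, Rabs_pos_eq by (apply Rmult_le_pos; [apply Rmult_le_pos|]; lra).
    pose proof (mul_cos_le_sin t ltac:(lra) ltac:(lra)) as Hm.
    assert (Hcp : 0 <= cos t) by (apply cos_ge_0; pose proof PI_RGT_0; lra).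
    assert (Hm2 : (t * cos t) ^ 2 <= sin t ^ 2).
    { apply pow_incr. split; [apply Rmult_le_pos; lra | exact Hm]. }
    pose proof (sin2_cos2 t) as Hs. unfold Rsqr in Hs.
    replace (x * (x * 1)) with (x ^ 2) by ring.
    apply Rle_trans with (cos t * cos t * c * (2 * (x * t) ^ 2)).
    + apply Rmult_le_compat_l; [apply Rmult_le_pos; lra | lra].
    + replace (cos t * cos t * c * (2 * (x * t) ^ 2)) with (2 * x ^ 2 * c * ((t * cos t) ^ 2)) by ring.
      replace (2 * x ^ 2 * (c * 1 + - (cos t * (cos t * c) * 1))) with (2 * x ^ 2 * c * (1 - cos t * cos t)) by ring.
      apply Rmult_le_compat_l; [pose proof (pow2_ge_0 x); apply Rmult_le_pos; lra|].
      nra.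
Qed.

Lemma is_lim_seq_one_add (c x : R) : 0 < x -> is_lim_seq (fun n => 1 + c / (x + INR n)) 1.
Proof.
  intros Hx. replace (Finite 1) with (Finite (1 + 0)) by (f_equal; ring).
  apply is_lim_seq_plus'; [apply is_lim_seq_const | apply is_lim_seq_div_shift, Hx].
Qed.

Lemma is_lim_seq_one_sub (c x : R) : 0 < x -> is_lim_seq (fun n => 1 - c / (x + INR n)) 1.
Proof.
  intros Hx. replace (Finite 1) with (Finite (1 - 0)) by (f_equal; ring).
  apply is_lim_seq_minus'; [apply is_lim_seq_const | apply is_lim_seq_div_shift, Hx].
Qed.

(** At x = 0 the recursion gives [cos_moment m 0 - cos_moment (S m) 0] as a fraction 1 / (2m + 1) of
    [cos_moment (S m) 0], so the relative error is O(1/m). *)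
Lemma cos_moment_ratio_limit (x : R) :
  is_lim_seq (fun m => cos_moment m x / cos_moment m 0) 1.
Proof.
  apply is_lim_seq_incr_1.
  assert (Hb : forall m, Rabs (cos_moment (S m) x / cos_moment (S m) 0 - 1) <= 2 * x ^ 2 / (1 + INR m)).
  { intros m. pose proof (cos_moment_pos (S m)) as Hp. pose proof (pos_INR m) as Hm.
    replace (_ - 1) with ((cos_moment (S m) x - cos_moment (S m) 0) / cos_moment (S m) 0) by (field; lra).
    unfold Rdiv at 1. rewrite Rabs_mult, (Rabs_pos_eq (/ _)) by (left; apply Rinv_0_lt_compat, Hp).
    apply Rmult_le_reg_r with (cos_moment (S m) 0); trivial.
    rewrite Rmult_assoc, Rinv_l, Rmult_1_r by lra.
    eapply Rle_trans; [apply cos_moment_diff|].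
    pose proof (cos_moment_succ m 0) as E.
    assert (E' : cos_moment m 0 - cos_moment (S m) 0 = cos_moment (S m) 0 / (2 * INR m + 1)).
    { apply Rmult_eq_reg_l with ((INR m + 1) * (2 * INR m + 1)); [| apply Rgt_not_eq; nra].
      rewrite Rmult_minus_distr_l, <- E. field. lra. }
    rewrite E'. unfold Rdiv. rewrite !Rmult_assoc.
    apply Rmult_le_compat_l; [lra|]. apply Rmult_le_compat_l; [apply pow2_ge_0|].
    rewrite Rmult_comm. apply Rmult_le_compat_r; [lra|].
    apply Rinv_le_contravar; lra. }
  apply is_lim_seq_le_le with (u := fun m => 1 - 2 * x ^ 2 / (1 + INR m)) (w := fun m => 1 + 2 * x ^ 2 / (1 + INR m)).
  - intros m. specialize (Hb m). apply Rabs_le_between in Hb. lra.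
  - apply is_lim_seq_one_sub; lra.
  - apply is_lim_seq_one_add; lra.
Qed.

(** Euler's product truncated after m factors with an exact remainder, the moment ratio. Each factor
    is the quotient of the recursion at x and at 0. *)
Lemma sin_product (m : nat) (x : R) : x <> 0 ->
  sin (PI * x) / (PI * x) * pochhammer 1 m ^ 2 =
  pochhammer (1 + x) m * pochhammer (1 - x) m * (cos_moment m x / cos_moment m 0).
Proof.
  intros Hx. pose proof PI_RGT_0 as Hpi. induction m as [|m IH].
  - rewrite cos_moment_0, cos_moment_0_0 by easy. simpl. field. lra.
  - simpl pochhammer.
    replace ((pochhammer 1 m * (1 + INR m)) ^ 2) with (pochhammer 1 m ^ 2 * (1 + INR m) ^ 2) by ring.
    rewrite <- Rmult_assoc, IH.
    pose proof (cos_moment_succ m 0) as E0. pose proof (cos_moment_succ m x) as E1.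
    pose proof (cos_moment_pos m) as P0. pose proof (cos_moment_pos (S m)) as P1. pose proof (pos_INR m) as Hm.
    assert (E0' : cos_moment m 0 = 2 * (INR m + 1) / (2 * INR m + 1) * cos_moment (S m) 0).
    { apply Rmult_eq_reg_l with ((INR m + 1) * (2 * INR m + 1)); [| apply Rgt_not_eq; nra].
      rewrite <- E0. field. lra. }
    assert (E1' : cos_moment m x = 2 * ((INR m + 1) ^ 2 - x ^ 2) / ((INR m + 1) * (2 * INR m + 1)) * cos_moment (S m) x).
    { apply Rmult_eq_reg_l with ((INR m + 1) * (2 * INR m + 1)); [| apply Rgt_not_eq; nra].
      rewrite <- E1. field. lra. }
    rewrite E0', E1'. field. lra.
Qed.

(** Wendel's exponents x and 1 - x add up to 1: with a common base, the two powers combine into one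
    linear factor. *)
Lemma Gamma_ratio_bounds (x : R) (m : nat) : 0 < x < 1 ->
  1 - 1 / (2 + INR m) <= Gamma (1 + x + INR m) * Gamma (1 - x + INR m) / pochhammer 1 m ^ 2
    /\ (m <> O -> Gamma (1 + x + INR m) * Gamma (1 - x + INR m) / pochhammer 1 m ^ 2 <= 1 + 1 / INR m).
Proof.
  intros Hx. pose proof (pos_INR m) as Hm. pose proof (pochhammer_pos 1 m Rlt_0_1) as HP.
  assert (EG : Gamma (1 + INR m) = pochhammer 1 m).
  { rewrite Gamma_shift, Gamma_1 by (apply Gamma_pole_pos; lra). ring. }
  pose proof (Gamma_pos (1 + x + INR m) ltac:(lra)) as G1.
  pose proof (Gamma_pos (1 - x + INR m) ltac:(lra)) as G2.
  assert (HP2 : 0 < pochhammer 1 m ^ 2) by (apply pow_lt, HP).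
  split; [| intros Hm0].
  - pose proof (Gamma_lower (1 + INR m) x ltac:(lra) ltac:(lra)) as L1.
    assert (L2 : Gamma (1 + INR m) <= Rpower (1 - x + INR m) x * Gamma (1 - x + INR m)).
    { pose proof (Gamma_upper (1 - x + INR m) x ltac:(lra) ltac:(lra)) as U.
      replace (1 - x + INR m + x) with (1 + INR m) in U by ring. exact U. }
    replace (1 + INR m + x) with (1 + x + INR m) in L1 by ring. rewrite EG in L1, L2.
    assert (M1 : Rpower (1 + x + INR m) (1 - x) <= Rpower (2 + INR m) (1 - x)) by (apply Rle_Rpower_l; lra).
    assert (M2 : Rpower (1 - x + INR m) x <= Rpower (2 + INR m) x) by (apply Rle_Rpower_l; lra).
    assert (M3 : Rpower (2 + INR m) (1 - x) * Rpower (2 + INR m) x = 2 + INR m).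
    { rewrite <- Rpower_plus. replace (1 - x + x) with 1 by ring. apply Rpower_1. lra. }
    set (A := Gamma (1 + x + INR m)) in *. set (B := Gamma (1 - x + INR m)) in *.
    set (P := pochhammer 1 m) in *.
    assert (N1 : (1 + INR m) * P <= Rpower (2 + INR m) (1 - x) * A).
    { eapply Rle_trans; [exact L1|]. apply Rmult_le_compat_r; lra. }
    assert (N2 : P <= Rpower (2 + INR m) x * B).
    { eapply Rle_trans; [exact L2|]. apply Rmult_le_compat_r; lra. }
    assert (N3 : (1 + INR m) * P * P <= Rpower (2 + INR m) (1 - x) * A * (Rpower (2 + INR m) x * B)).
    { apply Rmult_le_compat; try lra. apply Rmult_le_pos; lra. }
    replace (Rpower (2 + INR m) (1 - x) * A * (Rpower (2 + INR m) x * B)) with ((2 + INR m) * (A * B)) in N3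
      by (rewrite <- M3 at 1; ring).
    apply Rmult_le_reg_r with ((2 + INR m) * P ^ 2); [apply Rmult_lt_0_compat; lra|].
    field_simplify; try lra.
  - assert (Hm1 : 1 <= INR m) by (apply (le_INR 1 m); lia).
    pose proof (Gamma_upper (1 + INR m) x ltac:(lra) ltac:(lra)) as U1.
    pose proof (Gamma_upper (INR m) (1 - x) ltac:(lra) ltac:(lra)) as U2.
    replace (1 + INR m + x) with (1 + x + INR m) in U1 by ring.
    replace (INR m + (1 - x)) with (1 - x + INR m) in U2 by ring.
    assert (EG' : Gamma (INR m) = pochhammer 1 m / INR m).
    { rewrite <- EG. replace (1 + INR m) with (INR m + 1) by ring.
      rewrite Gamma_succ by (apply Gamma_pole_pos; lra). field. lra. }
    rewrite EG in U1. rewrite EG' in U2.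
    set (A := Gamma (1 + x + INR m)) in *. set (B := Gamma (1 - x + INR m)) in *.
    set (P := pochhammer 1 m) in *.
    assert (M1 : Rpower (INR m) (1 - x) <= Rpower (1 + INR m) (1 - x)) by (apply Rle_Rpower_l; lra).
    assert (M3 : Rpower (1 + INR m) (1 - x) * Rpower (1 + INR m) x = 1 + INR m).
    { rewrite <- Rpower_plus. replace (1 - x + x) with 1 by ring. apply Rpower_1. lra. }
    assert (N0 : 0 < P / INR m) by (apply Rdiv_lt_0_compat; lra).
    assert (N2 : B <= Rpower (1 + INR m) (1 - x) * (P / INR m)).
    { eapply Rle_trans; [exact U2|]. apply Rmult_le_compat_r; lra. }
    assert (N3 : A * B <= (Rpower (1 + INR m) x * P) * (Rpower (1 + INR m) (1 - x) * (P / INR m))).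
    { apply Rmult_le_compat; lra. }
    replace ((Rpower (1 + INR m) x * P) * (Rpower (1 + INR m) (1 - x) * (P / INR m)))
      with ((1 + INR m) * (P * (P / INR m))) in N3 by (rewrite <- M3 at 1; ring).
    apply Rmult_le_reg_r with (P ^ 2); [lra|].
    replace (A * B / P ^ 2 * P ^ 2) with (A * B) by (field; lra).
    eapply Rle_trans; [exact N3|]. right. field. lra.
Qed.

(** Two sequences of limit 1 have a product that does not depend on m: the Pochhammer factors in
    [sin_product] are those by which [Gamma_shift] moves 1 + x and 1 - x. *)
Lemma Gamma_reflection_unit (x : R) : 0 < x < 1 ->
  Gamma (1 + x) * Gamma (1 - x) * (sin (PI * x) / (PI * x)) = 1.
Proof.
  intros Hx.
  set (r := fun m => Gamma (1 + x + INR m) * Gamma (1 - x + INR m) / pochhammer 1 m ^ 2).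
  assert (Hr : is_lim_seq r 1).
  { apply is_lim_seq_incr_1.
    apply is_lim_seq_le_le with (u := fun m => 1 - 1 / (3 + INR m)) (w := fun m => 1 + 1 / (1 + INR m)).
    - intros m. destruct (Gamma_ratio_bounds x (S m) Hx) as [H1 H2]. unfold r. split.
      + replace (3 + INR m) with (2 + INR (S m)) by (rewrite S_INR; ring). exact H1.
      + specialize (H2 ltac:(lia)). replace (1 / (1 + INR m)) with (1 / INR (S m)); [exact H2|].
        rewrite S_INR, Rplus_comm. reflexivity.
    - apply is_lim_seq_one_sub; lra.
    - apply is_lim_seq_one_add; lra. }
  pose proof (is_lim_seq_mult' _ _ _ _ Hr (cos_moment_ratio_limit x)) as Hl.
  apply is_lim_seq_ext with (v := fun _ => Gamma (1 + x) * Gamma (1 - x) * (sin (PI * x) / (PI * x))) in Hl.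
  - pose proof (is_lim_seq_unique _ _ Hl) as E. rewrite Lim_seq_const in E. injection E as E. lra.
  - intros m. unfold r. pose proof (pochhammer_pos 1 m Rlt_0_1) as HP.
    rewrite !Gamma_shift by (apply Gamma_pole_pos; lra).
    pose proof (sin_product m x ltac:(lra)) as E.
    apply Rmult_eq_reg_r with (pochhammer 1 m ^ 2); [| apply Rgt_not_eq, pow_lt, HP].
    pose proof (cos_moment_pos m).
    transitivity (Gamma (1 + x) * Gamma (1 - x) * (sin (PI * x) / (PI * x) * pochhammer 1 m ^ 2)); [|ring].
    rewrite E. field. lra.
Qed.

(** Under x -> x + 1 both Gamma(1+x) Gamma(1-x) / x and sin(pi x) change sign, which reduces every x
    to the unit interval. *)
Lemma Gamma_reflection (x : R) : (forall m : Z, x <> IZR m) -> 0 < x ->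
  Gamma (1 + x) * Gamma (1 - x) = PI * x / sin (PI * x) /\ sin (PI * x) <> 0.
Proof.
  intros HZ Hx0. pose proof PI_RGT_0 as Hpi.
  assert (H : forall n x, (forall m : Z, x <> IZR m) -> 0 < x < INR n + 1 ->
     Gamma (1 + x) * Gamma (1 - x) * (sin (PI * x) / (PI * x)) = 1).
  { clear x HZ Hx0. induction n as [|n IH]; intros x HZ Hx.
    - simpl in Hx. apply Gamma_reflection_unit. lra.
    - rewrite S_INR in Hx. destruct (Rlt_or_le x (INR n + 1)) as [Hlt | Hge]; [apply IH; trivial; lra|].
      assert (Hx1 : 0 < x - 1).
      { destruct (Req_dec x 1) as [-> | Hn]; [exfalso; apply (HZ 1%Z); reflexivity|].
        pose proof (pos_INR n). lra. }
      assert (HZ' : forall m : Z, x - 1 <> IZR m).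
      { intros m Hm. apply (HZ (m + 1)%Z). rewrite plus_IZR. lra. }
      apply eq_trans with (2 := IH (x - 1) HZ' ltac:(lra)).
      replace (1 + (x - 1)) with x by ring.
      replace (1 - (x - 1)) with (1 - x + 1) by ring.
      replace (1 + x) with (x + 1) by ring.
      rewrite !Gamma_succ.
      + replace (PI * (x - 1)) with (PI * x - PI) by ring.
        rewrite sin_minus, cos_PI, sin_PI. field.
        repeat split; try lra; replace (PI * x - PI) with (PI * (x - 1)) by ring;
          apply Rmult_integral_contrapositive_currified; lra.
      + intros [k Hk]. apply (HZ (Z.of_nat k + 1)%Z). rewrite plus_IZR, <- INR_IZR_INZ. lra.
      + apply Gamma_pole_pos. lra. }
  destruct (INR_unbounded x) as [n Hn].
  pose proof (H n x HZ ltac:(lra)) as E.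
  assert (Hs : sin (PI * x) <> 0). { intros E0. rewrite E0 in E. unfold Rdiv in E. lra. }
  split; trivial.
  apply Rmult_eq_reg_r with (sin (PI * x) / (PI * x)).
  - rewrite E. field. lra.
  - intros E0. rewrite E0 in E. lra.
Qed.

(** * Complex power series with real coefficients *)

Lemma im_le_Cmod (c : C) : Rabs (Im c) <= Cmod c.
Proof. eapply Rle_trans; [apply Rmax_r | apply Rmax_Cmod]. Qed.

Lemma Cmod_le_sum (c : C) : Cmod c <= Rabs (Re c) + Rabs (Im c).
Proof.
  destruct c as [x y]. replace (x, y) with (RtoC x + RtoC y * Ci)%C.
  - eapply Rle_trans; [apply Cmod_triangle|].
    rewrite Cmod_mult, Cmod_Ci, !Cmod_R. rewrite re_plus, im_plus, re_scal_l, im_scal_l. simpl.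
    right. rewrite !Rmult_0_r, !Rmult_1_r, Rplus_0_r, Rplus_0_l. reflexivity.
  - unfold Cplus, Cmult, RtoC, Ci; simpl. f_equal; ring.
Qed.

Lemma Series_zero (u : nat -> R) : (forall k, u k = 0) -> Series u = 0.
Proof.
  intros H. transitivity (Series (fun k => 0 * u k)).
  - apply Series_ext. intros k. rewrite H. ring.
  - rewrite Series_scal_l. ring.
Qed.

Lemma C_eq (a b : C) : Re a = Re b -> Im a = Im b -> a = b.
Proof. destruct a, b. simpl. congruence. Qed.

Definition is_CSeries (u : nat -> C) (l : C) : Prop :=
  is_series (fun k => Re (u k)) (Re l) /\ is_series (fun k => Im (u k)) (Im l).

Lemma is_CSeries_unique (u : nat -> C) (l : C) : is_CSeries u l -> CSeries u = l.
Proof.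
  intros [H1 H2]. unfold CSeries. rewrite (is_series_unique _ _ H1), (is_series_unique _ _ H2).
  destruct l; reflexivity.
Qed.

Lemma is_CSeries_ext (u v : nat -> C) (l : C) : (forall k, u k = v k) -> is_CSeries u l -> is_CSeries v l.
Proof.
  intros E [H1 H2]. split; [eapply is_series_ext, H1 | eapply is_series_ext, H2];
  intros k; simpl; rewrite E; reflexivity.
Qed.

Lemma CSeries_ext (u v : nat -> C) : (forall k, u k = v k) -> CSeries u = CSeries v.
Proof. intros E. unfold CSeries. f_equal; apply Series_ext; intros k; rewrite E; reflexivity. Qed.

Lemma is_CSeries_abs (u : nat -> C) : ex_series (fun k => Cmod (u k)) -> is_CSeries u (CSeries u).
Proof.
  intros H. split; simpl; apply Series_correct.
  - apply ex_series_le_Rabs with (2 := H). intros k. apply re_le_Cmod.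
  - apply ex_series_le_Rabs with (2 := H). intros k. apply im_le_Cmod.
Qed.

(** The factor 2 comes from bounding the real and imaginary parts separately. *)
Lemma Cmod_CSeries_le (u : nat -> C) (b : nat -> R) (S : R) :
  (forall k, Cmod (u k) <= b k) -> is_series b S -> Cmod (CSeries u) <= 2 * S.
Proof.
  intros Hu Hb.
  assert (H : forall v : nat -> R, (forall k, Rabs (v k) <= Cmod (u k)) -> Rabs (Series v) <= S).
  { intros v Hv. rewrite <- (is_series_unique _ _ Hb).
    assert (Hv' : forall k, Rabs (v k) <= b k) by (intros k; eapply Rle_trans; [apply Hv | apply Hu]).
    assert (Ha : ex_series (fun k => Rabs (v k))).
    { apply ex_series_le_Rabs with b; [| eexists; exact Hb].
      intros k. unfold norm; simpl. unfold abs; simpl. rewrite Rabs_Rabsolu. apply Hv'. }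
    eapply Rle_trans; [apply Series_Rabs, Ha|].
    apply Series_le; [| eexists; exact Hb]. intros k. split; [apply Rabs_pos | apply Hv']. }
  eapply Rle_trans; [apply Cmod_le_sum|]. simpl.
  pose proof (H _ (fun k => re_le_Cmod (u k))). pose proof (H _ (fun k => im_le_Cmod (u k))). lra.
Qed.

Lemma is_CSeries_plus (u v : nat -> C) (a b : C) : is_CSeries u a -> is_CSeries v b ->
  is_CSeries (fun k => (u k + v k)%C) (a + b)%C.
Proof.
  intros [H1 H2] [H3 H4]. split.
  - exact (is_series_plus _ _ _ _ H1 H3).
  - exact (is_series_plus _ _ _ _ H2 H4).
Qed.

Lemma is_CSeries_scal (c : C) (u : nat -> C) (a : C) : is_CSeries u a ->
  is_CSeries (fun k => (c * u k)%C) (c * a)%C.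
Proof.
  intros [H1 H2]. split.
  - apply is_series_ext with (fun k => minus (scal (Re c) (Re (u k))) (scal (Im c) (Im (u k)))).
    + intros k. rewrite re_mult. reflexivity.
    + rewrite re_mult. apply (is_series_minus (V := R_NormedModule)); apply (is_series_scal (V := R_NormedModule)); easy.
  - apply is_series_ext with (fun k => plus (scal (Re c) (Im (u k))) (scal (Im c) (Re (u k)))).
    + intros k. rewrite im_mult. reflexivity.
    + rewrite im_mult. apply (is_series_plus (V := R_NormedModule)); apply (is_series_scal (V := R_NormedModule)); easy.
Qed.

Lemma is_CSeries_shift (u : nat -> C) (a : C) : u O = RtoC 0 ->
  is_CSeries (fun k => u (S k)) a -> is_CSeries u a.
Proof.
  intros H0 [H1 H2]. split; apply (is_series_decr_1 (V := R_NormedModule)).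
  - rewrite H0. simpl. unfold plus, opp; simpl. rewrite Ropp_0, Rplus_0_r. exact H1.
  - rewrite H0. simpl. unfold plus, opp; simpl. rewrite Ropp_0, Rplus_0_r. exact H2.
Qed.

(** Stated on absolute values at every radius, so that polynomial factors in k can be absorbed by
    enlarging the radius. *)
Definition entire (a : nat -> R) : Prop :=
  forall r, 0 <= r -> ex_series (fun k => Rabs (a k) * r ^ k).

Definition CPSeries (a : nat -> R) (w : C) : C := CSeries (fun k => (RtoC (a k) * w ^ k)%C).

Lemma CPSeries_ext (a b : nat -> R) (w : C) : (forall k, a k = b k) -> CPSeries a w = CPSeries b w.
Proof. intros E. apply CSeries_ext. intros k. rewrite E. reflexivity. Qed.

Lemma Cmod_coef_pow (c : R) (w : C) (k : nat) : Cmod (RtoC c * w ^ k) = Rabs c * Cmod w ^ k.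
Proof. rewrite Cmod_mult, Cmod_R, Cmod_pow. reflexivity. Qed.

Lemma is_CSeries_CPSeries (a : nat -> R) (w : C) : entire a -> is_CSeries (fun k => (RtoC (a k) * w ^ k)%C) (CPSeries a w).
Proof.
  intros Ha. apply is_CSeries_abs. apply ex_series_ext with (2 := Ha (Cmod w) (Cmod_ge_0 w)).
  intros k. symmetry. apply Cmod_coef_pow.
Qed.

(** Ratio test without division: past index N + M, with M > 2 r, each term is at most half of the
    previous one. *)
Lemma entire_ratio (a : nat -> R) (N : nat) :
  (forall k, (N <= k)%nat -> Rabs (a (S k)) * (INR k - INR N) <= Rabs (a k)) -> entire a.
Proof.
  intros H r Hr. destruct (INR_unbounded (2 * r)) as [M HM].
  apply (ex_series_incr_n (V := R_NormedModule) _ (N + M)).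
  set (b := fun k => Rabs (a k) * r ^ k).
  apply ex_series_le_Rabs with (fun j => scal (b (N + M)%nat) ((1 / 2) ^ j)).
  - intros j. unfold norm; simpl. unfold abs; simpl. fold (b (N + M + j)%nat).
    assert (Hb : forall k, 0 <= b k) by (intros k; apply Rmult_le_pos; [apply Rabs_pos | apply pow_le, Hr]).
    rewrite Rabs_pos_eq by apply Hb. induction j as [|j IH].
    + rewrite Nat.add_0_r. unfold scal; simpl; unfold mult; simpl. lra.
    + rewrite Nat.add_succ_r.
      assert (Hs : b (S (N + M + j)) <= 1 / 2 * b (N + M + j)%nat).
      { unfold b. specialize (H (N + M + j)%nat ltac:(lia)).
        rewrite 2!plus_INR in H. simpl pow.
        assert (Hp : 0 <= r ^ (N + M + j)) by (apply pow_le, Hr).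
        pose proof (pos_INR j).
        assert (Hk : Rabs (a (S (N + M + j))) * (2 * r) <= Rabs (a (N + M + j)%nat)).
        { eapply Rle_trans; [|exact H]. apply Rmult_le_compat_l; [apply Rabs_pos | lra]. }
        apply Rmult_le_compat_r with (r := r ^ (N + M + j)) in Hk; trivial. lra. }
      unfold scal in *; simpl in *; unfold mult in *; simpl in *. lra.
  - apply (ex_series_scal (V := R_NormedModule)). apply ex_series_geom. rewrite Rabs_pos_eq; lra.
Qed.

Lemma INR_le_pow2 (k : nat) : INR k <= 2 ^ k.
Proof.
  induction k as [|k IH]; [simpl; lra|]. rewrite S_INR. simpl.
  assert (1 <= 2 ^ k) by (apply pow_R1_Rle; lra). lra.
Qed.

(** The bound k + 1 <= 2^(k+1) hides the factor k + 1 in a doubled radius; r + 1 replaces r so that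
    one more power does no harm. *)
Lemma entire_derive (a : nat -> R) : entire a -> entire (PS_derive a).
Proof.
  intros Ha r Hr.
  assert (Hs : ex_series (fun k => Rabs (a (S k)) * (2 * (r + 1)) ^ S k)).
  { apply (ex_series_incr_1 (V := R_NormedModule) (fun k => Rabs (a k) * (2 * (r + 1)) ^ k)). apply Ha. lra. }
  apply ex_series_le_Rabs with (2 := Hs).
  intros k. unfold norm; simpl. unfold abs; simpl.
  change (match k with 0%nat => 1 | S _ => INR k + 1 end) with (INR (S k)).
  unfold PS_derive. change (2 * (r + 1) * (2 * (r + 1)) ^ k) with ((2 * (r + 1)) ^ S k).
  rewrite Rabs_pos_eq by (apply Rmult_le_pos; [apply Rabs_pos | apply pow_le, Hr]).
  rewrite Rabs_mult, (Rabs_pos_eq (INR _)) by apply pos_INR.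
  rewrite (Rmult_comm (INR _)), Rmult_assoc. apply Rmult_le_compat_l; [apply Rabs_pos|].
  rewrite Rpow_mult_distr. apply Rmult_le_compat; [apply pos_INR | apply pow_le, Hr | apply INR_le_pow2|].
  apply Rle_trans with ((r + 1) ^ k).
  - apply pow_incr. lra.
  - apply Rle_pow; [lra | lia].
Qed.

(* [(z + h)^k - z^k - k z^(k-1) h] satisfies [D (k+1) = (z + h) D k + k z^(k-1) h^2]. *)
Lemma Cpow_taylor (z h : C) (r : R) (k : nat) : 1 <= r -> Cmod z <= r -> Cmod (z + h) <= r ->
  Cmod ((z + h) ^ k - z ^ k - INR k * z ^ pred k * h) <= INR k ^ 2 * r ^ k * Cmod h ^ 2.
Proof.
  intros Hr Hz Hzh. induction k as [|k IH].
  - replace ((z + h) ^ 0 - z ^ 0 - INR 0 * z ^ pred 0 * h)%C with (RtoC 0) by (simpl; ring).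
    rewrite Cmod_0. simpl. lra.
  - assert (E : ((z + h) ^ S k - z ^ S k - INR (S k) * z ^ pred (S k) * h
      = (z + h) * ((z + h) ^ k - z ^ k - INR k * z ^ pred k * h) + INR k * z ^ pred k * h ^ 2)%C).
    { rewrite S_INR, RtoC_plus. destruct k as [|k]; simpl pred; rewrite ?Cpow_S; simpl INR; ring. }
    rewrite E. eapply Rle_trans; [apply Cmod_triangle|].
    rewrite !Cmod_mult, !Cmod_pow, Cmod_R, (Rabs_pos_eq (INR k)) by apply pos_INR.
    assert (H1 : Cmod (z + h) * Cmod ((z + h) ^ k - z ^ k - INR k * z ^ pred k * h)
       <= r * (INR k ^ 2 * r ^ k * Cmod h ^ 2)).
    { apply Rmult_le_compat; trivial; apply Cmod_ge_0. }
    assert (H2 : Cmod z ^ pred k <= r ^ S k).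
    { apply Rle_trans with (r ^ pred k).
      - apply pow_incr. split; [apply Cmod_ge_0 | exact Hz].
      - apply Rle_pow; [exact Hr | lia]. }
    pose proof (pow2_ge_0 (Cmod h)) as Hh. pose proof (pos_INR k) as Hk.
    assert (H3 : INR k * Cmod z ^ pred k * Cmod h ^ 2 <= INR k * r ^ S k * Cmod h ^ 2).
    { apply Rmult_le_compat_r; trivial. apply Rmult_le_compat_l; trivial. }
    assert (Hp : 0 <= r ^ S k * Cmod h ^ 2) by (apply Rmult_le_pos; [apply pow_le; lra | exact Hh]).
    rewrite S_INR. replace (r * (INR k ^ 2 * r ^ k * Cmod h ^ 2)) with (INR k ^ 2 * (r ^ S k * Cmod h ^ 2)) in H1 by (simpl; ring).
    replace ((INR k + 1) ^ 2 * r ^ S k * Cmod h ^ 2) with ((INR k ^ 2 + 2 * INR k + 1) * (r ^ S k * Cmod h ^ 2)) by ring.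
    nra.
Qed.

(** One quadratic remainder serves both continuity and differentiation along curves. *)
Lemma CPSeries_taylor (a : nat -> R) (z : C) : entire a ->
  exists M, 0 <= M /\ forall h, Cmod h <= 1 ->
    Cmod (CPSeries a (z + h) - CPSeries a z - CPSeries (PS_derive a) z * h) <= M * Cmod h ^ 2.
Proof.
  intros Ha. set (r := Cmod z + 1). assert (Hr : 1 <= r) by (pose proof (Cmod_ge_0 z); unfold r; lra).
  (* The factor k^2 of [Cpow_taylor] is at most 4^k, hence the radius 4 r. *)
  destruct (Ha (4 * r) ltac:(lra)) as [S HS].
  assert (HS0 : 0 <= S).
  { rewrite <- (is_series_unique _ _ HS), <- (Series_zero (fun _ => 0)) by easy. apply Series_le; [| eexists; exact HS].
    intros k. split; [lra|]. apply Rmult_le_pos; [apply Rabs_pos | apply pow_le; lra]. }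
  exists (2 * S). split; [lra|]. intros h Hh.
  assert (Hzh : Cmod (z + h) <= r) by (eapply Rle_trans; [apply Cmod_triangle | unfold r; lra]).
  assert (Hd : is_CSeries (fun k => (RtoC (a k) * (INR k * z ^ pred k))%C) (CPSeries (PS_derive a) z)).
  { apply is_CSeries_shift; [simpl; ring|].
    apply is_CSeries_ext with (2 := is_CSeries_CPSeries _ z (entire_derive a Ha)).
    intros k. unfold PS_derive. rewrite RtoC_mult. simpl pred. ring. }
  assert (Hu : is_CSeries (fun k => (RtoC (a k) * ((z + h) ^ k - z ^ k - INR k * z ^ pred k * h))%C)
     (CPSeries a (z + h) - CPSeries a z - CPSeries (PS_derive a) z * h)%C).
  { replace (CPSeries a (z + h) - CPSeries a z - CPSeries (PS_derive a) z * h)%C with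
      (CPSeries a (z + h) + (-(1)) * CPSeries a z + (- h) * CPSeries (PS_derive a) z)%C by ring.
    eapply is_CSeries_ext; [| apply is_CSeries_plus; [apply is_CSeries_plus; [| apply is_CSeries_scal]| apply is_CSeries_scal, Hd];
      apply is_CSeries_CPSeries, Ha].
    intros k. simpl. ring. }
  rewrite <- (is_CSeries_unique _ _ Hu).
  replace (2 * S * Cmod h ^ 2) with (2 * (Cmod h ^ 2 * S)) by ring.
  apply Cmod_CSeries_le with (b := fun k => scal (Cmod h ^ 2) (Rabs (a k) * (4 * r) ^ k)).
  - intros k. rewrite Cmod_mult, Cmod_R. unfold scal; simpl; unfold mult; simpl.
    change (Cmod h * (Cmod h * 1)) with (Cmod h ^ 2).
    rewrite (Rmult_comm (Cmod h ^ 2)), Rmult_assoc. apply Rmult_le_compat_l; [apply Rabs_pos|].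
    eapply Rle_trans; [apply (Cpow_taylor z h r k); trivial; unfold r; lra|].
    apply Rmult_le_compat_r; [apply pow2_ge_0|]. rewrite Rpow_mult_distr.
    apply Rmult_le_compat_r; [apply pow_le; lra|].
    replace 4 with (2 ^ 2) by ring. rewrite <- pow_mult, Nat.mul_comm, pow_mult.
    apply pow_incr. split; [apply pos_INR | apply INR_le_pow2].
  - apply (is_series_scal (V := R_NormedModule)), HS.
Qed.

Lemma ball_C (w w' : C) (e : R) : Cmod (w' - w) < e -> @ball C_UniformSpace w e w'.
Proof.
  intros H. split; apply Rabs_ball.
  - eapply Rle_lt_trans; [|exact H]. apply (re_le_Cmod (w' - w)).
  - eapply Rle_lt_trans; [|exact H]. apply (im_le_Cmod (w' - w)).
Qed.

Lemma ball_C_inv (w w' : C) (e : R) : @ball C_UniformSpace w e w' -> Cmod (w' - w) <= 2 * e.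
Proof.
  intros [H1 H2]. simpl in H1, H2. unfold ball in H1, H2; simpl in H1, H2.
  unfold AbsRing_ball, abs, minus, plus, opp in H1, H2; simpl in H1, H2.
  eapply Rle_trans; [apply Cmod_le_sum|].
  change (Re (w' - w)) with (fst w' + - fst w). change (Im (w' - w)) with (snd w' + - snd w). lra.
Qed.

Lemma CPSeries_continuous (a : nat -> R) (z : C) : entire a -> @continuous C_UniformSpace C_UniformSpace (CPSeries a) z.
Proof.
  intros Ha. destruct (CPSeries_taylor a z Ha) as [M [HM H]].
  set (L := M + Cmod (CPSeries (PS_derive a) z) + 1).
  assert (HL : 0 < L) by (pose proof (Cmod_ge_0 (CPSeries (PS_derive a) z)); unfold L; lra).
  intros P [eps HP]. pose proof (cond_pos eps) as He.
  assert (Hd : 0 < Rmin (1 / 2) (eps / (3 * L))).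
  { apply Rmin_case; [lra | apply Rdiv_lt_0_compat; lra]. }
  exists (mkposreal _ Hd). intros w Hw. apply HP. apply ball_C. apply ball_C_inv in Hw. simpl in Hw.
  set (h := (w - z)%C) in *. replace w with (z + h)%C by (unfold h; ring).
  pose proof (Rmin_l (1 / 2) (eps / (3 * L))). pose proof (Rmin_r (1 / 2) (eps / (3 * L))).
  assert (Hh : Cmod h <= 1) by lra. specialize (H h Hh). pose proof (Cmod_ge_0 h) as Hh0.
  replace (CPSeries a (z + h) - CPSeries a z)%C with
    ((CPSeries a (z + h) - CPSeries a z - CPSeries (PS_derive a) z * h) + CPSeries (PS_derive a) z * h)%C by ring.
  eapply Rle_lt_trans; [apply Cmod_triangle|]. rewrite Cmod_mult.
  assert (M * Cmod h ^ 2 <= M * Cmod h) by (apply Rmult_le_compat_l; [|simpl; nra]; lra).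
  apply Rle_lt_trans with (L * Cmod h).
  - unfold L. nra.
  - apply Rle_lt_trans with (L * (2 * (eps / (3 * L)))).
    + apply Rmult_le_compat_l; lra.
    + replace (L * (2 * (eps / (3 * L)))) with (2 / 3 * eps) by (field; lra). lra.
Qed.

Lemma sum_f_R0_minus_ext (f g h : nat -> R) (n : nat) : (forall k, (k <= n)%nat -> f k - g k = h k) ->
  sum_f_R0 f n - sum_f_R0 g n = sum_f_R0 h n.
Proof. intros H. rewrite <- minus_sum. apply sum_eq, H. Qed.

Lemma sum_f_R0_plus_ext (f g h : nat -> R) (n : nat) : (forall k, (k <= n)%nat -> f k + g k = h k) ->
  sum_f_R0 f n + sum_f_R0 g n = sum_f_R0 h n.
Proof. intros H. rewrite <- sum_plus. apply sum_eq, H. Qed.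

(* Componentwise, the complex Cauchy product reduces to four real ones. *)
Lemma CPSeries_mult (a b : nat -> R) (w : C) : entire a -> entire b ->
  (CPSeries a w * CPSeries b w)%C = CPSeries (PS_mult a b) w.
Proof.
  intros Ha Hb. symmetry. apply is_CSeries_unique.
  destruct (is_CSeries_CPSeries a w Ha) as [A1 A2]. destruct (is_CSeries_CPSeries b w Hb) as [B1 B2].
  assert (Habs : forall c, entire c -> ex_series (fun k => Rabs (Re (RtoC (c k) * w ^ k))) /\
     ex_series (fun k => Rabs (Im (RtoC (c k) * w ^ k)))).
  { intros c Hc. pose proof (Hc (Cmod w) (Cmod_ge_0 w)) as H.
    split; apply ex_series_le_Rabs with (2 := H); intros k;
    unfold norm; simpl; unfold abs; simpl; rewrite Rabs_Rabsolu; fold (RtoC (c k));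
    rewrite <- Cmod_coef_pow; [apply (re_le_Cmod (RtoC (c k) * w ^ k)) | apply (im_le_Cmod (RtoC (c k) * w ^ k))]. }
  destruct (Habs a Ha) as [A3 A4]. destruct (Habs b Hb) as [B3 B4].
  pose proof (is_series_mult _ _ _ _ A1 B1 A3 B3) as RR.
  pose proof (is_series_mult _ _ _ _ A2 B2 A4 B4) as II.
  pose proof (is_series_mult _ _ _ _ A1 B2 A3 B4) as RI.
  pose proof (is_series_mult _ _ _ _ A2 B1 A4 B3) as IR.
  assert (Hw : forall n k, (k <= n)%nat -> (w ^ n = w ^ k * w ^ (n - k))%C).
  { intros n k Hk. rewrite <- Cpow_add_r. f_equal. lia. }
  split.
  - eapply is_series_ext; [| rewrite re_mult; exact (is_series_minus _ _ _ _ RR II)].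
    intros n. rewrite re_scal_l. unfold minus, plus, opp, PS_mult. cbn -[Re Im Cmult Cpow]. rewrite Rmult_comm, scal_sum.
    apply sum_f_R0_minus_ext. intros k Hk. rewrite !re_scal_l, !im_scal_l.
    rewrite (Hw n k Hk), re_mult. ring.
  - eapply is_series_ext; [| rewrite im_mult; exact (is_series_plus _ _ _ _ RI IR)].
    intros n. rewrite im_scal_l. unfold plus, PS_mult. cbn -[Re Im Cmult Cpow]. rewrite Rmult_comm, scal_sum.
    apply sum_f_R0_plus_ext. intros k Hk. rewrite !re_scal_l, !im_scal_l.
    rewrite (Hw n k Hk), im_mult. ring.
Qed.

Lemma CPSeries_real (a : nat -> R) (r : R) : CPSeries a (RtoC r) = RtoC (PSeries a r).
Proof.
  assert (E : forall k, (RtoC (a k) * RtoC r ^ k)%C = RtoC (a k * r ^ k)).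
  { intros k. rewrite RtoC_mult, RtoC_pow. reflexivity. }
  unfold CPSeries. rewrite (CSeries_ext _ _ E). unfold CSeries, RtoC, PSeries. simpl. f_equal.
  apply Series_zero. reflexivity.
Qed.

(** * Limits and derivatives along paths *)

(** [auto_derive] leaves [Derive] of abstract functions in its result; this puts in the value known
    from a hypothesis. *)
Ltac use_derive H :=
  match type of H with is_derive ?p ?t ?l =>
    replace (Derive (fun x : R => p x) t) with l by (symmetry; exact (is_derive_unique p t l H))
  end.

Definition limC {T : Type} (F : (T -> Prop) -> Prop) (u : T -> C) (l : C) : Prop :=
  filterlim u F (@locally C_UniformSpace l).

Lemma limC_components {T : Type} (F : (T -> Prop) -> Prop) {FF : Filter F} (u : T -> C) (l : C) :
  limC F u l <->
  filterlim (fun x => Re (u x)) F (locally (Re l)) /\ filterlim (fun x => Im (u x)) F (locally (Im l)).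
Proof.
  split.
  - intros H. split; intros P [eps HP].
    + apply (H (fun z => P (Re z))). exists eps. intros y Hy. apply HP, Hy.
    + apply (H (fun z => P (Im z))). exists eps. intros y Hy. apply HP, Hy.
  - intros [H1 H2] P [eps HP].
    assert (E1 : F (fun x => ball (Re l) eps (Re (u x)))) by (apply H1; exists eps; trivial).
    assert (E2 : F (fun x => ball (Im l) eps (Im (u x)))) by (apply H2; exists eps; trivial).
    apply (filter_imp (F := F) (fun x => ball (Re l) eps (Re (u x)) /\ ball (Im l) eps (Im (u x)))).
    + intros x [B1 B2]. apply HP. split; trivial.
    + apply filter_and; trivial.
Qed.

Lemma filterlim_Rplus {T : Type} (F : (T -> Prop) -> Prop) {FF : Filter F} (u v : T -> R) (a b : R) :
  filterlim u F (locally a) -> filterlim v F (locally b) ->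
  filterlim (fun x => u x + v x) F (locally (a + b)).
Proof.
  intros H1 H2. eapply (filterlim_comp_2 (G := locally a) (H := locally b)); [exact H1 | exact H2|].
  apply (filterlim_plus (V := R_NormedModule) a b).
Qed.

Lemma filterlim_Rmult {T : Type} (F : (T -> Prop) -> Prop) {FF : Filter F} (u v : T -> R) (a b : R) :
  filterlim u F (locally a) -> filterlim v F (locally b) ->
  filterlim (fun x => u x * v x) F (locally (a * b)).
Proof.
  intros H1 H2. eapply (filterlim_comp_2 (G := locally a) (H := locally b)); [exact H1 | exact H2|].
  apply (filterlim_mult (K := R_AbsRing) a b).
Qed.

Lemma filterlim_Rcont {T : Type} (F : (T -> Prop) -> Prop) (f : R -> R) (u : T -> R) (a : R) :
  continuous f a -> filterlim u F (locally a) -> filterlim (fun x => f (u x)) F (locally (f a)).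
Proof. intros H1 H2. eapply filterlim_comp; [exact H2 | exact H1]. Qed.

Lemma filterlim_Rpow2 {T : Type} (F : (T -> Prop) -> Prop) (u : T -> R) (a : R) :
  filterlim u F (locally a) -> filterlim (fun x => u x ^ 2) F (locally (a ^ 2)).
Proof.
  apply (filterlim_Rcont F (fun y => y ^ 2)). apply continuous_derivable. auto_derive. easy.
Qed.

Lemma filterlim_Ropp {T : Type} (F : (T -> Prop) -> Prop) (u : T -> R) (a : R) :
  filterlim u F (locally a) -> filterlim (fun x => - u x) F (locally (- a)).
Proof.
  apply (filterlim_Rcont F Ropp). apply continuous_derivable. auto_derive. easy.
Qed.

Lemma limC_const {T : Type} (F : (T -> Prop) -> Prop) {FF : Filter F} (c : C) : limC F (fun _ => c) c.
Proof. apply filterlim_const. Qed.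

Lemma limC_plus {T : Type} (F : (T -> Prop) -> Prop) {FF : Filter F} (u v : T -> C) (a b : C) :
  limC F u a -> limC F v b -> limC F (fun x => (u x + v x)%C) (a + b)%C.
Proof.
  rewrite !limC_components by easy. intros [H1 H2] [H3 H4]. split; apply (filterlim_Rplus F); easy.
Qed.

Lemma limC_mult {T : Type} (F : (T -> Prop) -> Prop) {FF : Filter F} (u v : T -> C) (a b : C) :
  limC F u a -> limC F v b -> limC F (fun x => (u x * v x)%C) (a * b)%C.
Proof.
  rewrite !limC_components by easy. intros [H1 H2] [H3 H4]. split.
  - apply (filterlim_Rplus F (fun x => Re (u x) * Re (v x)) (fun x => - (Im (u x) * Im (v x)))); try easy.
    + apply (filterlim_Rmult F); easy.
    + apply filterlim_Ropp, (filterlim_Rmult F); easy.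
  - apply (filterlim_Rplus F (fun x => Re (u x) * Im (v x)) (fun x => Im (u x) * Re (v x))); try easy;
    apply (filterlim_Rmult F); easy.
Qed.

Lemma limC_pow {T : Type} (F : (T -> Prop) -> Prop) {FF : Filter F} (u : T -> C) (a : C) (n : nat) :
  limC F u a -> limC F (fun x => (u x ^ n)%C) (a ^ n)%C.
Proof.
  intros H. induction n as [|n IH]; [apply limC_const; easy|].
  change (limC F (fun x => (u x * u x ^ n)%C) (a * a ^ n)%C). apply limC_mult; easy.
Qed.

Lemma limC_opp {T : Type} (F : (T -> Prop) -> Prop) {FF : Filter F} (u : T -> C) (a : C) :
  limC F u a -> limC F (fun x => (- u x)%C) (- a)%C.
Proof.
  rewrite !limC_components by easy. intros [H1 H2]. split; apply filterlim_Ropp; easy.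
Qed.

Lemma norm2_pos (z : C) : z <> RtoC 0 -> 0 < Re z * Re z + Im z * Im z.
Proof.
  intros Hz. apply Rnot_le_lt. intros H. apply Hz. destruct z as [x y]. simpl in H.
  assert (x = 0) by nra. assert (y = 0) by nra. subst. reflexivity.
Qed.

Lemma limC_inv {T : Type} (F : (T -> Prop) -> Prop) {FF : Filter F} (u : T -> C) (a : C) : a <> RtoC 0 ->
  limC F u a -> limC F (fun x => (/ u x)%C) (/ a)%C.
Proof.
  intros Ha. rewrite !limC_components by easy. intros [H1 H2]. pose proof (norm2_pos a Ha) as Hp.
  assert (H3 : filterlim (fun x => / (Re (u x) ^ 2 + Im (u x) ^ 2)) F (locally (/ (Re a ^ 2 + Im a ^ 2)))).
  { apply (filterlim_Rcont F Rinv).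
    - apply continuous_derivable. auto_derive. nra.
    - apply (filterlim_Rplus F); apply filterlim_Rpow2; easy. }
  split; simpl; apply (filterlim_Rmult F); trivial. apply filterlim_Ropp; easy.
Qed.

Lemma limC_continuous {T : Type} (F : (T -> Prop) -> Prop) (f : C -> C) (u : T -> C) (a : C) :
  limC (@locally C_UniformSpace a) f (f a) -> limC F u a -> limC F (fun x => f (u x)) (f a).
Proof. intros H1 H2. eapply filterlim_comp; [exact H2 | exact H1]. Qed.

Lemma limC_id (a : C) : limC (@locally C_UniformSpace a) (fun z => z) a.
Proof. apply filterlim_id. Qed.

Lemma limC_Cexp {T : Type} (F : (T -> Prop) -> Prop) {FF : Filter F} (u : T -> C) (a : C) :
  limC F u a -> limC F (fun x => Cexp (u x)) (Cexp a).
Proof.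
  rewrite !limC_components by easy. intros [H1 H2]. split; simpl; apply (filterlim_Rmult F).
  1, 3: apply (filterlim_Rcont F exp); trivial; apply continuous_derivable; auto_derive; easy.
  - apply (filterlim_Rcont F cos); trivial; apply continuous_derivable; auto_derive; easy.
  - apply (filterlim_Rcont F sin); trivial; apply continuous_derivable; auto_derive; easy.
Qed.

(** |z| + Re z vanishes exactly on the cut. Being continuous, it shows that the cut plane is open;
    it is also the denominator in [Carg_atan]. *)
Lemma Cmod_add_Re_pos (z : C) : cut_plane z <-> 0 < Cmod z + Re z.
Proof.
  unfold cut_plane. pose proof (re_le_Cmod z) as H. pose proof (Rle_abs (- Re z)) as H'.
  rewrite Rabs_Ropp in H'. split.
  - intros Hc. destruct (Rle_lt_or_eq_dec 0 (Cmod z + Re z)) as [Hl | He]; [lra | easy |].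
    exfalso. apply Hc. assert (E : Cmod z ^ 2 = (Re z) ^ 2).
    { replace (Cmod z) with (- Re z) by lra. ring. }
    rewrite Cmod2_alt in E. assert (Im z ^ 2 = 0) by lra.
    split; [nra|]. pose proof (Cmod_ge_0 z). lra.
  - intros Hp [Hi Hr]. assert (E : Cmod z ^ 2 = (Re z) ^ 2) by (rewrite Cmod2_alt, Hi; ring).
    pose proof (Cmod_ge_0 z). assert (Cmod z = - Re z) by nra. lra.
Qed.

Lemma cut_plane_neq_0 (z : C) : cut_plane z -> z <> RtoC 0.
Proof. intros H ->. apply H. simpl. lra. Qed.

(* Half-angle formula: unlike the definition of [Carg] through [acos], it is visibly smooth
   across the positive real axis. *)
Lemma Carg_atan (z : C) : cut_plane z -> Carg z = 2 * atan (Im z / (Cmod z + Re z)).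
Proof.
  intros Hc. pose proof (proj1 (Cmod_add_Re_pos z) Hc) as Hp.
  assert (Hm : 0 < Cmod z) by (apply Cmod_gt_0, cut_plane_neq_0, Hc).
  set (t := Im z / (Cmod z + Re z)).
  pose proof (Cmod2_alt z) as E.
  assert (Ht : Re z / Cmod z = cos (2 * atan t)).
  { rewrite cos_2a, cos_atan, sin_atan.
    assert (H1 : 0 < 1 + t²) by (pose proof (Rle_0_sqr t); lra).
    pose proof (sqrt_lt_R0 _ H1) as Hs. pose proof (sqrt_sqrt (1 + t²) ltac:(lra)) as Hss.
    transitivity ((1 - t²) / (sqrt (1 + t²) * sqrt (1 + t²))); [| unfold Rsqr in *; field; lra].
    rewrite Hss. unfold t, Rsqr, Rdiv.
    assert (Hi : Im z * Im z = Cmod z ^ 2 - Re z ^ 2) by lra.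
    assert (HD : (Cmod z + Re z) ^ 2 + (Cmod z ^ 2 - Re z ^ 2) <> 0) by (apply Rgt_not_eq; nra).
    transitivity (((Cmod z + Re z) ^ 2 - Im z * Im z) / ((Cmod z + Re z) ^ 2 + Im z * Im z)).
    - rewrite Hi. field. lra.
    - field. rewrite Hi. split; [|lra]. replace (Im z ^ 2) with (Im z * Im z) by ring. nra. }
  pose proof (atan_bound t) as Hb. unfold Carg. rewrite Ht.
  destruct (Rle_dec 0 (Im z)) as [H0 | H0].
  - apply acos_cos. split; [|lra]. apply Rmult_le_pos; [lra|].
    rewrite <- atan_0. assert (0 <= t) by (apply Rdiv_le_0_compat; lra).
    destruct H as [H | <-]; [left; apply atan_increasing, H | lra].
  - rewrite <- cos_neg, acos_cos; [ring|]. split; [|lra].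
    assert (t < 0). { unfold t. apply Rmult_lt_reg_r with (Cmod z + Re z); trivial. field_simplify; lra. }
    pose proof (atan_increasing t 0 H). rewrite atan_0 in H1. lra.
Qed.

Lemma filterlim_Cmod {T : Type} (F : (T -> Prop) -> Prop) {FF : Filter F} (u : T -> C) (a : C) :
  limC F u a -> filterlim (fun x => Cmod (u x)) F (locally (Cmod a)).
Proof.
  rewrite limC_components by easy. intros [H1 H2]. unfold Cmod.
  apply (filterlim_Rcont F sqrt); [apply continuous_sqrt|].
  apply (filterlim_Rplus F); apply filterlim_Rpow2; easy.
Qed.

Lemma limC_cut_plane {T : Type} (F : (T -> Prop) -> Prop) {FF : Filter F} (u : T -> C) (a : C) :
  cut_plane a -> limC F u a -> F (fun x => cut_plane (u x)).
Proof.
  intros Hc H. pose proof (proj1 (Cmod_add_Re_pos a) Hc) as Hp.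
  assert (H1 : filterlim (fun x => Cmod (u x) + Re (u x)) F (locally (Cmod a + Re a))).
  { apply (filterlim_Rplus F); [apply filterlim_Cmod, H; easy|]. apply limC_components in H; easy. }
  specialize (H1 (fun y => 0 < y)).
  apply (filter_imp (F := F) (fun x => 0 < Cmod (u x) + Re (u x))).
  - intros x. apply Cmod_add_Re_pos.
  - apply H1. apply (open_gt 0), Hp.
Qed.

Lemma limC_Clog {T : Type} (F : (T -> Prop) -> Prop) {FF : Filter F} (u : T -> C) (a : C) :
  cut_plane a -> limC F u a -> limC F (fun x => Clog (u x)) (Clog a).
Proof.
  intros Hc H. pose proof (limC_cut_plane F u a Hc H) as Hloc.
  pose proof (proj1 (Cmod_add_Re_pos a) Hc) as Hp.
  pose proof (filterlim_Cmod F u a H) as HM.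
  apply limC_components; [easy|]. split; simpl.
  - apply (filterlim_Rcont F ln); trivial. apply continuous_derivable. auto_derive.
    apply Cmod_gt_0, cut_plane_neq_0, Hc.
  - rewrite Carg_atan by easy.
    apply (filterlim_ext_loc (F := F) (fun x => 2 * atan (Im (u x) / (Cmod (u x) + Re (u x))))).
    { apply (filter_imp (F := F) _ _ (fun x Hx => eq_sym (Carg_atan (u x) Hx)) Hloc). }
    apply limC_components in H; [|easy]. destruct H as [H1 H2].
    apply (filterlim_Rmult F); [apply filterlim_const|].
    apply (filterlim_Rcont F atan); [apply continuous_derivable; auto_derive; easy|].
    apply (filterlim_Rmult F); trivial.
    apply (filterlim_Rcont F Rinv); [apply continuous_derivable; auto_derive; lra|].
    apply (filterlim_Rplus F); easy.
Qed.

(** Chain rules along curves take the place of complex derivatives: the path integral asks for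
    nothing more. *)
Definition path_der (g : R -> C) (t : R) (l : C) : Prop :=
  is_derive (fun u => Re (g u)) t (Re l) /\ is_derive (fun u => Im (g u)) t (Im l).

Lemma path_der_continuous (g : R -> C) (t : R) (l : C) : path_der g t l -> limC (locally t) g (g t).
Proof.
  intros [H1 H2]. apply limC_components; [typeclasses eauto|].
  split; apply continuous_derivable; eexists; eassumption.
Qed.

Lemma path_der_const (c : C) (t : R) : path_der (fun _ => c) t (RtoC 0).
Proof. split; simpl; apply (is_derive_const (V := R_NormedModule)). Qed.

Lemma path_der_plus (g h : R -> C) (t : R) (a b : C) : path_der g t a -> path_der h t b ->
  path_der (fun u => (g u + h u)%C) t (a + b)%C.
Proof.
  intros [H1 H2] [H3 H4]. split.
  - exact (is_derive_plus _ _ _ _ _ H1 H3).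
  - exact (is_derive_plus _ _ _ _ _ H2 H4).
Qed.

Lemma path_der_mult (g h : R -> C) (t : R) (a b : C) : path_der g t a -> path_der h t b ->
  path_der (fun u => (g u * h u)%C) t (a * h t + g t * b)%C.
Proof.
  intros [H1 H2] [H3 H4].
  assert (D : forall (p q : R -> R) dp dq, is_derive p t dp -> is_derive q t dq ->
     is_derive (fun u => p u * q u) t (dp * q t + p t * dq)).
  { intros p q dp dq P Q. apply (is_derive_mult (K := R_AbsRing)); trivial. intros; apply Rmult_comm. }
  split.
  - pose proof (is_derive_minus _ _ _ _ _ (D _ _ _ _ H1 H3) (D _ _ _ _ H2 H4)) as H.
    eapply is_derive_ext; [| replace (Re (a * h t + g t * b)) with
      (minus (Re a * Re (h t) + Re (g t) * Re b) (Im a * Im (h t) + Im (g t) * Im b)); [exact H|]].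
    + intros u. reflexivity.
    + unfold minus, plus, opp; simpl. unfold Re, Im. ring.
  - pose proof (is_derive_plus _ _ _ _ _ (D _ _ _ _ H1 H4) (D _ _ _ _ H2 H3)) as H.
    eapply is_derive_ext; [| replace (Im (a * h t + g t * b)) with
      (plus (Re a * Im (h t) + Re (g t) * Im b) (Im a * Re (h t) + Im (g t) * Re b)); [exact H|]].
    + intros u. unfold plus; simpl. unfold Re, Im. ring.
    + unfold plus; simpl. unfold Re, Im. ring.
Qed.

Lemma path_der_eq (g : R -> C) (t : R) (a b : C) : path_der g t a -> a = b -> path_der g t b.
Proof. intros H <-. exact H. Qed.

Lemma path_der_ext (g h : R -> C) (t : R) (a : C) : (forall u, g u = h u) -> path_der g t a -> path_der h t a.
Proof.
  intros E [H1 H2]. split; [eapply is_derive_ext, H1 | eapply is_derive_ext, H2];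
  intros u; simpl; rewrite E; reflexivity.
Qed.

Lemma path_der_scal (c : C) (g : R -> C) (t : R) (a : C) : path_der g t a -> path_der (fun u => (c * g u)%C) t (c * a)%C.
Proof.
  intros H. eapply path_der_eq; [apply path_der_mult; [apply path_der_const | exact H]|]. simpl. ring.
Qed.

Lemma is_derive_Cmod (g : R -> C) (t : R) (l : C) : g t <> RtoC 0 -> path_der g t l ->
  is_derive (fun u => Cmod (g u)) t ((Re (g t) * Re l + Im (g t) * Im l) / Cmod (g t)).
Proof.
  intros H0 [H1 H2]. pose proof (norm2_pos _ H0) as Hp.
  set (p := fun u => Re (g u)) in *. set (q := fun u => Im (g u)) in *.
  change (is_derive p t (Re l)) in H1. change (is_derive q t (Im l)) in H2.
  apply (is_derive_ext (fun u => sqrt (p u * p u + q u * q u))).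
  - intros u. unfold Cmod, p, q, Re, Im. f_equal. ring.
  - assert (E : Cmod (g t) = sqrt (p t * p t + q t * q t)) by (unfold Cmod, p, q, Re, Im; f_equal; ring).
    rewrite E. change (Re (g t)) with (p t) in *. change (Im (g t)) with (q t) in *.
    auto_derive.
    + repeat split; try easy; eexists; eassumption.
    + use_derive H1. use_derive H2.
      field. apply Rgt_not_eq, sqrt_lt_R0, Hp.
Qed.

Lemma path_der_Clog (g : R -> C) (t : R) (l : C) : cut_plane (g t) -> path_der g t l ->
  path_der (fun u => Clog (g u)) t (l / g t)%C.
Proof.
  intros Hc H. pose proof (cut_plane_neq_0 _ Hc) as H0.
  pose proof (is_derive_Cmod g t l H0 H) as HM.
  pose proof (limC_cut_plane _ _ _ Hc (path_der_continuous g t l H)) as Hloc.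
  pose proof (proj1 (Cmod_add_Re_pos _) Hc) as Hpos.
  assert (Hm : 0 < Cmod (g t)) by (apply Cmod_gt_0, H0).
  pose proof (Cmod2_alt (g t)) as E.
  pose proof (norm2_pos _ H0) as Hn.
  destruct H as [H1 H2].
  assert (Hdiv : (l / g t)%C = ((Re l * Re (g t) + Im l * Im (g t)) / Cmod (g t) ^ 2,
     (Im l * Re (g t) - Re l * Im (g t)) / Cmod (g t) ^ 2)).
  { rewrite E. destruct (g t) as [x y], l as [p q]. simpl in *.
    unfold Cdiv, Cmult, Cinv; simpl. f_equal; field; nra. }
  set (m := fun u => Cmod (g u)) in *.
  change (is_derive m t ((Re (g t) * Re l + Im (g t) * Im l) / Cmod (g t))) in HM. set (p := fun u => Re (g u)) in *. set (q := fun u => Im (g u)) in *.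
  change (is_derive p t (Re l)) in H1. change (is_derive q t (Im l)) in H2.
  change (Cmod (g t)) with (m t) in *. change (Re (g t)) with (p t) in *. change (Im (g t)) with (q t) in *.
  rewrite Hdiv. split.
  - simpl. change (fun u => ln (Cmod (g u))) with (fun u => ln (m u)).
    auto_derive.
    + repeat split; trivial. eexists; eassumption.
    + use_derive HM. field. lra.
  - simpl. apply (is_derive_ext_loc (fun u => 2 * atan (q u / (m u + p u)))).
    { apply (filter_imp (F := locally t) _ _ (fun x Hx => eq_sym (Carg_atan (g x) Hx)) Hloc). }
    auto_derive.
    + repeat split; trivial; try (eexists; eassumption). lra.
    + use_derive HM. use_derive H1. use_derive H2.
      (* Eliminating q^2 leaves a rational identity whose denominators are powers of m and m + p,
         both positive off the cut. *)
      assert (Hq : q t ^ 2 = m t ^ 2 - p t ^ 2) by lra.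
      transitivity (2 * (Im l * (m t + p t) - q t * ((p t * Re l + q t * Im l) / m t + Re l)) / ((m t + p t) ^ 2 + q t ^ 2)).
      * field. repeat split; try lra; nra.
      * replace (q t * ((p t * Re l + q t * Im l) / m t + Re l))
          with ((q t * Re l * (p t + m t) + q t ^ 2 * Im l) / m t) by (field; lra).
        rewrite Hq. field. repeat split; try lra. apply Rgt_not_eq. nra.
Qed.

Lemma path_der_Cexp (g : R -> C) (t : R) (l : C) : path_der g t l -> path_der (fun u => Cexp (g u)) t (l * Cexp (g t))%C.
Proof.
  intros [H1 H2]. set (p := fun u => Re (g u)) in *. set (q := fun u => Im (g u)) in *.
  change (is_derive p t (Re l)) in H1. change (is_derive q t (Im l)) in H2.
  split; simpl.
  - change (fun u => exp (Re (g u)) * cos (Im (g u))) with (fun u => exp (p u) * cos (q u)).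
    auto_derive; [repeat split; eexists; eassumption|].
    use_derive H1. use_derive H2. unfold p, q, Re, Im. simpl. ring.
  - change (fun u => exp (Re (g u)) * sin (Im (g u))) with (fun u => exp (p u) * sin (q u)).
    auto_derive; [repeat split; eexists; eassumption|].
    use_derive H1. use_derive H2. unfold p, q, Re, Im. simpl. ring.
Qed.

(** Domination by a function with zero value and zero derivative; it turns the quadratic Taylor
    remainder into a derivative along a path. *)
Lemma is_derive_small (E q : R -> R) (t : R) : is_derive q t 0 -> E t = 0 -> q t = 0 ->
  locally t (fun u => Rabs (E u) <= q u) -> is_derive E t 0.
Proof.
  intros Hq E0 q0 [d Hd]. apply is_derive_Reals. apply is_derive_Reals in Hq.
  intros eps Heps. destruct (Hq eps Heps) as [d' Hd'].
  exists (mkposreal (Rmin d d') (Rmin_case _ _ _ (cond_pos d) (cond_pos d'))). simpl. intros h Hh Hhd.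
  pose proof (Rmin_l d d'). pose proof (Rmin_r d d').
  specialize (Hd' h Hh ltac:(lra)). rewrite q0, !Rminus_0_r in Hd'. rewrite E0, !Rminus_0_r.
  eapply Rle_lt_trans; [|exact Hd']. unfold Rdiv. rewrite !Rabs_mult.
  apply Rmult_le_compat_r; [apply Rabs_pos|]. eapply Rle_trans; [| apply Rle_abs].
  apply Hd. apply Rabs_ball; simpl.
  replace (t + h - t) with h by ring. lra.
Qed.

Lemma path_der_CPSeries (a : nat -> R) (g : R -> C) (t : R) (l : C) : entire a -> path_der g t l ->
  path_der (fun u => CPSeries a (g u)) t (CPSeries (PS_derive a) (g t) * l)%C.
Proof.
  intros Ha Hg. destruct (CPSeries_taylor a (g t) Ha) as [M [HM HT]].
  set (z := g t) in *. set (P' := CPSeries (PS_derive a) z) in *.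
  set (E := fun u => (CPSeries a (g u) - CPSeries a z - P' * (g u - z))%C).
  assert (Hlin : path_der (fun u => (CPSeries a z + P' * (g u + - z))%C) t (P' * l)%C).
  { eapply path_der_eq; [apply path_der_plus; [apply path_der_const | apply path_der_scal, path_der_plus; [exact Hg | apply path_der_const]]|].
    simpl. ring. }
  assert (HE : path_der E t (RtoC 0)).
  { set (q := fun u => M * ((Re (g u) - Re z) ^ 2 + (Im (g u) - Im z) ^ 2)).
    assert (Hq : is_derive q t 0).
    { destruct Hg as [H1 H2]. set (p1 := fun u => Re (g u)) in *. set (p2 := fun u => Im (g u)) in *.
      change (is_derive p1 t (Re l)) in H1. change (is_derive p2 t (Im l)) in H2.
      change q with (fun u => M * ((p1 u - Re z) ^ 2 + (p2 u - Im z) ^ 2)).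
      auto_derive; [repeat split; eexists; eassumption|].
      unfold p1, p2, z. ring. }
    assert (Hbound : locally t (fun u => Cmod (E u) <= q u)).
    { apply (filter_imp (F := locally t) (fun u => @ball C_UniformSpace z (mkposreal (1/2) ltac:(lra)) (g u))).
      - intros u Hu. apply ball_C_inv in Hu. simpl in Hu.
        specialize (HT (g u - z)%C ltac:(lra)). replace (z + (g u - z))%C with (g u) in HT by ring.
        rewrite Cmod2_alt in HT. exact HT.
      - apply (path_der_continuous g t l Hg). exists (mkposreal (1/2) ltac:(lra)). trivial. }
    assert (E0 : E t = RtoC 0) by (unfold E, z; ring).
    assert (q0 : q t = 0) by (unfold q, z; ring).
    clearbody E. split; [change (Re (RtoC 0)) with 0 | change (Im (RtoC 0)) with 0].
    - apply is_derive_small with q; trivial; [rewrite E0; reflexivity|].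
      apply (filter_imp (F := locally t) _ _ (fun u Hu => Rle_trans _ _ _ (re_le_Cmod (E u)) Hu) Hbound).
    - apply is_derive_small with q; trivial; [rewrite E0; reflexivity|].
      apply (filter_imp (F := locally t) _ _ (fun u Hu => Rle_trans _ _ _ (im_le_Cmod (E u)) Hu) Hbound). }
  pose proof (path_der_plus _ _ _ _ _ Hlin HE) as H.
  apply path_der_eq with (b := (P' * l)%C) in H; [|ring].
  eapply path_der_ext; [|exact H]. intros u. unfold E. simpl. ring.
Qed.

(** * Path integrals *)

Lemma at_right_before (a b : R) : a < b -> at_right a (fun t => a < t < b).
Proof.
  intros H. exists (mkposreal (b - a) ltac:(lra)). intros t Ht Hat.
  apply ball_Rabs in Ht; simpl in Ht.
  apply Rabs_def2 in Ht. lra.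
Qed.

Lemma at_left_after (a b : R) : a < b -> at_left b (fun t => a < t < b).
Proof.
  intros H. exists (mkposreal (b - a) ltac:(lra)). intros t Ht Hat.
  apply ball_Rabs in Ht; simpl in Ht.
  apply Rabs_def2 in Ht. lra.
Qed.

Lemma locally_interval (a b t : R) : a < t < b -> locally t (fun u => a < u < b).
Proof.
  intros H. apply (filter_and (F := locally t)); [apply (open_gt a) | apply (open_lt b)]; lra.
Qed.

Lemma continuous_at_left (f : R -> R) (x : R) : continuous f x ->
  filterlim f (at_left x) (locally (f x)).
Proof. intros H P HP. apply filter_le_within. apply H, HP. Qed.

(** At a break point [path_deriv] may be a meaningless default of [Derive]. Extending by the
    one-sided limits gives a continuous function that agrees with phi inside the interval. *)
Definition clip (phi : R -> R) (a b la lb : R) (t : R) : R :=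
  if Rle_dec t a then la else if Rle_dec b t then lb else phi t.

Lemma clip_inside (phi : R -> R) (a b la lb t : R) : a < t < b -> clip phi a b la lb t = phi t.
Proof. intros H. unfold clip. destruct (Rle_dec t a); [lra|]. destruct (Rle_dec b t); [lra|easy]. Qed.

Lemma clip_continuous (phi : R -> R) (a b la lb t : R) : a < b ->
  (forall t, a < t < b -> continuous phi t) ->
  filterlim phi (at_right a) (locally la) -> filterlim phi (at_left b) (locally lb) ->
  continuous (clip phi a b la lb) t.
Proof.
  intros Hab Hc Ha Hb.
  assert (Ea : clip phi a b la lb a = la) by (unfold clip; destruct (Rle_dec a a); lra).
  assert (Eb : clip phi a b la lb b = lb).
  { unfold clip. destruct (Rle_dec b a); [lra|]. destruct (Rle_dec b b); lra. }
  destruct (Rtotal_order t a) as [H | [H | H]].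
  - apply continuous_ext_loc with (fun _ => la); [| apply continuous_const].
    apply (filter_imp (F := locally t) (fun u => u < a)); [| apply (open_lt a), H].
    intros u Hu. unfold clip. destruct (Rle_dec u a); lra.
  - subst t. intros P HP. rewrite Ea in HP. specialize (Ha P HP).
    pose proof (at_right_before a b Hab) as Hr.
    unfold filtermap, at_right, within in *.
    apply (filter_imp (F := locally a)) with (2 := filter_and _ _ Ha Hr).
    intros u [H1 H2]. unfold clip. destruct (Rle_dec u a) as [Hu | Hu].
    + apply locally_singleton, HP.
    + destruct (Rle_dec b u); [specialize (H2 ltac:(lra)); lra | apply H1; lra].
  - destruct (Rtotal_order t b) as [H' | [H' | H']].
    + apply continuous_ext_loc with phi; [| apply Hc; lra].
      apply (filter_imp (F := locally t) (fun u => a < u < b)); [| apply locally_interval; lra].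
      intros u Hu. symmetry. apply clip_inside, Hu.
    + subst t. intros P HP. rewrite Eb in HP. specialize (Hb P HP).
      pose proof (at_left_after a b Hab) as Hr.
      unfold filtermap, at_left, within in *.
      apply (filter_imp (F := locally b)) with (2 := filter_and _ _ Hb Hr).
      intros u [H1 H2]. unfold clip. destruct (Rle_dec u a) as [Hu | Hu].
      * specialize (H2 ltac:(lra)). lra.
      * destruct (Rle_dec b u); [apply locally_singleton, HP | apply H1; lra].
    + apply continuous_ext_loc with (fun _ => lb); [| apply continuous_const].
      apply (filter_imp (F := locally t) (fun u => b < u)); [| apply (open_gt b), H'].
      intros u Hu. unfold clip. destruct (Rle_dec u a); [lra|]. destruct (Rle_dec b u); lra.
Qed.

(** Fundamental theorem of calculus with the derivative known only inside: h minus the integral of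
    the clipped function is constant on (a, b), and continuity extends this to the ends. *)
Lemma is_RInt_open_interval (h phi : R -> R) (a b la lb : R) : a < b ->
  filterlim h (at_right a) (locally (h a)) -> filterlim h (at_left b) (locally (h b)) ->
  (forall t, a < t < b -> is_derive h t (phi t)) -> (forall t, a < t < b -> continuous phi t) ->
  filterlim phi (at_right a) (locally la) -> filterlim phi (at_left b) (locally lb) ->
  is_RInt phi a b (h b - h a).
Proof.
  intros Hab Hha Hhb Hd Hc Ha Hb. set (psi := clip phi a b la lb).
  assert (Hpsi : forall t, continuous psi t) by (intros t; apply clip_continuous; trivial).
  assert (Hex : forall s t, ex_RInt psi s t).
  { intros s t. apply (@ex_RInt_continuous R_CompleteNormedModule). intros u _. apply Hpsi. }
  set (J := fun t => RInt psi a t).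
  assert (HJ : forall t, continuous J t).
  { intros t. apply continuous_derivable. exists (psi t).
    apply (is_derive_RInt (V := R_NormedModule) psi J a t); [| apply Hpsi].
    apply filter_forall. intros u. apply (RInt_correct (V := R_CompleteNormedModule)), Hex. }
  set (m := (a + b) / 2). set (c := h m - J m).
  assert (Hcst : forall t, a < t < b -> h t - J t = c).
  { intros t Ht.
    assert (H1 : is_RInt phi m t (h t - h m)).
    { apply (is_RInt_derive h phi); intros u Hu.
      - apply Hd. unfold m in *. unfold Rmin, Rmax in Hu. destruct (Rle_dec ((a + b) / 2) t); lra.
      - apply Hc. unfold m in *. unfold Rmin, Rmax in Hu. destruct (Rle_dec ((a + b) / 2) t); lra. }
    assert (H2 : is_RInt psi m t (h t - h m)).
    { apply is_RInt_ext with (2 := H1). intros u Hu. symmetry. apply clip_inside.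
      unfold m in *. unfold Rmin, Rmax in Hu. destruct (Rle_dec ((a + b) / 2) t); lra. }
    pose proof (RInt_Chasles psi a m t (Hex _ _) (Hex _ _)) as E.
    rewrite (is_RInt_unique _ _ _ _ H2) in E. unfold plus in E; simpl in E.
    unfold c, J. lra. }
  assert (Ea : h a - J a = c).
  { apply (filterlim_locally_unique (F := at_right a) (fun t => h t - J t)).
    - apply (filterlim_Rplus (at_right a) h (fun t => - J t)); trivial. apply filterlim_Ropp, continuous_at_right, HJ.
    - apply (filterlim_ext_loc (F := at_right a) (fun _ => c)); [| apply filterlim_const].
      apply (filter_imp (F := at_right a)) with (2 := at_right_before a b Hab).
      intros t Ht. symmetry. apply Hcst, Ht. }
  assert (Eb : h b - J b = c).
  { apply (filterlim_locally_unique (F := at_left b) (fun t => h t - J t)).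
    - apply (filterlim_Rplus (at_left b) h (fun t => - J t)); trivial. apply filterlim_Ropp, continuous_at_left, HJ.
    - apply (filterlim_ext_loc (F := at_left b) (fun _ => c)); [| apply filterlim_const].
      apply (filter_imp (F := at_left b)) with (2 := at_left_after a b Hab).
      intros t Ht. symmetry. apply Hcst, Ht. }
  assert (Ja : J a = 0) by (unfold J; rewrite RInt_point; reflexivity).
  replace (h b - h a) with (J b) by lra.
  apply is_RInt_ext with psi.
  - intros t Ht. rewrite Rmin_left, Rmax_right in Ht by lra. apply clip_inside, Ht.
  - apply (RInt_correct (V := R_CompleteNormedModule)), Hex.
Qed.

(** [piecewise_C1] with the break points as a parameter, ready for induction on the list. *)
Definition C1_off (S : list R) (g : R -> C) (a b : R) : Prop :=
  (forall t, a <= t <= b ->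
     filterlim g (within (fun u => a <= u <= b) (locally t)) (@locally C_UniformSpace (g t))) /\
  (forall t, a < t < b -> ~ In t S ->
     ex_derive (fun u => Re (g u)) t /\ ex_derive (fun u => Im (g u)) t /\
     @continuous R_UniformSpace C_UniformSpace (path_deriv g) t) /\
  (forall t, a <= t < b -> exists l : C, limC (at_right t) (path_deriv g) l) /\
  (forall t, a < t <= b -> exists l : C, limC (at_left t) (path_deriv g) l).

Lemma C1_off_sub (S : list R) (g : R -> C) (a b a' b' : R) : a <= a' -> b' <= b ->
  C1_off S g a b -> C1_off S g a' b'.
Proof.
  intros Ha Hb (H1 & H2 & H3 & H4). repeat split.
  - intros t Ht P HP. specialize (H1 t ltac:(lra) P HP). unfold filtermap, within in *.
    apply (filter_imp (F := locally t)) with (2 := H1). intros u Hu Hu'. apply Hu. lra.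
  - intros. apply H2; [lra | easy].
  - intros. apply H2; [lra | easy].
  - intros. apply H2; [lra | easy].
  - intros. apply H3; lra.
  - intros. apply H4; lra.
Qed.

Lemma limC_at_right_within (g : R -> C) (a b : R) (l : C) : a < b ->
  limC (within (fun u => a <= u <= b) (locally a)) g l -> limC (at_right a) g l.
Proof.
  intros Hab H P HP. specialize (H P HP). unfold filtermap, at_right, within in *.
  apply (filter_imp (F := locally a)) with (2 := filter_and _ _ H (at_right_before a b Hab)).
  intros u [H1 H2] Hu. apply H1. specialize (H2 Hu). lra.
Qed.

Lemma limC_at_left_within (g : R -> C) (a b : R) (l : C) : a < b ->
  limC (within (fun u => a <= u <= b) (locally b)) g l -> limC (at_left b) g l.
Proof.
  intros Hab H P HP. specialize (H P HP). unfold filtermap, at_left, within in *.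
  apply (filter_imp (F := locally b)) with (2 := filter_and _ _ H (at_left_after a b Hab)).
  intros u [H1 H2] Hu. apply H1. specialize (H2 Hu). lra.
Qed.

(** The equation F' = f tested on curves. The two continuity clauses give the one-sided limits at
    the ends of a smooth piece. *)
Definition path_primitive (D : C -> Prop) (F f : C -> C) : Prop :=
  (forall z, D z -> limC (@locally C_UniformSpace z) F (F z)) /\
  (forall z, D z -> limC (@locally C_UniformSpace z) f (f z)) /\
  (forall g t l, D (g t) -> path_der g t l -> path_der (fun u => F (g u)) t (f (g t) * l)%C).

Lemma is_RInt_C (phi : R -> C) (a b : R) (l : C) :
  is_RInt (fun t => Re (phi t)) a b (Re l) -> is_RInt (fun t => Im (phi t)) a b (Im l) ->
  @is_RInt C_R_NormedModule phi a b l.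
Proof.
  intros H1 H2. destruct l as [x y].
  exact (is_RInt_fct_extend_pair (U := R_NormedModule) (V := R_NormedModule) phi a b x y H1 H2).
Qed.

Lemma path_integral_C1 (D : C -> Prop) (F f : C -> C) (g : R -> C) (a b : R) : a < b ->
  path_primitive D F f -> (forall t, a <= t <= b -> D (g t)) -> C1_off [] g a b ->
  @is_RInt C_R_NormedModule (fun t => (f (g t) * path_deriv g t)%C) a b (F (g b) - F (g a))%C.
Proof.
  intros Hab (HF & Hf & HFf) HD (H1 & H2 & H3 & H4).
  destruct (H3 a ltac:(lra)) as [la Hla]. destruct (H4 b ltac:(lra)) as [lb Hlb].
  pose proof (limC_at_right_within g a b (g a) Hab (H1 a ltac:(lra))) as Ga.
  pose proof (limC_at_left_within g a b (g b) Hab (H1 b ltac:(lra))) as Gb.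
  assert (Hp : forall t, a < t < b -> path_der g t (path_deriv g t)).
  { intros t Ht. destruct (H2 t Ht (fun H => H)) as (E1 & E2 & _). split; apply Derive_correct; trivial. }
  assert (Hd : forall t, a < t < b -> path_der (fun u => F (g u)) t (f (g t) * path_deriv g t)%C).
  { intros t Ht. apply HFf; [apply HD; lra | apply Hp, Ht]. }
  assert (Hc : forall t, a < t < b -> limC (locally t) (fun t => (f (g t) * path_deriv g t)%C) (f (g t) * path_deriv g t)%C).
  { intros t Ht. apply (limC_mult (locally t)).
    - apply limC_continuous; [apply Hf, HD; lra | eapply path_der_continuous, Hp, Ht].
    - apply (H2 t Ht (fun H => H)). }
  assert (La : limC (at_right a) (fun t => (f (g t) * path_deriv g t)%C) (f (g a) * la)%C).
  { apply (limC_mult (at_right a)); trivial. apply limC_continuous; [apply Hf, HD; lra | exact Ga]. }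
  assert (Lb : limC (at_left b) (fun t => (f (g t) * path_deriv g t)%C) (f (g b) * lb)%C).
  { apply (limC_mult (at_left b)); trivial. apply limC_continuous; [apply Hf, HD; lra | exact Gb]. }
  assert (Fa : limC (at_right a) (fun t => F (g t)) (F (g a))).
  { apply limC_continuous; [apply HF, HD; lra | exact Ga]. }
  assert (Fb : limC (at_left b) (fun t => F (g t)) (F (g b))).
  { apply limC_continuous; [apply HF, HD; lra | exact Gb]. }
  apply limC_components in La, Lb, Fa, Fb; try typeclasses eauto.
  apply is_RInt_C.
  - apply (is_RInt_open_interval (fun t => Re (F (g t))) (fun t => Re (f (g t) * path_deriv g t)) a b
      (Re (f (g a) * la)) (Re (f (g b) * lb))); trivial; try apply La; try apply Lb; try apply Fa; try apply Fb.
    + intros t Ht. apply (Hd t Ht).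
    + intros t Ht. specialize (Hc t Ht). apply limC_components in Hc; [apply Hc | typeclasses eauto].
  - apply (is_RInt_open_interval (fun t => Im (F (g t))) (fun t => Im (f (g t) * path_deriv g t)) a b
      (Im (f (g a) * la)) (Im (f (g b) * lb))); trivial; try apply La; try apply Lb; try apply Fa; try apply Fb.
    + intros t Ht. apply (Hd t Ht).
    + intros t Ht. specialize (Hc t Ht). apply limC_components in Hc; [apply Hc | typeclasses eauto].
Qed.

(** Induction on the break points: the interval is cut at the head of the list if this lies strictly
    inside, and on each half the head is then no longer an interior point. *)
Lemma path_integral_C1_off (D : C -> Prop) (F f : C -> C) (g : R -> C) (S : list R) :
  path_primitive D F f -> forall a b, a < b -> (forall t, a <= t <= b -> D (g t)) -> C1_off S g a b ->
  @is_RInt C_R_NormedModule (fun t => (f (g t) * path_deriv g t)%C) a b (F (g b) - F (g a))%C.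
Proof.
  intros HP. induction S as [|s S IH]; intros a b Hab HD Hg; [apply path_integral_C1 with D; trivial|].
  assert (Hdrop : forall a' b', a <= a' -> b' <= b -> ~ (a' < s < b') -> C1_off S g a' b').
  { intros a' b' Ha' Hb' Hs. destruct (C1_off_sub _ _ _ _ _ _ Ha' Hb' Hg) as (H1 & H2 & H3 & H4).
    repeat split; trivial; intros; apply H2; trivial; intros [-> | Hin]; auto. }
  destruct (Rlt_dec a s) as [Has | Has]; [destruct (Rlt_dec s b) as [Hsb | Hsb]|].
  - assert (E : (F (g b) - F (g a))%C = plus (F (g s) - F (g a))%C (F (g b) - F (g s))%C).
    { change plus with Cplus. ring. }
    rewrite E. apply (@is_RInt_Chasles C_R_NormedModule) with s; apply IH; trivial;
      try (intros; apply HD; lra); apply Hdrop; lra.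
  - apply IH; trivial. apply Hdrop; lra.
  - apply IH; trivial. apply Hdrop; lra.
Qed.

Lemma path_to_infinity_integral (D : C -> Prop) (F f : C -> C) (z : C) (g : R -> C) :
  path_primitive D F f -> (forall w, cut_plane w -> D w) -> path_to_infinity z g ->
  limC (Rbar_locally p_infty) (fun x : R => F (RtoC x)) (RtoC 0) ->
  is_path_integral f g (- F z)%C.
Proof.
  intros HP HD (H0 & Hpw & Hcut & Him & Hre) Hlim.
  assert (Hlim' : limC (Rbar_locally p_infty) (fun b => (F (g b) - F z)%C) (- F z)%C).
  { replace (- F z)%C with (RtoC 0 + - F z)%C by ring.
    apply (limC_plus (Rbar_locally p_infty)); [| apply limC_const; typeclasses eauto].
    (* The path is eventually real, so the limit of F along the real axis is enough. *)
    apply (filterlim_ext_loc (F := Rbar_locally p_infty) (fun b => F (RtoC (Re (g b))))).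
    - apply (filter_imp (F := Rbar_locally p_infty)) with (2 := Him). intros t Ht. f_equal.
      apply C_eq; [reflexivity | rewrite Ht; reflexivity].
    - eapply filterlim_comp; [exact Hre | exact Hlim]. }
  intros P HP'. specialize (Hlim' P HP').
  apply Filter_prod with (fun a => a = 0) (fun b => 0 < b /\ P (F (g b) - F z)%C).
  - reflexivity.
  - apply (filter_and (F := Rbar_locally p_infty)); [exists 0; trivial | exact Hlim'].
  - intros a b -> [Hb HPb]. exists (F (g b) - F z)%C. split; trivial. simpl. rewrite <- H0 at 1.
    destruct (Hpw b Hb) as (K1 & S & K2 & K3 & K4).
    apply path_integral_C1_off with D S; trivial.
    + intros t Ht. apply HD, Hcut. lra.
    + repeat split; trivial; apply K2; trivial.
Qed.

(** * Bessel products and their primitive *)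

Lemma entire_le (a b : nat -> R) (M : R) : (forall k, Rabs (b k) <= M * Rabs (a k)) -> entire a -> entire b.
Proof.
  intros H Ha r Hr.
  apply ex_series_le_Rabs with (fun k => scal M (Rabs (a k) * r ^ k)).
  - intros k. unfold norm; simpl. unfold abs; simpl. unfold scal; simpl; unfold mult; simpl.
    pose proof (pow_le r k Hr). rewrite Rabs_pos_eq by (apply Rmult_le_pos; [apply Rabs_pos | easy]).
    rewrite <- Rmult_assoc. apply Rmult_le_compat_r; [easy | apply H].
  - apply (ex_series_scal (V := R_NormedModule)), Ha, Hr.
Qed.

Lemma entire_mult (a b : nat -> R) : entire a -> entire b -> entire (PS_mult a b).
Proof.
  intros Ha Hb r Hr.
  destruct (Ha r Hr) as [la Hla]. destruct (Hb r Hr) as [lb Hlb].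
  assert (Habs : forall u, entire u -> ex_series (fun k => Rabs (Rabs (u k) * r ^ k))).
  { intros u Hu. apply ex_series_ext with (2 := Hu r Hr). intros k. symmetry. apply Rabs_pos_eq.
    apply Rmult_le_pos; [apply Rabs_pos | apply pow_le, Hr]. }
  pose proof (is_series_mult _ _ _ _ Hla Hlb (Habs a Ha) (Habs b Hb)) as H.
  eapply ex_series_le_Rabs; [| eexists; exact H].
  intros n. unfold norm; simpl. unfold abs; simpl.
  rewrite Rabs_pos_eq by (apply Rmult_le_pos; [apply Rabs_pos | apply pow_le, Hr]).
  unfold PS_mult.
  apply Rle_trans with (sum_f_R0 (fun k => Rabs (a k * b (n - k)%nat)) n * r ^ n).
  - apply Rmult_le_compat_r; [apply pow_le, Hr | apply Rsum_abs].
  - rewrite Rmult_comm, scal_sum. right. apply sum_eq. intros k Hk.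
    rewrite Rabs_mult. replace n with (k + (n - k))%nat at 2 by lia. rewrite pow_add. ring.
Qed.

Lemma CPSeries_plus (a b : nat -> R) (w : C) : entire a -> entire b ->
  CPSeries (fun k => a k + b k) w = (CPSeries a w + CPSeries b w)%C.
Proof.
  intros Ha Hb. apply is_CSeries_unique.
  eapply is_CSeries_ext; [| apply is_CSeries_plus; apply is_CSeries_CPSeries; [exact Ha | exact Hb]].
  intros k. simpl. rewrite RtoC_plus. ring.
Qed.

Lemma CPSeries_scal (c : R) (a : nat -> R) (w : C) : entire a -> CPSeries (fun k => c * a k) w = (RtoC c * CPSeries a w)%C.
Proof.
  intros Ha. apply is_CSeries_unique.
  eapply is_CSeries_ext; [| apply is_CSeries_scal, is_CSeries_CPSeries, Ha].
  intros k. simpl. rewrite RtoC_mult. ring.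
Qed.

Lemma CPSeries_shift (a b : nat -> R) (w : C) : entire a -> b O = 0 -> (forall k, b (S k) = a k) ->
  CPSeries b w = (w * CPSeries a w)%C.
Proof.
  intros Ha H0 HS. apply is_CSeries_unique. apply is_CSeries_shift; [rewrite H0; ring|].
  eapply is_CSeries_ext; [| apply is_CSeries_scal, is_CSeries_CPSeries, Ha].
  intros k. simpl. rewrite HS. ring.
Qed.

Lemma CPSeries_euler (a : nat -> R) (w : C) : entire a ->
  (w * CPSeries (PS_derive a) w)%C = CPSeries (fun k => INR k * a k) w.
Proof.
  intros Ha. symmetry. apply CPSeries_shift; [apply entire_derive, Ha | simpl; ring | reflexivity].
Qed.

Lemma entire_INR_mul (a : nat -> R) : entire a -> entire (fun k => INR k * a k).
Proof.
  intros Ha r Hr. apply (ex_series_incr_1 (V := R_NormedModule)).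
  apply ex_series_ext with (fun k => scal r (Rabs (PS_derive a k) * r ^ k)).
  - intros k. unfold PS_derive, scal; simpl; unfold mult; simpl. ring.
  - apply (ex_series_scal (V := R_NormedModule)), entire_derive, Hr. exact Ha.
Qed.

Lemma entire_scal (c : R) (a : nat -> R) : entire a -> entire (fun k => c * a k).
Proof.
  apply entire_le with (Rabs c). intros k. rewrite Rabs_mult. lra.
Qed.

(** The binomial coefficient x over k for real x: the Pochhammer symbol is the falling factorial x
    (x-1) ... (x-k+1) read upwards. *)
Definition gbinom (x : R) (k : nat) : R := pochhammer (x - INR k + 1) k / INR (fact k).

Lemma pochhammer_succ_l (a : R) (k : nat) : pochhammer a (S k) = a * pochhammer (a + 1) k.
Proof.
  change (S k) with (1 + k)%nat. rewrite pochhammer_add. simpl. rewrite Rplus_0_r. ring.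
Qed.

Lemma fact_succ (k : nat) : INR (fact (S k)) = (INR k + 1) * INR (fact k).
Proof. rewrite fact_simpl, mult_INR, S_INR. reflexivity. Qed.

Lemma INR_fact_pos (k : nat) : 0 < INR (fact k).
Proof. apply lt_0_INR, lt_O_fact. Qed.

Lemma pochhammer_1 (k : nat) : pochhammer 1 k = INR (fact k).
Proof.
  induction k as [|k IH]; [reflexivity|]. simpl pochhammer. rewrite fact_succ, IH. ring.
Qed.

Lemma gbinom_succ (x : R) (k : nat) : (INR k + 1) * gbinom x (S k) = (x - INR k) * gbinom x k.
Proof.
  unfold gbinom. rewrite pochhammer_succ_l, fact_succ, S_INR.
  replace (x - (INR k + 1) + 1) with (x - INR k) by ring.
  pose proof (INR_fact_pos k). pose proof (pos_INR k). field. lra.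
Qed.

(** Multiply by n + 1 = k + (n + 1 - k) under the sum and lower each half by [gbinom_succ]; the
    factors a - k and b - (n - k) add up to a + b - n. *)
Lemma gbinom_vandermonde (a b : R) (n : nat) :
  gbinom (a + b) n = sum_f_R0 (fun k => gbinom a k * gbinom b (n - k)) n.
Proof.
  induction n as [|n IH].
  - unfold gbinom. simpl. field.
  - pose proof (pos_INR n) as Hn. apply Rmult_eq_reg_l with (INR n + 1); [|lra].
    rewrite gbinom_succ, IH.
    set (X := fun k => gbinom a k * gbinom b (S n - k)).
    assert (E1 : sum_f_R0 (fun k => INR k * X k) (S n) = sum_f_R0 (fun k => (a - INR k) * (gbinom a k * gbinom b (n - k))) n).
    { rewrite decomp_sum by lia. change (pred (S n)) with n. change (INR 0) with 0. rewrite Rmult_0_l, Rplus_0_l.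
      apply sum_eq. intros k Hk. unfold X. cbv beta. replace (S n - S k)%nat with (n - k)%nat by lia.
      rewrite S_INR, <- Rmult_assoc, gbinom_succ. ring. }
    assert (E2 : sum_f_R0 (fun k => (INR n + 1 - INR k) * X k) (S n) =
      sum_f_R0 (fun k => (b - INR (n - k)) * (gbinom a k * gbinom b (n - k))) n).
    { rewrite tech5, S_INR, Rminus_diag, Rmult_0_l, Rplus_0_r.
      apply sum_eq. intros k Hk. unfold X. cbv beta. replace (S n - k)%nat with (S (n - k)) by lia.
      replace (INR n + 1 - INR k) with (INR (n - k) + 1) by (rewrite minus_INR by lia; ring).
      transitivity (gbinom a k * ((INR (n - k) + 1) * gbinom b (S (n - k)))); [ring|]. rewrite gbinom_succ. ring. }
    rewrite !scal_sum.
    transitivity (sum_f_R0 (fun k => INR k * X k) (S n) + sum_f_R0 (fun k => (INR n + 1 - INR k) * X k) (S n)).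
    + rewrite E1, E2, <- sum_plus. apply sum_eq. intros k Hk. rewrite minus_INR by lia. ring.
    + rewrite <- sum_plus. apply sum_eq. intros k Hk. unfold X. ring.
Qed.

(** Coefficient of (z/2)^(2k) in (z/2)^(-nu) I_nu(z). *)
Definition alpha (nu : R) (k : nat) : R := / (INR (fact k) * Gamma (nu + INR k + 1)).

(** Keeps every Gamma value in [alpha nu] off the poles, where [Gamma] would take a default
    value. *)
Definition regular (nu : R) : Prop := ~ Gamma_pole (nu + 1).

Lemma regular_add (nu : R) (k : nat) : regular nu -> ~ Gamma_pole (nu + INR k + 1).
Proof.
  intros H. replace (nu + INR k + 1) with (nu + 1 + INR k) by ring. apply Gamma_pole_add, H.
Qed.

Lemma nonint_regular (nu : R) : (forall m : Z, nu <> IZR m) -> regular nu.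
Proof.
  intros H [n Hn]. apply (H (- Z.of_nat n - 1)%Z). rewrite minus_IZR, opp_IZR, <- INR_IZR_INZ. lra.
Qed.

Lemma alpha_succ (nu : R) (k : nat) : regular nu ->
  alpha nu k = (INR k + 1) * (nu + INR k + 1) * alpha nu (S k).
Proof.
  intros H. unfold alpha. rewrite fact_succ, S_INR.
  replace (nu + (INR k + 1) + 1) with (nu + INR k + 1 + 1) by ring.
  rewrite (Gamma_succ (nu + INR k + 1)) by apply regular_add, H.
  pose proof (Gamma_neq_0 _ (regular_add nu k H)). pose proof (INR_fact_pos k). pose proof (pos_INR k).
  assert (nu + INR k + 1 <> 0).
  { intros E. apply (regular_add nu k H). exists 0%nat. simpl. lra. }
  field. repeat split; lra.
Qed.

Lemma entire_alpha (nu : R) : regular nu -> entire (alpha nu).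
Proof.
  intros H. destruct (INR_unbounded (Rabs nu)) as [N HN]. apply entire_ratio with N.
  intros k Hk. apply le_INR in Hk. rewrite (alpha_succ nu k H).
  rewrite !Rabs_mult. rewrite Rmult_comm. apply Rmult_le_compat_r; [apply Rabs_pos|].
  pose proof (pos_INR k). pose proof (pos_INR N). pose proof (Rle_abs (- nu)). rewrite Rabs_Ropp in H2.
  rewrite !Rabs_pos_eq by lra. nra.
Qed.

(** Relative to Gamma(nu+n+1) Gamma(mu+n+1), the k-th product of coefficients is the binomial
    coefficient of mu + n over k times that of nu + n over n - k, so Vandermonde applies. *)
Lemma alpha_mult (nu mu : R) (n : nat) : regular nu -> regular mu ->
  PS_mult (alpha nu) (alpha mu) n =
  pochhammer (nu + mu + INR n + 1) n / (INR (fact n) * Gamma (nu + INR n + 1) * Gamma (mu + INR n + 1)).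
Proof.
  intros Hn Hm.
  pose proof (Gamma_neq_0 _ (regular_add nu n Hn)) as G1. pose proof (Gamma_neq_0 _ (regular_add mu n Hm)) as G2.
  pose proof (INR_fact_pos n) as Hf.
  transitivity (gbinom ((mu + INR n) + (nu + INR n)) n / (Gamma (nu + INR n + 1) * Gamma (mu + INR n + 1))).
  - rewrite gbinom_vandermonde. unfold PS_mult, Rdiv. rewrite Rmult_comm, scal_sum.
    apply sum_eq. intros k Hk. unfold alpha, gbinom.
    rewrite !minus_INR by lia.
    replace (mu + INR n - INR k + 1) with (mu + INR (n - k) + 1) by (rewrite minus_INR by lia; ring).
    replace (nu + INR n - (INR n - INR k) + 1) with (nu + INR k + 1) by ring.
    replace (mu + (INR n - INR k) + 1) with (mu + INR (n - k) + 1) by (rewrite minus_INR by lia; ring).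
    assert (E1 : Gamma (nu + INR n + 1) = pochhammer (nu + INR k + 1) (n - k) * Gamma (nu + INR k + 1)).
    { rewrite <- Gamma_shift by apply regular_add, Hn. f_equal. rewrite minus_INR by lia. ring. }
    assert (E2 : Gamma (mu + INR n + 1) = pochhammer (mu + INR (n - k) + 1) k * Gamma (mu + INR (n - k) + 1)).
    { rewrite <- Gamma_shift by apply regular_add, Hm. f_equal. rewrite minus_INR by lia. ring. }
    rewrite E1, E2. pose proof (INR_fact_pos k). pose proof (INR_fact_pos (n - k)).
    field. repeat split; try lra; try (apply Gamma_neq_0, regular_add; easy);
      apply pochhammer_neq_0, regular_add; easy.
  - unfold gbinom. replace (mu + INR n + (nu + INR n) - INR n + 1) with (nu + mu + INR n + 1) by ring.
    field. repeat split; lra.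
Qed.

Lemma pochhammer_double (a : R) (k : nat) :
  pochhammer (2 * a) (2 * k) = 4 ^ k * pochhammer a k * pochhammer (a + 1 / 2) k.
Proof.
  induction k as [|k IH]; [simpl; ring|].
  replace (2 * S k)%nat with (S (S (2 * k))) by lia.
  assert (Hm : INR (2 * k) = 2 * INR k) by (rewrite mult_INR; reflexivity).
  remember (2 * k)%nat as m eqn:Em. cbn [pochhammer pow]. rewrite IH, S_INR, Hm. field.
Qed.

Lemma pochhammer_mul_shift (a : R) (k : nat) : a * pochhammer (a + 1) k = (a + INR k) * pochhammer a k.
Proof. rewrite <- pochhammer_succ_l. simpl. ring. Qed.

(** * The product I_nu K_nu as power series, and its primitive *)

Lemma Cdiv_RtoC (w : C) (r : R) : r <> 0 -> (w / RtoC r)%C = (RtoC (/ r) * w)%C.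
Proof. intros H. unfold Cdiv. rewrite RtoC_inv by easy. ring. Qed.

Lemma BesselI_CPSeries (nu : R) (z : C) : regular nu ->
  BesselI nu z = (Cexp (RtoC nu * Clog (z / 2)) * CPSeries (alpha nu) ((z / 2) ^ 2))%C.
Proof.
  intros H. unfold BesselI, Cpower, CPSeries. f_equal. apply CSeries_ext. intros k.
  rewrite Cdiv_RtoC; [rewrite Cpow_mult_r; reflexivity|].
  apply Rmult_integral_contrapositive_currified; [apply Rgt_not_eq, INR_fact_pos|].
  apply Gamma_neq_0, regular_add, H.
Qed.

Lemma Cexp_add (a b : C) : Cexp (a + b) = (Cexp a * Cexp b)%C.
Proof.
  destruct a as [a1 a2], b as [b1 b2]. unfold Cexp, Cplus, Cmult; simpl.
  rewrite exp_plus, cos_plus, sin_plus. f_equal; ring.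
Qed.

Lemma Cexp_0 : Cexp (RtoC 0) = RtoC 1.
Proof. unfold Cexp, RtoC; simpl. rewrite exp_0, cos_0, sin_0. f_equal; ring. Qed.

Definition coef_c (nu : R) : nat -> R := PS_mult (alpha nu) (alpha nu).
Definition coef_d (nu : R) : nat -> R := PS_mult (alpha nu) (alpha (- nu)).
Definition kappa (nu : R) : R := PI / (2 * sin (PI * nu)).

Definition bessel_IK (nu : R) (z : C) : C :=
  (RtoC (kappa nu) * (CPSeries (coef_d nu) ((z / 2) ^ 2)
     - Cexp (RtoC (2 * nu) * Clog (z / 2)) * CPSeries (coef_c nu) ((z / 2) ^ 2)))%C.

Definition nonint (nu : R) : Prop := forall m : Z, nu <> IZR m.

Lemma nonint_opp (nu : R) : nonint nu -> nonint (- nu).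
Proof. intros H m Hm. apply (H (- m)%Z). rewrite opp_IZR. lra. Qed.

Lemma nonint_add (nu : R) (k : nat) : nonint nu -> nonint (nu + INR k).
Proof. intros H m Hm. apply (H (m - Z.of_nat k)%Z). rewrite minus_IZR, <- INR_IZR_INZ. lra. Qed.

Lemma bessel_product (nu : R) (z : C) : nonint nu -> 0 < nu -> (BesselI nu z * BesselK nu z)%C = bessel_IK nu z.
Proof.
  intros H Hp. pose proof (Gamma_reflection nu H Hp) as [_ Hs].
  pose proof (nonint_regular _ H) as R1. pose proof (nonint_regular _ (nonint_opp _ H)) as R2.
  unfold BesselK, bessel_IK, coef_c, coef_d, kappa. rewrite !BesselI_CPSeries, <- !CPSeries_mult by (try apply entire_alpha; easy).
  set (l := Clog (z / 2)). set (a := CPSeries _ _). set (b := CPSeries _ _).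
  assert (E1 : Cexp (RtoC (2 * nu) * l) = (Cexp (RtoC nu * l) * Cexp (RtoC nu * l))%C).
  { rewrite <- Cexp_add. f_equal. rewrite RtoC_mult. ring. }
  (* The opposite powers cancel: I_nu I_(-nu) is a power series in z^2 without branching. *)
  assert (E2 : (Cexp (RtoC nu * l) * Cexp (RtoC (- nu) * l) = 1)%C).
  { rewrite <- Cexp_add, <- Cexp_0. f_equal. rewrite RtoC_opp. ring. }
  rewrite E1.
  assert (E3 : RtoC (PI / (2 * sin (PI * nu))) = (PI / 2 / sin (PI * nu))%C).
  { rewrite RtoC_div, RtoC_mult by lra. field. repeat split; intros E; apply RtoC_inj in E; lra. }
  rewrite E3.
  transitivity (PI / 2 / sin (PI * nu) * ((Cexp (nu * l) * Cexp (RtoC (- nu) * l)) * (a * b)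
    - Cexp (nu * l) * Cexp (nu * l) * (a * a)))%C.
  - unfold Cdiv. ring.
  - rewrite E2. ring.
Qed.

(* At [k = 0] the division by zero makes [coef_d' nu 0 = 0]: the constant term of [I_nu I_(-nu)]
   integrates to the logarithm instead. *)
Definition coef_b' (nu : R) (k : nat) : R := coef_c nu k / (nu + INR k).
Definition coef_d' (nu : R) (k : nat) : R := coef_d nu k / INR k.

Lemma entire_coef_c (nu : R) : regular nu -> entire (coef_c nu).
Proof. intros H. apply entire_mult; apply entire_alpha, H. Qed.

Lemma entire_coef_d (nu : R) : nonint nu -> entire (coef_d nu).
Proof.
  intros H. apply entire_mult; apply entire_alpha, nonint_regular; trivial. apply nonint_opp, H.
Qed.

Lemma entire_coef_b' (nu : R) : 0 < nu -> entire (coef_b' nu).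
Proof.
  intros H. assert (R0 : regular nu) by (apply Gamma_pole_pos; lra).
  apply entire_le with (2 := entire_coef_c nu R0) (M := / nu). intros k. unfold coef_b'.
  pose proof (pos_INR k). unfold Rdiv. rewrite Rabs_mult, Rmult_comm.
  apply Rmult_le_compat_r; [apply Rabs_pos|]. rewrite Rabs_pos_eq by (left; apply Rinv_0_lt_compat; lra).
  apply Rinv_le_contravar; lra.
Qed.

Lemma entire_coef_d' (nu : R) : nonint nu -> entire (coef_d' nu).
Proof.
  intros H. apply entire_le with (2 := entire_coef_d nu H) (M := 1). intros k. unfold coef_d'.
  unfold Rdiv. rewrite Rabs_mult, Rmult_comm.
  apply Rmult_le_compat_r; [apply Rabs_pos|]. destruct k as [|k].
  - simpl. rewrite Rinv_0, Rabs_R0. lra.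
  - pose proof (pos_INR k). rewrite S_INR. rewrite Rabs_pos_eq by (left; apply Rinv_0_lt_compat; lra).
    rewrite <- Rinv_1. apply Rinv_le_contravar; lra.
Qed.

(** The right-hand side of the theorem with psi left free: the derivative does not see this
    constant, and only the limit at infinity selects [digamma nu]. *)
Definition primitive (nu psi : R) (z : C) : C :=
  (RtoC (kappa nu / 2) * Cexp (RtoC (2 * nu) * Clog (z / 2)) * CPSeries (coef_b' nu) ((z / 2) ^ 2)
   - RtoC (kappa nu / 2) * CPSeries (coef_d' nu) ((z / 2) ^ 2)
   - RtoC (/ (2 * nu)) * Clog (z / 2)
   + RtoC ((psi + 1 / (2 * nu)) / (2 * nu)))%C.

Lemma kappa_coef_d_0 (nu : R) : nonint nu -> 0 < nu -> kappa nu * coef_d nu 0 = / (2 * nu).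
Proof.
  intros H Hp. destruct (Gamma_reflection nu H Hp) as [Hg Hs]. pose proof PI_RGT_0.
  unfold kappa, coef_d, PS_mult, alpha. simpl. rewrite !Rplus_0_r, !Rmult_1_l.
  rewrite (Rplus_comm nu), (Rplus_comm (- nu)). rewrite <- Rinv_mult.
  change (1 + - nu) with (1 - nu). rewrite Hg. field. lra.
Qed.

Lemma cut_plane_half (z : C) : cut_plane z -> cut_plane (z / 2).
Proof.
  intros H [H1 H2]. apply H. destruct z as [x y]. unfold Cdiv, Cinv, Cmult in *; simpl in *.
  split; field_simplify in H1; field_simplify in H2; lra.
Qed.

Lemma C2_neq_0 : RtoC 2 <> RtoC 0.
Proof. intros E. apply RtoC_inj in E. lra. Qed.

Lemma path_der_half (g : R -> C) (t : R) (l : C) : path_der g t l -> path_der (fun u => (g u / 2)%C) t (l / 2)%C.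
Proof.
  intros H. eapply path_der_ext; [| eapply path_der_eq; [apply (path_der_scal (/ 2)%C), H|]].
  - intros u. unfold Cdiv. ring.
  - unfold Cdiv. ring.
Qed.

Lemma limC_half {T : Type} (F : (T -> Prop) -> Prop) {FF : Filter F} (u : T -> C) (a : C) :
  limC F u a -> limC F (fun x => (u x / 2)%C) (a / 2)%C.
Proof. intros H. apply (limC_mult F); [exact H | apply limC_const; easy]. Qed.

(** The operator nu + w d/dw multiplies the k-th coefficient by nu + k and so undoes the division in
    [coef_b']. *)
Lemma CPSeries_coef_b' (nu : R) (w : C) : 0 < nu ->
  (RtoC nu * CPSeries (coef_b' nu) w + w * CPSeries (PS_derive (coef_b' nu)) w)%C = CPSeries (coef_c nu) w.
Proof.
  intros H. pose proof (entire_coef_b' nu H) as He.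
  rewrite CPSeries_euler, <- CPSeries_scal, <- CPSeries_plus by (try apply entire_scal; try apply entire_INR_mul; exact He).
  apply CPSeries_ext. intros k. unfold coef_b'. pose proof (pos_INR k). field. lra.
Qed.

Lemma is_series_zero : is_series (fun _ : nat => 0) 0.
Proof.
  apply (filterlim_ext (fun _ : nat => 0)); [| apply filterlim_const].
  intros n. induction n as [|n IH]; [symmetry; apply sum_O|].
  rewrite sum_Sn, <- IH. unfold plus; simpl. ring.
Qed.

Lemma CPSeries_coef_d' (nu : R) (w : C) : nonint nu ->
  (w * CPSeries (PS_derive (coef_d' nu)) w)%C = (CPSeries (coef_d nu) w - RtoC (coef_d nu 0))%C.
Proof.
  intros H. rewrite CPSeries_euler by apply entire_coef_d', H.
  apply is_CSeries_unique.
  (* A series supported at index 0 accounts for the constant term lost in [coef_d']. *)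
  assert (H0 : is_CSeries (fun k => match k with O => RtoC (coef_d nu 0) | S _ => RtoC 0 end) (RtoC (coef_d nu 0))).
  { split; simpl; apply (is_series_decr_1 (V := R_NormedModule)); unfold plus, opp; simpl.
    - rewrite Rplus_opp_r. apply is_series_zero.
    - rewrite Ropp_0, Rplus_0_r. apply is_series_zero. }
  replace (CPSeries (coef_d nu) w - RtoC (coef_d nu 0))%C with (CPSeries (coef_d nu) w + -(1) * RtoC (coef_d nu 0))%C by ring.
  eapply is_CSeries_ext; [| apply is_CSeries_plus; [apply is_CSeries_CPSeries, entire_coef_d, H | apply is_CSeries_scal, H0]].
  intros [|k]; unfold coef_d'.
  - simpl. rewrite Rmult_0_l. ring.
  - replace (INR (S k) * (coef_d nu (S k) / INR (S k))) with (coef_d nu (S k)) by (field; apply not_0_INR; lia). ring.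
Qed.

Lemma path_der_primitive (nu psi : R) (g : R -> C) (t : R) (l : C) : nonint nu -> 0 < nu ->
  cut_plane (g t) -> path_der g t l -> path_der (fun u => primitive nu psi (g u)) t (- (bessel_IK nu (g t) / g t * l))%C.
Proof.
  intros H Hp Hc Hg. set (z := g t) in *.
  pose proof (path_der_half g t l Hg) as Hh. pose proof (cut_plane_half z Hc) as Hch.
  pose proof (path_der_Clog (fun u => (g u / 2)%C) t _ Hch Hh) as HL.
  pose proof (path_der_mult _ _ t _ _ Hh (path_der_mult _ _ t _ _ Hh (path_der_const (RtoC 1) t))) as Hq.
  pose proof (path_der_Cexp _ t _ (path_der_scal (RtoC (2 * nu)) _ t _ HL)) as HE.
  pose proof (path_der_CPSeries _ _ t _ (entire_coef_b' nu Hp) Hq) as HB.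
  pose proof (path_der_CPSeries _ _ t _ (entire_coef_d' nu H) Hq) as HD.
  pose proof (path_der_plus _ _ t _ _ (path_der_plus _ _ t _ _ (path_der_plus _ _ t _ _
     (path_der_mult _ _ t _ _ (path_der_scal (RtoC (kappa nu / 2)) _ t _ HE) HB)
     (path_der_scal (- RtoC (kappa nu / 2))%C _ t _ HD)) (path_der_scal (- RtoC (/ (2 * nu)))%C _ t _ HL))
     (path_der_const (RtoC ((psi + 1 / (2 * nu)) / (2 * nu))) t)) as HF.
  eapply path_der_ext; [| eapply path_der_eq; [exact HF|]].
  - intros u. unfold primitive. simpl. ring.
  - clear HF HD HB HE Hq HL Hh Hg. cbv beta. fold z.
    change (z / 2 * (z / 2 * 1))%C with ((z / 2) ^ 2)%C.
    pose proof (cut_plane_neq_0 z Hc) as Hz.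
    pose proof (CPSeries_coef_b' nu ((z / 2) ^ 2) Hp) as EB. pose proof (CPSeries_coef_d' nu ((z / 2) ^ 2) H) as ED.
    unfold bessel_IK. pose proof (kappa_coef_d_0 nu H Hp) as EK. apply (f_equal RtoC) in EK. rewrite RtoC_mult in EK.
    rewrite <- EB, <- EK. replace (CPSeries (coef_d nu) ((z / 2) ^ 2)) with
      ((z / 2) ^ 2 * CPSeries (PS_derive (coef_d' nu)) ((z / 2) ^ 2) + RtoC (coef_d nu 0))%C by (rewrite ED; ring).
    set (X := Cexp _). set (B := CPSeries (coef_b' nu) _). set (B' := CPSeries (PS_derive (coef_b' nu)) _).
    set (D' := CPSeries (PS_derive (coef_d' nu)) _).
    replace (RtoC (kappa nu / 2)) with (RtoC (kappa nu) / 2)%C by (rewrite RtoC_div by lra; reflexivity).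
    rewrite (RtoC_mult 2 nu). field. repeat split; try exact Hz; apply C2_neq_0.
Qed.

Lemma limC_primitive (nu psi : R) (z : C) : nonint nu -> 0 < nu -> cut_plane z ->
  limC (@locally C_UniformSpace z) (primitive nu psi) (primitive nu psi z).
Proof.
  intros H Hp Hc. pose proof (limC_half _ _ _ (limC_id z)) as Hh.
  pose proof (limC_Clog _ _ _ (cut_plane_half z Hc) Hh) as HL.
  pose proof (limC_pow _ _ _ 2 Hh) as Hq.
  unfold primitive, Cminus.
  assert (HK : forall c : C, limC (@locally C_UniformSpace z) (fun _ => c) c).
  { intros c. apply limC_const. typeclasses eauto. }
  refine (limC_plus _ _ _ _ _ (limC_plus _ _ _ _ _ (limC_plus _ _ _ _ _
    (limC_mult _ _ _ _ _ (limC_mult _ _ _ _ _ (HK _) (limC_Cexp _ _ _ (limC_mult _ _ _ _ _ (HK _) HL))) _)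
    (limC_opp _ _ _ (limC_mult _ _ _ _ _ (HK _) _))) (limC_opp _ _ _ (limC_mult _ _ _ _ _ (HK _) HL))) (HK _)).
  - apply (limC_continuous _ (CPSeries (coef_b' nu)) (fun z => ((z / 2) ^ 2)%C)); trivial. apply CPSeries_continuous, entire_coef_b', Hp.
  - apply (limC_continuous _ (CPSeries (coef_d' nu)) (fun z => ((z / 2) ^ 2)%C)); trivial. apply CPSeries_continuous, entire_coef_d', H.
Qed.

Lemma limC_bessel_IK_div (nu : R) (z : C) : nonint nu -> 0 < nu -> cut_plane z ->
  limC (@locally C_UniformSpace z) (fun z => (bessel_IK nu z / z)%C) (bessel_IK nu z / z)%C.
Proof.
  intros H Hp Hc. pose proof (limC_half _ _ _ (limC_id z)) as Hh.
  pose proof (limC_Clog _ _ _ (cut_plane_half z Hc) Hh) as HL.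
  pose proof (limC_pow _ _ _ 2 Hh) as Hq.
  assert (HK : forall c : C, limC (@locally C_UniformSpace z) (fun _ => c) c).
  { intros c. apply limC_const. typeclasses eauto. }
  unfold bessel_IK, Cminus.
  refine (limC_mult _ _ _ _ _ (limC_mult _ _ _ _ _ (HK _) (limC_plus _ _ _ _ _ _
    (limC_opp _ _ _ (limC_mult _ _ _ _ _ (limC_Cexp _ _ _ (limC_mult _ _ _ _ _ (HK _) HL)) _))))
    (limC_inv _ _ _ (cut_plane_neq_0 z Hc) (limC_id z))).
  - apply (limC_continuous _ (CPSeries (coef_d nu)) (fun z => ((z / 2) ^ 2)%C)); trivial. apply CPSeries_continuous, entire_coef_d, H.
  - apply (limC_continuous _ (CPSeries (coef_c nu)) (fun z => ((z / 2) ^ 2)%C)); trivial.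
    apply CPSeries_continuous, entire_coef_c, nonint_regular, H.
Qed.

Lemma path_primitive_bessel_IK (nu psi : R) : nonint nu -> 0 < nu ->
  path_primitive cut_plane (fun z => (- primitive nu psi z)%C) (fun z => (BesselI nu z * BesselK nu z / z)%C).
Proof.
  intros H Hp. split; [|split].
  - intros w Hw. exact (limC_opp _ _ _ (limC_primitive nu psi w H Hp Hw)).
  - intros w Hw. rewrite bessel_product by trivial.
    apply (filterlim_ext (F := locally w) (fun z => (bessel_IK nu z / z)%C)).
    + intros v. rewrite bessel_product by trivial. reflexivity.
    + apply limC_bessel_IK_div; trivial.
  - intros g t l Hc Hg. rewrite bessel_product by trivial.
    eapply path_der_ext; [| eapply path_der_eq; [apply (path_der_scal (-(1))%C), (path_der_primitive nu psi g t l H Hp Hc Hg)|]].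
    + intros u. simpl. ring.
    + ring.
Qed.

(** * Bessel functions on the positive axis *)

Lemma entire_CV_radius (a : nat -> R) (r : R) : entire a -> Rbar_lt (Rabs r) (CV_radius a).
Proof.
  intros Ha. apply Rbar_lt_le_trans with (Rabs r + 1); [simpl; lra|].
  pose proof (Rabs_pos r).
  unfold CV_radius. apply (proj1 (Lub_Rbar_correct (CV_disk a))).
  unfold CV_disk. apply ex_series_ext with (2 := Ha (Rabs r + 1) ltac:(lra)).
  intros k. rewrite Rabs_mult. f_equal. symmetry. apply Rabs_pos_eq, pow_le. lra.
Qed.

Lemma PSeries_derivable (a : nat -> R) (w : R) : entire a -> is_derive (PSeries a) w (PSeries (PS_derive a) w).
Proof. intros Ha. apply is_derive_PSeries, entire_CV_radius, Ha. Qed.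

Lemma ex_series_pseries (a : nat -> R) (w : R) : entire a -> ex_series (fun k => a k * w ^ k).
Proof.
  intros Ha. apply ex_series_le_Rabs with (2 := Ha (Rabs w) (Rabs_pos w)).
  intros k. unfold norm; simpl. unfold abs; simpl. rewrite Rabs_mult, RPow_abs. lra.
Qed.

Lemma PSeries_le (a b : nat -> R) (w : R) : entire b -> 0 <= w ->
  (forall k, 0 <= a k <= b k) -> PSeries a w <= PSeries b w.
Proof.
  intros Hb Hw H. apply Series_le; [| apply ex_series_pseries, Hb].
  intros k. pose proof (pow_le w k Hw). split; [apply Rmult_le_pos | apply Rmult_le_compat_r]; trivial; apply H.
Qed.

(** The constant term is there for positivity of I_nu, the linear one for a growth rate in
    [BI_lower]. *)
Lemma PSeries_ge_two_terms (a : nat -> R) (w : R) : entire a -> 0 <= w -> (forall k, 0 <= a k) ->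
  a O + a 1%nat * w <= PSeries a w.
Proof.
  intros Ha Hw H. unfold PSeries. pose proof (ex_series_pseries a w Ha) as Hex.
  rewrite Series_incr_1 by exact Hex.
  pose proof (proj1 (ex_series_incr_1 _) Hex) as Hex1.
  rewrite Series_incr_1 by exact Hex1.
  pose proof (proj1 (ex_series_incr_1 _) Hex1) as Hex2.
  assert (0 <= Series (fun k => a (S (S k)) * w ^ S (S k))).
  { rewrite <- (Series_zero (fun _ => 0)) by easy. apply Series_le; [| exact Hex2].
    intros k. split; [lra|]. apply Rmult_le_pos; [apply H | apply pow_le, Hw]. }
  simpl pow at 1 2. lra.
Qed.

Lemma alpha_pos (nu : R) (k : nat) : -1 < nu -> 0 < alpha nu k.
Proof.
  intros H. unfold alpha. pose proof (pos_INR k).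
  apply Rinv_0_lt_compat, Rmult_lt_0_compat; [apply INR_fact_pos | apply Gamma_pos; lra].
Qed.

Lemma regular_gt (nu : R) : -1 < nu -> regular nu.
Proof. intros H. apply Gamma_pole_pos. lra. Qed.

Lemma regular_succ (nu : R) : regular nu -> regular (nu + 1).
Proof. intros H. apply Gamma_pole_succ, H. Qed.

(** In w = (z/2)^2 differentiation raises the order by one: the classical rule that the derivative
    of x^(-nu) I_nu is x^(-nu) I_(nu+1). *)
Lemma PS_derive_alpha (nu : R) (k : nat) : PS_derive (alpha nu) k = alpha (nu + 1) k.
Proof.
  unfold PS_derive, alpha. rewrite fact_succ, S_INR.
  replace (nu + (INR k + 1) + 1) with (nu + 1 + INR k + 1) by ring.
  pose proof (pos_INR k). rewrite Rmult_assoc, Rinv_mult, <- Rmult_assoc, Rinv_r, Rmult_1_l by lra. reflexivity.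
Qed.

(* [BI nu s] is the modified Bessel function [I_nu (2 exp s)]: in the variable [s] the operator
   [x d/dx] is just the derivative. *)
Definition BI (nu s : R) : R := exp (nu * s) * PSeries (alpha nu) (exp (2 * s)).

Definition dBI (nu s : R) : R := nu * BI nu s + 2 * exp s * BI (nu + 1) s.

Lemma exp_double (s : R) : exp (2 * s) = exp s * exp s.
Proof. rewrite <- exp_plus. f_equal. ring. Qed.

Lemma exp_mul_succ (nu s : R) : exp ((nu + 1) * s) = exp (nu * s) * exp s.
Proof. rewrite <- exp_plus. f_equal. ring. Qed.

Lemma is_derive_exp_PSeries (a : nat -> R) (nu s : R) : entire a ->
  is_derive (fun s => exp (nu * s) * PSeries a (exp (2 * s))) s
    (exp (nu * s) * (nu * PSeries a (exp (2 * s)) + 2 * exp (2 * s) * PSeries (PS_derive a) (exp (2 * s)))).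
Proof.
  intros Ha. pose proof (PSeries_derivable a (exp (2 * s)) Ha) as HP.
  set (f := PSeries a) in *. set (l := PSeries (PS_derive a) (exp (2 * s))) in *. clearbody f l.
  auto_derive; [eexists; exact HP |].
  use_derive HP. ring.
Qed.

Lemma is_derive_eq (f : R -> R) (x l l' : R) : is_derive f x l -> l = l' -> is_derive f x l'.
Proof. intros H <-. exact H. Qed.

Lemma BI_derive (nu s : R) : regular nu -> is_derive (BI nu) s (dBI nu s).
Proof.
  intros H. eapply is_derive_eq; [apply is_derive_exp_PSeries, entire_alpha, H|].
  unfold dBI, BI. rewrite (PSeries_ext (PS_derive (alpha nu)) (alpha (nu + 1))) by apply PS_derive_alpha.
  rewrite exp_mul_succ. rewrite !(exp_double s). ring.
Qed.

Lemma alpha_pred (nu : R) (k : nat) : regular (nu - 1) -> alpha (nu - 1) k = (nu + INR k) * alpha nu k.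
Proof.
  intros H. unfold alpha. replace (nu - 1 + INR k + 1) with (nu + INR k) by ring.
  assert (Hp : ~ Gamma_pole (nu + INR k)).
  { replace (nu + INR k) with (nu - 1 + INR k + 1) by ring. apply regular_add, H. }
  rewrite (Gamma_succ (nu + INR k)) by exact Hp.
  pose proof (INR_fact_pos k). pose proof (Gamma_neq_0 _ Hp).
  assert (nu + INR k <> 0) by (intros E; apply Hp; exists 0%nat; simpl; lra).
  field. repeat split; trivial. lra.
Qed.

Lemma PSeries_alpha_rec (nu w : R) : regular (nu - 1) ->
  PSeries (alpha (nu - 1)) w = w * PSeries (alpha (nu + 1)) w + nu * PSeries (alpha nu) w.
Proof.
  intros H. assert (Hn : regular nu) by (replace nu with (nu - 1 + 1) by ring; apply regular_succ, H).
  pose proof (entire_alpha _ Hn) as E0. pose proof (entire_alpha _ (regular_succ _ Hn)) as E1.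
  apply RtoC_inj. rewrite RtoC_plus, !RtoC_mult, <- !CPSeries_real.
  rewrite <- (CPSeries_ext (PS_derive (alpha nu)) (alpha (nu + 1)) w) by apply PS_derive_alpha.
  rewrite CPSeries_euler, <- CPSeries_scal, <- CPSeries_plus by (try apply entire_INR_mul; try apply entire_scal; exact E0).
  apply CPSeries_ext. intros k. rewrite alpha_pred by exact H. ring.
Qed.

Lemma BI_rec (nu s : R) : regular (nu - 1) ->
  2 * exp s * BI (nu - 1) s = 2 * exp s * BI (nu + 1) s + 2 * nu * BI nu s.
Proof.
  intros H. unfold BI. rewrite PSeries_alpha_rec by exact H. rewrite exp_mul_succ.
  replace (exp (nu * s)) with (exp ((nu - 1) * s) * exp s) by (rewrite <- exp_plus; f_equal; ring).
  rewrite (exp_double s). ring.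
Qed.

Lemma dBI_pred (nu s : R) : regular nu -> dBI (nu + 1) s = 2 * exp s * BI nu s - (nu + 1) * BI (nu + 1) s.
Proof.
  intros H. pose proof (BI_rec (nu + 1) s) as E. replace (nu + 1 - 1) with nu in E by ring.
  specialize (E H). unfold dBI. lra.
Qed.

(** The modified Bessel equation: the square of x d/dx multiplies I_nu by x^2 + nu^2. *)
Lemma dBI_derive (nu s : R) : regular nu ->
  is_derive (dBI nu) s ((4 * exp (2 * s) + nu ^ 2) * BI nu s).
Proof.
  intros H. pose proof (BI_derive nu s H) as D0. pose proof (BI_derive _ s (regular_succ _ H)) as D1.
  unfold dBI at 1. auto_derive.
  - split; [eexists; exact D0 | split; [eexists; exact D1 | easy]].
  - use_derive D0. use_derive D1. rewrite dBI_pred by exact H. unfold dBI. rewrite exp_double. ring.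
Qed.

Lemma BI_pos (nu s : R) : -1 < nu -> 0 < BI nu s.
Proof.
  intros H. unfold BI. apply Rmult_lt_0_compat; [apply exp_pos|].
  pose proof (alpha_pos nu 0 H). pose proof (alpha_pos nu 1 H). pose proof (exp_pos (2 * s)).
  eapply Rlt_le_trans; [| apply PSeries_ge_two_terms].
  - assert (0 < alpha nu 1 * exp (2 * s)) by (apply Rmult_lt_0_compat; lra). lra.
  - apply entire_alpha, regular_gt, H.
  - lra.
  - intros k. left. apply alpha_pos, H.
Qed.

Lemma BI_lower (nu s : R) : -1 < nu -> alpha nu 1 * exp ((nu + 2) * s) <= BI nu s.
Proof.
  intros H. unfold BI. replace ((nu + 2) * s) with (nu * s + 2 * s) by ring. rewrite exp_plus.
  replace (alpha nu 1 * (exp (nu * s) * exp (2 * s))) with (exp (nu * s) * (alpha nu 1 * exp (2 * s))) by ring.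
  apply Rmult_le_compat_l; [left; apply exp_pos|].
  pose proof (alpha_pos nu 0 H).
  eapply Rle_trans; [| apply PSeries_ge_two_terms].
  - lra.
  - apply entire_alpha, regular_gt, H.
  - left. apply exp_pos.
  - intros k. left. apply alpha_pos, H.
Qed.

(** * Limits in s, monotone comparison and bounds for I_nu *)

Lemma lim_plus (b : Rbar) (u v : R -> R) (x y : R) :
  filterlim u (Rbar_locally b) (locally x) -> filterlim v (Rbar_locally b) (locally y) ->
  filterlim (fun t => u t + v t) (Rbar_locally b) (locally (x + y)).
Proof. apply filterlim_Rplus, Rbar_locally_filter. Qed.

Lemma lim_mult (b : Rbar) (u v : R -> R) (x y : R) :
  filterlim u (Rbar_locally b) (locally x) -> filterlim v (Rbar_locally b) (locally y) ->
  filterlim (fun t => u t * v t) (Rbar_locally b) (locally (x * y)).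
Proof. apply filterlim_Rmult, Rbar_locally_filter. Qed.

Lemma exp_small (c e : R) : 0 < c -> 0 < e -> Rbar_locally m_infty (fun s => exp (c * s) < e).
Proof.
  intros Hc He. exists (ln e / c). intros s Hs. rewrite <- (exp_ln e He) at 1.
  apply exp_increasing. apply Rmult_lt_compat_l with (r := c) in Hs; trivial.
  replace (c * (ln e / c)) with (ln e) in Hs by (field; lra). exact Hs.
Qed.

Lemma exp_minfty (c : R) : 0 < c -> lim_minfty (fun s => exp (c * s)) 0.
Proof.
  intros Hc P [eps HP]. unfold filtermap.
  apply (filter_imp (F := Rbar_locally m_infty)) with (2 := exp_small c eps Hc (cond_pos eps)).
  intros s Hs. apply HP. apply Rabs_ball; simpl.
  rewrite Rminus_0_r, Rabs_pos_eq; [easy | left; apply exp_pos].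
Qed.

Lemma exp_pinfty (c : R) : 0 < c -> lim_pinfty (fun s => exp (- (c * s))) 0.
Proof.
  intros Hc P HP. destruct (exp_minfty c Hc P HP) as [M HM]. exists (- M). intros s Hs.
  specialize (HM (- s) ltac:(lra)). unfold filtermap in HM. replace (- (c * s)) with (c * - s) by ring. exact HM.
Qed.

Lemma filterlim_eq {T : Type} (F : (T -> Prop) -> Prop) (f : T -> R) (l l' : R) :
  l = l' -> filterlim f F (locally l) -> filterlim f F (locally l').
Proof. intros <-. trivial. Qed.

Lemma filterlim_squeeze {T : Type} (F : (T -> Prop) -> Prop) {FF : Filter F} (f g h : T -> R) (l : R) :
  F (fun x => f x <= h x <= g x) -> filterlim f F (locally l) -> filterlim g F (locally l) ->
  filterlim h F (locally l).
Proof.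
  intros H Hf Hg P [eps HP].
  assert (H1 : F (fun x => ball l eps (f x))) by (apply Hf; exists eps; trivial).
  assert (H2 : F (fun x => ball l eps (g x))) by (apply Hg; exists eps; trivial).
  unfold filtermap. apply (filter_imp (F := F)) with (2 := filter_and _ _ H (filter_and _ _ H1 H2)).
  intros x (Hx & B1 & B2). apply HP.
  apply ball_Rabs in B1. apply ball_Rabs in B2. apply Rabs_ball.
  apply Rabs_def2 in B1. apply Rabs_def2 in B2. apply Rabs_def1; lra.
Qed.

Lemma filterlim_ge {T : Type} (F : (T -> Prop) -> Prop) {FF : ProperFilter F} (f : T -> R) (l c : R) :
  F (fun x => c <= f x) -> filterlim f F (locally l) -> c <= l.
Proof.
  intros H Hf. apply Rnot_lt_le. intros Hlt.
  assert (H1 : F (fun x => f x < c)) by exact (Hf (fun y => y < c) (open_lt c l Hlt)).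
  destruct (filter_ex (F := F) _ (filter_and _ _ H H1)) as [x [A B]]. lra.
Qed.

Lemma filterlim_le_upper {T : Type} (F : (T -> Prop) -> Prop) {FF : ProperFilter F} (f : T -> R) (l c : R) :
  F (fun x => f x <= c) -> filterlim f F (locally l) -> l <= c.
Proof.
  intros H Hf. apply Rnot_lt_le. intros Hlt.
  assert (H1 : F (fun x => c < f x)) by exact (Hf (fun y => c < y) (open_gt c l Hlt)).
  destruct (filter_ex (F := F) _ (filter_and _ _ H H1)) as [x [A B]]. lra.
Qed.

Lemma nondecreasing_of_derive (f f' : R -> R) : (forall t, is_derive f t (f' t)) -> (forall t, 0 <= f' t) ->
  forall a b, a <= b -> f a <= f b.
Proof.
  intros Hd Hp a b Hab. destruct (MVT_gen f a b f') as [c [_ E]].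
  - intros t _. apply Hd.
  - intros t _. apply continuity_pt_filterlim, continuous_derivable. eexists. apply Hd.
  - specialize (Hp c). nra.
Qed.

Lemma nondecreasing_ge_limit (f f' : R -> R) (l : R) : (forall t, is_derive f t (f' t)) -> (forall t, 0 <= f' t) ->
  lim_minfty f l -> forall s, l <= f s.
Proof.
  intros Hd Hp Hl s. apply (filterlim_le_upper (Rbar_locally m_infty)) with f; trivial.
  exists s. intros t Ht. apply (nondecreasing_of_derive f f'); trivial. lra.
Qed.

Lemma nondecreasing_le_limit (f f' : R -> R) (l : R) : (forall t, is_derive f t (f' t)) -> (forall t, 0 <= f' t) ->
  lim_pinfty f l -> forall s, f s <= l.
Proof.
  intros Hd Hp Hl s. apply (filterlim_ge (Rbar_locally p_infty)) with f; trivial.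
  exists s. intros t Ht. apply (nondecreasing_of_derive f f'); trivial. lra.
Qed.

Lemma PSeries_exp_minfty (a : nat -> R) : entire a ->
  lim_minfty (fun s => PSeries a (exp (2 * s))) (a O).
Proof.
  intros Ha. replace (a O) with (PSeries a 0) by apply PSeries_0.
  apply (filterlim_Rcont _ (PSeries a)).
  - apply continuous_derivable. eexists. apply PSeries_derivable, Ha.
  - apply exp_minfty. lra.
Qed.

Lemma BI_minfty (nu : R) : 0 < nu -> lim_minfty (BI nu) 0.
Proof.
  intros H. replace 0 with (0 * alpha nu 0) by ring.
  apply lim_mult; [apply exp_minfty, H |].
  apply PSeries_exp_minfty, entire_alpha, regular_gt. lra.
Qed.

Lemma dBI_minfty (nu : R) : 0 < nu -> lim_minfty (dBI nu) 0.
Proof.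
  intros H. replace 0 with (nu * 0 + 2 * 0 * 0) by ring.
  apply lim_plus.
  - apply lim_mult; [apply filterlim_const | apply BI_minfty, H].
  - apply lim_mult; [| apply BI_minfty; lra].
    apply lim_mult; [apply filterlim_const|].
    apply (filterlim_ext (fun s => exp (1 * s))); [intros s; rewrite Rmult_1_l; reflexivity | apply exp_minfty; lra].
Qed.

(* [sqrt (x^2 + nu^2)] at [x = 2 exp s]. *)
Definition rad (nu s : R) : R := sqrt (4 * exp (2 * s) + nu ^ 2).

Lemma rad_sq (nu s : R) : rad nu s * rad nu s = 4 * exp (2 * s) + nu ^ 2.
Proof. apply sqrt_sqrt. pose proof (exp_pos (2 * s)). pose proof (pow2_ge_0 nu). lra. Qed.

Lemma rad_bounds (nu s : R) : 0 < nu -> 2 * exp s < rad nu s /\ nu < rad nu s /\ rad nu s < 2 * exp s + nu.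
Proof.
  intros H. pose proof (rad_sq nu s) as E. rewrite exp_double in E. pose proof (exp_pos s).
  assert (0 <= rad nu s) by apply sqrt_pos. repeat split; nra.
Qed.

(* [(x^2 + nu^2) I^2 - (x I')^2] increases from [0]; the same expression for [K] increases to [0],
   which gives the reverse inequality in [dBK_upper]. *)
Lemma dBI_upper (nu s : R) : 0 < nu -> dBI nu s <= rad nu s * BI nu s.
Proof.
  intros H. assert (Hr : regular nu) by (apply regular_gt; lra).
  assert (HE : 0 <= (4 * exp (2 * s) + nu ^ 2) * BI nu s ^ 2 - dBI nu s ^ 2).
  { apply (nondecreasing_ge_limit (fun s => (4 * exp (2 * s) + nu ^ 2) * BI nu s ^ 2 - dBI nu s ^ 2)
      (fun s => 8 * exp (2 * s) * BI nu s ^ 2)).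
    - intros t. pose proof (BI_derive nu t Hr) as D0. pose proof (dBI_derive nu t Hr) as D1.
      auto_derive; [repeat split; eexists; eassumption|]. use_derive D0. use_derive D1. ring.
    - intros t. apply Rmult_le_pos; [pose proof (exp_pos (2 * t)); lra | apply pow2_ge_0].
    - replace 0 with ((4 * 0 + nu ^ 2) * 0 ^ 2 + - 0 ^ 2) by ring.
      apply lim_plus.
      + apply lim_mult.
        * apply lim_plus; [| apply filterlim_const].
          apply lim_mult; [apply filterlim_const | apply exp_minfty; lra].
        * apply filterlim_Rpow2, BI_minfty, H.
      + apply filterlim_Ropp, filterlim_Rpow2, dBI_minfty, H. }
  rewrite <- rad_sq in HE. destruct (rad_bounds nu s H) as (_ & Hb & _).
  pose proof (BI_pos nu s ltac:(lra)). apply Rnot_lt_le. intros Hlt.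
  assert (0 < rad nu s * BI nu s) by (apply Rmult_lt_0_compat; lra). nra.
Qed.

(* [(x I_nu' / I_nu - nu) (x I_(nu+1)' / I_(nu+1) + nu + 1) = x^2], so that the upper bound at [nu + 1]
   becomes a lower bound at [nu]. *)
Lemma BI_succ_lower (nu s : R) : 0 < nu ->
  (rad (nu + 1) s - nu - 1) * BI nu s <= 2 * exp s * BI (nu + 1) s.
Proof.
  intros H. pose proof (dBI_upper (nu + 1) s ltac:(lra)) as Hu.
  rewrite dBI_pred in Hu by (apply regular_gt; lra).
  destruct (rad_bounds (nu + 1) s ltac:(lra)) as (_ & Hb & _).
  pose proof (rad_sq (nu + 1) s) as E. rewrite exp_double in E. pose proof (exp_pos s).
  apply Rmult_le_reg_l with (rad (nu + 1) s + nu + 1); [lra|].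
  replace ((rad (nu + 1) s + nu + 1) * ((rad (nu + 1) s - nu - 1) * BI nu s)) with
    ((rad (nu + 1) s * rad (nu + 1) s - (nu + 1) ^ 2) * BI nu s) by ring.
  rewrite E. apply Rmult_le_compat_l with (r := 2 * exp s) in Hu; [|lra]. nra.
Qed.

Lemma dBI_lower (nu s : R) : 0 < nu -> (rad (nu + 1) s - 1) * BI nu s <= dBI nu s.
Proof. intros H. pose proof (BI_succ_lower nu s H). unfold dBI. lra. Qed.

Lemma dBI_ge (nu s : R) : 0 < nu -> nu * BI nu s <= dBI nu s.
Proof.
  intros H. pose proof (BI_pos (nu + 1) s ltac:(lra)). pose proof (exp_pos s). unfold dBI. nra.
Qed.

(** [dBI_upper] reads x I_(nu+1) <= (rad - nu) I_nu, and rad < x + nu. *)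
Lemma BI_succ_le (nu s : R) : 0 < nu -> BI (nu + 1) s <= BI nu s.
Proof.
  intros H. pose proof (dBI_upper nu s H) as Hu. unfold dBI in Hu.
  destruct (rad_bounds nu s H) as (_ & _ & Hb). pose proof (exp_pos s). pose proof (BI_pos nu s ltac:(lra)).
  apply Rmult_le_reg_l with (2 * exp s); [lra|]. nra.
Qed.

Lemma BI_succ_ge (nu s : R) : 0 < nu -> (1 - (nu + 1) * exp (- s)) * BI nu s <= BI (nu + 1) s.
Proof.
  intros H. pose proof (BI_succ_lower nu s H) as Hl.
  destruct (rad_bounds (nu + 1) s ltac:(lra)) as (Hb & _ & _). pose proof (exp_pos s) as He.
  pose proof (BI_pos nu s ltac:(lra)).
  apply Rmult_le_reg_l with (2 * exp s); [lra|].
  eapply Rle_trans; [|exact Hl]. rewrite <- Rmult_assoc. apply Rmult_le_compat_r; [lra|].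
  replace (2 * exp s * (1 - (nu + 1) * exp (- s))) with (2 * exp s - 2 * (nu + 1) * (exp s * exp (- s))) by ring.
  rewrite <- exp_plus, Rplus_opp_r, exp_0. lra.
Qed.

(* Wendel's inequality for [Gamma], applied to each term of the Bessel series. *)
Lemma alpha_frac (a d E : R) (k : nat) : 0 < a -> 0 <= d <= 1 -> 0 < E ->
  Rpower E d * alpha (a + d) k <= (d * E + (1 - d) * d) * alpha (a + 1) k + (1 - d) * alpha a k.
Proof.
  intros Ha Hd HE. pose proof (pos_INR k) as Hk. set (y := a + INR k + 1).
  assert (Hy : 0 < y) by (unfold y; lra).
  pose proof (Gamma_lower y d Hy Hd) as HG. pose proof (Gamma_pos y Hy) as G0.
  pose proof (Gamma_pos (y + d) ltac:(lra)) as G1. pose proof (INR_fact_pos k) as Hf.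
  assert (E0 : alpha a k = / (INR (fact k) * Gamma y)) by reflexivity.
  assert (E1 : alpha (a + 1) k = / (INR (fact k) * (y * Gamma y))).
  { unfold alpha. rewrite <- Gamma_succ by (apply Gamma_pole_pos, Hy). do 3 f_equal. unfold y. ring. }
  assert (E2 : alpha (a + d) k = / (INR (fact k) * Gamma (y + d))).
  { unfold alpha. do 3 f_equal. unfold y. ring. }
  rewrite E0, E1, E2.
  (* Weighted means of E and y + d. The part (1 - d) y cancels the factor y of Gamma(y+1) and so
     leads to order a; the rest stays at order a + 1. *)
  assert (HA : Rpower E d * Rpower (y + d) (1 - d) <= d * E + (1 - d) * (y + d)).
  { assert (HYp : 0 < Rpower (y + d) (1 - d)) by apply exp_pos.
    pose proof (Rpower_le_affine (E / (y + d)) d ltac:(apply Rdiv_lt_0_compat; lra) Hd) as Hb.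
    replace (Rpower E d) with (Rpower (E / (y + d)) d * Rpower (y + d) d).
    2: { rewrite Rpower_mult_distr; [f_equal; field; lra | apply Rdiv_lt_0_compat; lra | lra]. }
    rewrite Rmult_assoc, <- Rpower_plus. replace (d + (1 - d)) with 1 by ring. rewrite Rpower_1 by lra.
    apply Rmult_le_compat_r with (r := y + d) in Hb; [|lra].
    eapply Rle_trans; [exact Hb|]. right. field. lra. }
  assert (HEp : 0 < Rpower E d) by apply exp_pos.
  apply Rmult_le_reg_r with (INR (fact k) * (y * Gamma y) * Gamma (y + d)).
  { apply Rmult_lt_0_compat; trivial. apply Rmult_lt_0_compat; trivial. apply Rmult_lt_0_compat; trivial. }
  replace (Rpower E d * / (INR (fact k) * Gamma (y + d)) * (INR (fact k) * (y * Gamma y) * Gamma (y + d)))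
    with (Rpower E d * (y * Gamma y)) by (field; lra).
  replace (((d * E + (1 - d) * d) * / (INR (fact k) * (y * Gamma y)) + (1 - d) * / (INR (fact k) * Gamma y)) *
    (INR (fact k) * (y * Gamma y) * Gamma (y + d))) with ((d * E + (1 - d) * (y + d)) * Gamma (y + d)) by (field; lra).
  apply Rle_trans with (Rpower E d * (Rpower (y + d) (1 - d) * Gamma (y + d))).
  - apply Rmult_le_compat_l; lra.
  - rewrite <- Rmult_assoc. apply Rmult_le_compat_r; lra.
Qed.

(** Sum [alpha_frac] with E = e^s, so that E^d e^(as) is the prefactor of order a + d; then replace
    I_(a+1) by the larger I_a. *)
Lemma BI_frac (a d s : R) : 0 < a -> 0 <= d <= 1 -> BI (a + d) s <= (1 + exp (- s)) * BI a s.
Proof.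
  intros Ha Hd. set (E := exp s). pose proof (exp_pos s) as HE. fold E in HE.
  assert (HP : Rpower E d * PSeries (alpha (a + d)) (exp (2 * s)) <=
    (d * E + (1 - d) * d) * PSeries (alpha (a + 1)) (exp (2 * s)) + (1 - d) * PSeries (alpha a) (exp (2 * s))).
  { pose proof (entire_alpha a (regular_gt a ltac:(lra))) as T0.
    pose proof (entire_alpha (a + 1) (regular_gt (a + 1) ltac:(lra))) as T1.
    pose proof (entire_alpha (a + d) (regular_gt (a + d) ltac:(lra))) as T2.
    set (p := d * E + (1 - d) * d).
    assert (Hp : 0 <= p).
    { unfold p. apply Rplus_le_le_0_compat; apply Rmult_le_pos; lra. }
    assert (EL : PSeries (fun k => Rpower E d * alpha (a + d) k) (exp (2 * s)) = Rpower E d * PSeries (alpha (a + d)) (exp (2 * s))).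
    { apply RtoC_inj. rewrite RtoC_mult, <- !CPSeries_real. apply CPSeries_scal, T2. }
    assert (ER : PSeries (fun k => p * alpha (a + 1) k + (1 - d) * alpha a k) (exp (2 * s)) =
      p * PSeries (alpha (a + 1)) (exp (2 * s)) + (1 - d) * PSeries (alpha a) (exp (2 * s))).
    { apply RtoC_inj. rewrite RtoC_plus, !RtoC_mult, <- !CPSeries_real.
      rewrite <- !CPSeries_scal by easy. apply CPSeries_plus; apply entire_scal; easy. }
    rewrite <- EL, <- ER.
    assert (P0 : forall k, 0 < alpha a k) by (intros; apply alpha_pos; lra).
    assert (P1 : forall k, 0 < alpha (a + 1) k) by (intros; apply alpha_pos; lra).
    assert (P2 : forall k, 0 < alpha (a + d) k) by (intros; apply alpha_pos; lra).
    apply PSeries_le; [| left; apply exp_pos |].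
    - apply entire_le with (a := fun k => alpha (a + 1) k + alpha a k) (M := p + 1).
      + intros k. specialize (P0 k). specialize (P1 k).
        assert (0 <= d * alpha a k) by (apply Rmult_le_pos; lra).
        assert (0 <= (1 - d) * alpha a k) by (apply Rmult_le_pos; lra).
        assert (0 <= p * alpha a k) by (apply Rmult_le_pos; lra).
        assert (0 <= p * alpha (a + 1) k) by (apply Rmult_le_pos; lra).
        rewrite !Rabs_pos_eq by lra. lra.
      + intros r Hr. apply ex_series_ext with (fun k => Rabs (alpha (a + 1) k) * r ^ k + Rabs (alpha a k) * r ^ k).
        * intros k. specialize (P0 k). specialize (P1 k). rewrite !Rabs_pos_eq by lra. symmetry. apply Rmult_plus_distr_r.
        * apply (ex_series_plus (V := R_NormedModule)); [apply T1 | apply T0]; exact Hr.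
    - intros k. split.
      + apply Rmult_le_pos; [left; apply exp_pos | left; apply P2].
      + apply alpha_frac; trivial. }
  assert (HI : BI (a + d) s <= (d + (1 - d) * d * exp (- s)) * BI (a + 1) s + (1 - d) * BI a s).
  { unfold BI. rewrite exp_mul_succ. fold E.
    replace (exp ((a + d) * s)) with (exp (a * s) * Rpower E d).
    2: { unfold Rpower, E. rewrite ln_exp, <- exp_plus. f_equal. ring. }
    replace (exp (- s)) with (/ E) by (unfold E; symmetry; apply exp_Ropp).
    apply Rmult_le_compat_l with (r := exp (a * s)) in HP; [| left; apply exp_pos].
    rewrite Rmult_assoc. eapply Rle_trans; [exact HP|]. right. field. lra. }
  pose proof (BI_succ_le a s Ha) as Hs. pose proof (BI_pos a s ltac:(lra)). pose proof (exp_pos (- s)).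
  assert (Hc : 0 <= d + (1 - d) * d * exp (- s)) by (apply Rplus_le_le_0_compat; [lra | repeat apply Rmult_le_pos; lra]).
  eapply Rle_trans; [exact HI|].
  apply Rle_trans with ((d + (1 - d) * d * exp (- s)) * BI a s + (1 - d) * BI a s).
  - apply Rplus_le_compat_r, Rmult_le_compat_l; lra.
  - rewrite <- Rmult_plus_distr_r. apply Rmult_le_compat_r; [lra|].
    assert ((1 - d) * d * exp (- s) <= 1 * exp (- s)) by (apply Rmult_le_compat_r; nra). lra.
Qed.

(** * Asymptotic equivalence of I at different orders *)

Definition BI_equiv (a b : R) : Prop :=
  lim_pinfty (fun s => BI a s / BI b s) 1.

Lemma exp_neg_pinfty (c d : R) : lim_pinfty (fun s => c + d * exp (- s)) c.
Proof.
  apply (filterlim_eq _ _ (c + d * 0)); [ring|].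
  apply lim_plus; [apply filterlim_const|].
  apply lim_mult; [apply filterlim_const|].
  apply (filterlim_ext (fun s => exp (- (1 * s)))); [intros s; rewrite Rmult_1_l; reflexivity | apply exp_pinfty; lra].
Qed.

Lemma BI_equiv_succ (a : R) : 0 < a -> BI_equiv (a + 1) a.
Proof.
  intros Ha. apply (filterlim_squeeze _ (fun s => 1 + (- (a + 1)) * exp (- s)) (fun _ => 1)).
  - apply (filter_forall (F := Rbar_locally p_infty)). intros s. pose proof (BI_pos a s ltac:(lra)) as Hp.
    pose proof (BI_succ_le a s Ha). pose proof (BI_succ_ge a s Ha).
    split; apply Rmult_le_reg_r with (BI a s); trivial; unfold Rdiv; rewrite Rmult_assoc, Rinv_l; lra.
  - apply exp_neg_pinfty.
  - apply filterlim_const.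
Qed.

(** The upper bound is [BI_frac]; the lower one is [BI_frac] again, from a + d over the remaining 1
    - d, combined with [BI_succ_ge]. *)
Lemma BI_equiv_frac (a d : R) : 0 < a -> 0 <= d <= 1 -> BI_equiv (a + d) a.
Proof.
  intros Ha Hd. apply (filterlim_squeeze _ (fun s => (1 + (- (a + 1)) * exp (- s)) * / (1 + 1 * exp (- s))) (fun s => 1 + 1 * exp (- s))).
  - apply (filter_forall (F := Rbar_locally p_infty)). intros s. pose proof (BI_pos a s ltac:(lra)) as Hp.
    pose proof (BI_frac a d s Ha Hd) as H1. pose proof (BI_frac (a + d) (1 - d) s ltac:(lra) ltac:(lra)) as H2.
    replace (a + d + (1 - d)) with (a + 1) in H2 by ring.
    pose proof (BI_succ_ge a s Ha) as H3. pose proof (exp_pos (- s)) as He.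
    split; apply Rmult_le_reg_r with (BI a s); trivial; unfold Rdiv; rewrite (Rmult_assoc (BI (a + d) s)), Rinv_l by lra.
    + apply Rmult_le_reg_l with (1 + exp (- s)); [lra|].
      replace ((1 + exp (- s)) * ((1 + - (a + 1) * exp (- s)) * / (1 + 1 * exp (- s)) * BI a s))
        with ((1 + - (a + 1) * exp (- s)) * BI a s) by (field; lra). lra.
    + lra.
  - apply (filterlim_eq _ _ (1 * / 1)); [field|].
    apply lim_mult; [apply exp_neg_pinfty|].
    apply (filterlim_Rcont _ Rinv); [apply continuous_derivable; auto_derive; lra | apply exp_neg_pinfty].
  - apply exp_neg_pinfty.
Qed.

Lemma BI_equiv_trans (a b c : R) : -1 < b -> BI_equiv a b -> BI_equiv b c -> BI_equiv a c.
Proof.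
  intros Hb H1 H2. apply (filterlim_eq _ _ (1 * 1)); [ring|].
  apply (filterlim_ext (fun s => BI a s / BI b s * (BI b s / BI c s))).
  - intros s. pose proof (BI_pos b s Hb). unfold Rdiv.
    rewrite Rmult_assoc, <- (Rmult_assoc (/ BI b s)), Rinv_l, Rmult_1_l by lra. reflexivity.
  - apply lim_mult; assumption.
Qed.

(** In I_(e-1) = I_(e+1) + (2e/x) I_e the last term is of lower order. Two consecutive orders are
    carried along because the recurrence has three terms. *)
Lemma BI_equiv_descend (b c : R) (n : nat) : nonint b -> BI_equiv b c -> BI_equiv (b + 1) c ->
  BI_equiv (b - INR n) c /\ BI_equiv (b - INR n + 1) c.
Proof.
  intros Hb H0 H1. induction n as [|n [IH0 IH1]].
  - simpl. rewrite Rminus_0_r. split; trivial.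
  - rewrite S_INR. replace (b - (INR n + 1)) with (b - INR n - 1) by ring.
    replace (b - INR n - 1 + 1) with (b - INR n) by ring. split; trivial.
    set (e := b - INR n) in *.
    assert (He : regular (e - 1)).
    { apply nonint_regular. intros m Hm. apply (Hb (m + Z.of_nat n + 1)%Z).
      rewrite !plus_IZR, <- INR_IZR_INZ. unfold e in Hm. lra. }
    apply (filterlim_eq _ _ (1 + 1 * 0)); [ring|].
    apply (filterlim_ext (fun s => BI (e + 1) s / BI c s + BI e s / BI c s * (e * exp (- s)))).
    + intros s. pose proof (BI_rec e s He) as E. pose proof (exp_pos s).
      assert (E' : BI (e - 1) s = BI (e + 1) s + e * exp (- s) * BI e s).
      { apply Rmult_eq_reg_l with (2 * exp s); [|lra]. rewrite E.
        replace (2 * exp s * (BI (e + 1) s + e * exp (- s) * BI e s)) with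
          (2 * exp s * BI (e + 1) s + 2 * e * BI e s * (exp s * exp (- s))) by ring.
        rewrite <- exp_plus, Rplus_opp_r, exp_0. ring. }
      rewrite E'. unfold Rdiv. ring.
    + apply lim_plus; [exact IH1|].
      apply lim_mult; [exact IH0|].
      apply (filterlim_ext (fun s => 0 + e * exp (- s))); [intros; ring | apply exp_neg_pinfty].
Qed.

(* [I_(-nu)] and [I_nu] have the same asymptotics, so that [K_nu] is recessive. *)
Lemma BI_equiv_opp (nu : R) : nonint nu -> 0 < nu -> BI_equiv (- nu) nu.
Proof.
  intros H Hp. destruct (archimed (2 * nu)) as [U1 U2].
  assert (Hz : (0 <= up (2 * nu))%Z) by (apply le_IZR; simpl; lra).
  (* The integer n with 0 < n - 2 nu <= 1 writes -nu as nu + d lowered n times. *)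
  set (n := Z.to_nat (up (2 * nu))).
  assert (Hn : INR n = IZR (up (2 * nu))) by (unfold n; rewrite INR_IZR_INZ, Z2Nat.id by exact Hz; reflexivity).
  set (d := INR n - 2 * nu). assert (Hd : 0 <= d <= 1) by (unfold d; lra).
  assert (E : - nu = nu + d - INR n) by (unfold d; ring). rewrite E.
  apply BI_equiv_descend.
  - intros m Hm. apply (H (Z.of_nat n - m)%Z). rewrite minus_IZR, <- INR_IZR_INZ. unfold d in Hm. lra.
  - apply BI_equiv_frac; trivial.
  - apply BI_equiv_trans with (nu + d); [lra | apply BI_equiv_succ; lra | apply BI_equiv_frac; trivial].
Qed.

(** * The recessive solution *)

(* [K_nu (2 exp s)]; [dBI] and [dBK] are the derivatives in [s]. *)
Definition BK (nu s : R) : R := kappa nu * (BI (- nu) s - BI nu s).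
Definition dBK (nu s : R) : R := kappa nu * (dBI (- nu) s - dBI nu s).

Lemma nonint_regular_opp (nu : R) : nonint nu -> regular (- nu).
Proof. intros H. apply nonint_regular, nonint_opp, H. Qed.

Lemma BK_derive (nu s : R) : nonint nu -> is_derive (BK nu) s (dBK nu s).
Proof.
  intros H. pose proof (BI_derive nu s (nonint_regular _ H)) as D0.
  pose proof (BI_derive (- nu) s (nonint_regular_opp _ H)) as D1.
  apply (is_derive_scal (fun s => BI (- nu) s - BI nu s)).
  exact (is_derive_minus _ _ _ _ _ D1 D0).
Qed.

Lemma dBK_derive (nu s : R) : nonint nu -> is_derive (dBK nu) s ((4 * exp (2 * s) + nu ^ 2) * BK nu s).
Proof.
  intros H. pose proof (dBI_derive nu s (nonint_regular _ H)) as D0.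
  pose proof (dBI_derive (- nu) s (nonint_regular_opp _ H)) as D1.
  eapply is_derive_eq.
  - apply (is_derive_scal (fun s => dBI (- nu) s - dBI nu s)). exact (is_derive_minus _ _ _ _ _ D1 D0).
  - unfold BK, minus, plus, opp; simpl. ring.
Qed.

Lemma is_derive_Rmult (f g : R -> R) (t a b : R) : is_derive f t a -> is_derive g t b ->
  is_derive (fun t => f t * g t) t (a * g t + f t * b).
Proof. intros Hf Hg. apply (is_derive_mult (K := R_AbsRing)); trivial. intros; apply Rmult_comm. Qed.

Lemma is_derive_Rplus (f g : R -> R) (t a b : R) : is_derive f t a -> is_derive g t b ->
  is_derive (fun t => f t + g t) t (a + b).
Proof. intros Hf Hg. exact (is_derive_plus _ _ _ _ _ Hf Hg). Qed.

Lemma is_derive_Rminus (f g : R -> R) (t a b : R) : is_derive f t a -> is_derive g t b ->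
  is_derive (fun t => f t - g t) t (a - b).
Proof. intros Hf Hg. exact (is_derive_minus _ _ _ _ _ Hf Hg). Qed.

Lemma constant_of_limit (f : R -> R) (l : R) : (forall t, is_derive f t 0) ->
  lim_minfty f l -> forall s, f s = l.
Proof.
  intros Hd Hl s. apply Rle_antisym.
  - assert (- l <= - f s); [| lra].
    apply (nondecreasing_ge_limit (fun s => - f s) (fun _ => - 0)).
    + intros t. apply (is_derive_opp f), Hd.
    + intros _. lra.
    + apply filterlim_Ropp, Hl.
  - apply (nondecreasing_ge_limit f (fun _ => 0)); trivial. intros _. lra.
Qed.

Lemma kappa_neq_0 (nu : R) : nonint nu -> 0 < nu -> kappa nu <> 0.
Proof.
  intros H Hp E. pose proof (kappa_coef_d_0 nu H Hp) as K. rewrite E, Rmult_0_l in K.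
  assert (0 < / (2 * nu)) by (apply Rinv_0_lt_compat; lra). lra.
Qed.

(** In the variable s the equation has no first-order term, so the Wronskian is constant; its value
    is found at s -> -oo, and [kappa nu] normalises it to 1. *)
Lemma wronskian (nu s : R) : nonint nu -> 0 < nu -> dBI nu s * BK nu s - BI nu s * dBK nu s = 1.
Proof.
  intros H Hp. pose proof (nonint_regular _ H) as R0. pose proof (nonint_regular_opp _ H) as R1.
  set (W := fun s => dBI nu s * BI (- nu) s - BI nu s * dBI (- nu) s).
  (* Written in the shape in which the limit arises: the vanishing second summand carries the limit
     0 of e^(2s). *)
  assert (E : W s = 2 * nu * coef_d nu 0 + 2 * 0 * (alpha (nu + 1) 0 * alpha (- nu) 0 - alpha nu 0 * alpha (- nu + 1) 0)).
  { apply constant_of_limit.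
    - intros t. pose proof (BI_derive nu t R0) as D0. pose proof (BI_derive (- nu) t R1) as D1.
      pose proof (dBI_derive nu t R0) as D2. pose proof (dBI_derive (- nu) t R1) as D3.
      eapply is_derive_eq; [apply is_derive_Rminus; apply is_derive_Rmult; eassumption|]. ring.
    - apply (filterlim_ext (fun s => 2 * nu * (PSeries (alpha nu) (exp (2 * s)) * PSeries (alpha (- nu)) (exp (2 * s)))
        + 2 * exp (2 * s) * (PSeries (alpha (nu + 1)) (exp (2 * s)) * PSeries (alpha (- nu)) (exp (2 * s))
          - PSeries (alpha nu) (exp (2 * s)) * PSeries (alpha (- nu + 1)) (exp (2 * s))))).
      + intros t. unfold W, dBI, BI. rewrite !exp_mul_succ. rewrite (exp_double t).
        assert (E : exp (- nu * t) = / exp (nu * t)) by (rewrite <- exp_Ropp; f_equal; ring).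
        rewrite E. pose proof (exp_pos (nu * t)). field. lra.
      + assert (L : forall mu, regular mu -> lim_minfty (fun s => PSeries (alpha mu) (exp (2 * s))) (alpha mu 0)).
        { intros mu Hmu. apply PSeries_exp_minfty, entire_alpha, Hmu. }
        pose proof (L _ R0). pose proof (L _ R1). pose proof (L _ (regular_succ _ R0)). pose proof (L _ (regular_succ _ R1)).
        apply lim_plus; apply lim_mult.
        * apply filterlim_const.
        * apply lim_mult; assumption.
        * apply lim_mult; [apply filterlim_const | apply exp_minfty; lra].
        * apply lim_plus; [|apply filterlim_Ropp];
            apply lim_mult; assumption. }
  transitivity (kappa nu * W s); [unfold BK, dBK, W; ring|].
  rewrite E. pose proof (kappa_coef_d_0 nu H Hp) as K.
  transitivity (2 * nu * (kappa nu * coef_d nu 0)); [ring|]. rewrite K. field. lra.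
Qed.

(** The numerator has the size of [rad]; in this form I_nu absorbs the crude majorant used in
    [dBK_upper]. *)
Lemma inv_BI_pinfty (nu c : R) : 0 < nu ->
  lim_pinfty (fun s => (c + exp s) / BI nu s) 0.
Proof.
  intros H. pose proof (alpha_pos nu 1 ltac:(lra)) as Ha.
  set (M := (Rabs c + 1) / alpha nu 1).
  assert (HM : 0 < M) by (apply Rdiv_lt_0_compat; pose proof (Rabs_pos c); lra).
  assert (L : lim_pinfty (fun s => M * exp (- (1 * s))) 0).
  { apply (filterlim_eq _ _ (M * 0)); [ring|].
    apply lim_mult; [apply filterlim_const | apply exp_pinfty; lra]. }
  apply (filterlim_squeeze _ (fun s => - (M * exp (- (1 * s)))) (fun s => M * exp (- (1 * s)))).
  - exists 0. intros s Hs. apply Rabs_le_between. unfold Rdiv. rewrite Rabs_mult.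
    pose proof (BI_pos nu s ltac:(lra)) as HB. pose proof (BI_lower nu s ltac:(lra)) as HL.
    rewrite (Rabs_pos_eq (/ _)) by (left; apply Rinv_0_lt_compat, HB).
    assert (He : 1 < exp s) by (rewrite <- exp_0; apply exp_increasing, Hs).
    assert (H1 : Rabs (c + exp s) <= (Rabs c + 1) * exp s).
    { eapply Rle_trans; [apply Rabs_triang|]. rewrite (Rabs_pos_eq (exp s)) by lra. pose proof (Rabs_pos c). nra. }
    assert (H2 : alpha nu 1 * (exp s * exp s) <= BI nu s).
    { eapply Rle_trans; [|exact HL]. apply Rmult_le_compat_l; [lra|]. rewrite <- exp_double.
      left. apply exp_increasing. nra. }
    apply Rmult_le_reg_r with (BI nu s); trivial. rewrite Rmult_assoc, Rinv_l, Rmult_1_r by lra.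
    eapply Rle_trans; [exact H1|]. rewrite Rmult_1_l.
    apply Rle_trans with (M * exp (- s) * (alpha nu 1 * (exp s * exp s))).
    + right. unfold M. rewrite exp_Ropp. field. lra.
    + apply Rmult_le_compat_l; [| exact H2]. apply Rmult_le_pos; [lra | left; apply exp_pos].
  - apply (filterlim_eq _ _ (- 0)); [ring|]. apply filterlim_Ropp, L.
  - exact L.
Qed.

Lemma inv_BI_pinfty' (nu : R) : 0 < nu ->
  lim_pinfty (fun s => / BI nu s) 0.
Proof.
  intros H. apply (filterlim_squeeze _ (fun _ => 0) (fun s => (1 + exp s) / BI nu s)).
  - apply (filter_forall (F := Rbar_locally p_infty)). intros s.
    pose proof (BI_pos nu s ltac:(lra)) as HB. pose proof (Rinv_0_lt_compat _ HB). pose proof (exp_pos s).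
    unfold Rdiv. split; nra.
  - apply filterlim_const.
  - apply inv_BI_pinfty, H.
Qed.

Lemma BK_div_BI_derive (nu s : R) : nonint nu -> 0 < nu ->
  is_derive (fun s => BK nu s / BI nu s) s (- / BI nu s ^ 2).
Proof.
  intros H Hp. pose proof (BI_derive nu s (nonint_regular _ H)) as D0. pose proof (BK_derive nu s H) as D1.
  pose proof (BI_pos nu s ltac:(lra)) as HB. pose proof (wronskian nu s H Hp) as HW.
  eapply is_derive_eq.
  - apply (is_derive_div (BK nu) (BI nu)); [exact D1 | exact D0 | lra].
  - replace (- / BI nu s ^ 2) with (- (dBI nu s * BK nu s - BI nu s * dBK nu s) / BI nu s ^ 2)
      by (rewrite HW; field; lra).
    field. lra.
Qed.

Lemma BK_div_BI_pinfty (nu : R) : nonint nu -> 0 < nu ->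
  lim_pinfty (fun s => BK nu s / BI nu s) 0.
Proof.
  intros H Hp. apply (filterlim_eq _ _ (kappa nu * (1 + - (1)))); [ring|].
  apply (filterlim_ext (fun s => kappa nu * (BI (- nu) s / BI nu s + - (1)))).
  - intros s. pose proof (BI_pos nu s ltac:(lra)). unfold BK. field. lra.
  - apply lim_mult; [apply filterlim_const|].
    apply lim_plus; [apply BI_equiv_opp; trivial | apply filterlim_const].
Qed.

(** The sign cannot be seen on the series. But K_nu / I_nu has derivative - 1 / I_nu^2 by the
    Wronskian and tends to 0, so it decreases strictly to 0. *)
Lemma BK_pos (nu s : R) : nonint nu -> 0 < nu -> 0 < BK nu s.
Proof.
  intros H Hp. set (k := fun s => BK nu s / BI nu s).
  assert (HB : forall t, 0 < BI nu t) by (intros; apply BI_pos; lra).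
  assert (Hi : forall t, 0 < / BI nu t ^ 2) by (intros; apply Rinv_0_lt_compat, pow_lt, HB).
  assert (Hd : forall t, is_derive (fun s => - k s) t (/ BI nu t ^ 2)).
  { intros t. eapply is_derive_eq; [apply (is_derive_opp k), BK_div_BI_derive; trivial|].
    unfold opp; simpl. ring. }
  assert (H1 : - k (s + 1) <= - 0).
  { apply (nondecreasing_le_limit (fun s => - k s) (fun t => / BI nu t ^ 2)); trivial.
    - intros t. left. apply Hi.
    - apply filterlim_Ropp, BK_div_BI_pinfty; trivial. }
  assert (H2 : - k s < - k (s + 1)).
  { apply (incr_function (fun s => - k s) m_infty p_infty (fun t => / BI nu t ^ 2)); simpl; trivial; [intros; apply Hi | lra]. }
  assert (H3 : 0 < k s) by lra. unfold k in H3.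
  replace (BK nu s) with (BK nu s / BI nu s * BI nu s) by (field; apply Rgt_not_eq, HB).
  apply Rmult_lt_0_compat; [exact H3 | apply HB].
Qed.

Definition bprod (nu s : R) : R := BI nu s * BK nu s.

(** K_nu / I_nu is the integral of 1 / I_nu^2 from s to infinity; as dI_nu/ds >= nu I_nu, it is at
    most 1 / (2 nu I_nu^2). The difference [f] increases to 0. This crude bound, which uses nothing
    on dK/ds, starts off [dBK_upper]. *)
Lemma bprod_le (nu s : R) : nonint nu -> 0 < nu -> bprod nu s <= / (2 * nu).
Proof.
  intros H Hp. assert (HB : forall t, 0 < BI nu t) by (intros; apply BI_pos; lra).
  set (f := fun s => BK nu s / BI nu s - / (2 * nu) * (/ BI nu s * / BI nu s)).
  assert (Hf : f s <= 0 - / (2 * nu) * (0 * 0)).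
  { apply (nondecreasing_le_limit f (fun t => (dBI nu t - nu * BI nu t) / (nu * BI nu t ^ 3))).
    - intros t. pose proof (BI_derive nu t (nonint_regular _ H)) as D0. specialize (HB t).
      assert (Di : is_derive (fun s => / BI nu s) t (- dBI nu t / BI nu t ^ 2)).
      { apply is_derive_inv; [exact D0 | lra]. }
      eapply is_derive_eq.
      + apply is_derive_Rminus; [apply BK_div_BI_derive; trivial |].
        apply is_derive_scal. apply is_derive_Rmult; exact Di.
      + simpl. field. lra.
    - intros t. specialize (HB t). pose proof (dBI_ge nu t Hp).
      apply Rdiv_le_0_compat; [lra|]. apply Rmult_lt_0_compat; [lra | apply pow_lt, HB].
    - apply lim_plus; [apply BK_div_BI_pinfty; trivial|].
      apply filterlim_Ropp. apply lim_mult; [apply filterlim_const|].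
      apply lim_mult; apply inv_BI_pinfty', Hp. }
  unfold f in Hf. specialize (HB s). unfold bprod.
  replace (BI nu s * BK nu s) with (BK nu s / BI nu s * BI nu s ^ 2) by (field; lra).
  apply Rle_trans with (/ (2 * nu) * (/ BI nu s * / BI nu s) * BI nu s ^ 2).
  - apply Rmult_le_compat_r; [apply pow2_ge_0 | lra].
  - right. field. lra.
Qed.

Lemma dBK_upper (nu s : R) : nonint nu -> 0 < nu -> dBK nu s <= - (rad nu s * BK nu s).
Proof.
  intros H Hp.
  assert (HB : forall t, 0 < BI nu t) by (intros; apply BI_pos; lra).
  assert (HK : forall t, 0 < BK nu t) by (intros; apply BK_pos; trivial).
  (* A common majorant of rad K and |dK/ds|, whose decay makes the quadratic expression tend to 0.
     In 3/2 nu + e^t, the part (x + nu) / 2 comes from rad < x + nu and [bprod_le], and nu from the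
     Wronskian. *)
  set (b := fun t => / nu * ((3 / 2 * nu + exp t) / BI nu t)).
  assert (Hb : lim_pinfty b 0).
  { apply (filterlim_eq _ _ (/ nu * 0)); [ring|].
    apply lim_mult; [apply filterlim_const | apply inv_BI_pinfty, Hp]. }
  assert (Hbb : forall t, rad nu t * BK nu t <= b t /\ Rabs (dBK nu t) <= b t).
  { intros t. specialize (HB t). specialize (HK t). destruct (rad_bounds nu t Hp) as (_ & Hr0 & Hr).
    pose proof (bprod_le nu t H Hp) as Hpr. unfold bprod in Hpr.
    pose proof (wronskian nu t H Hp) as HW. pose proof (dBI_upper nu t Hp) as HI. pose proof (dBI_ge nu t Hp) as HI0.
    pose proof (Rinv_0_lt_compat nu Hp) as Hi.
    assert (Hq : rad nu t * (BI nu t * BK nu t) <= (exp t + nu / 2) * / nu).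
    { apply Rle_trans with ((2 * exp t + nu) * (/ (2 * nu))).
      - apply Rmult_le_compat; try lra. apply Rmult_le_pos; lra.
      - right. field. lra. }
    assert (Eb : b t * BI nu t = / nu * (3 / 2 * nu + exp t)) by (unfold b; field; lra).
    assert (Eb' : b t * BI nu t = (exp t + nu / 2) * / nu + 1) by (rewrite Eb; field; lra).
    split; apply Rmult_le_reg_r with (BI nu t); trivial; rewrite Eb'.
    - lra.
    - rewrite <- (Rabs_pos_eq (BI nu t)) at 1 by lra. rewrite <- Rabs_mult.
      replace (dBK nu t * BI nu t) with (dBI nu t * BK nu t - 1) by lra.
      assert (0 <= dBI nu t * BK nu t) by (apply Rmult_le_pos; [| lra]; eapply Rle_trans; [|exact HI0]; apply Rmult_le_pos; lra).
      assert (dBI nu t * BK nu t <= rad nu t * (BI nu t * BK nu t)).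
      { rewrite <- Rmult_assoc. apply Rmult_le_compat_r; lra. }
      apply Rabs_le. lra. }
  assert (HE : (4 * exp (2 * s) + nu ^ 2) * BK nu s ^ 2 - dBK nu s ^ 2 <= 0).
  { apply (nondecreasing_le_limit (fun s => (4 * exp (2 * s) + nu ^ 2) * BK nu s ^ 2 - dBK nu s ^ 2)
      (fun s => 8 * exp (2 * s) * BK nu s ^ 2)).
    - intros t. pose proof (BK_derive nu t H) as D0. pose proof (dBK_derive nu t H) as D1.
      auto_derive; [repeat split; eexists; eassumption|]. use_derive D0. use_derive D1. ring.
    - intros t. apply Rmult_le_pos; [pose proof (exp_pos (2 * t)); lra | apply pow2_ge_0].
    - assert (Hb2 : lim_pinfty (fun t => b t ^ 2) 0).
      { apply (filterlim_eq _ _ (0 ^ 2)); [ring|]. apply filterlim_Rpow2, Hb. }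
      apply (filterlim_squeeze _ (fun t => - b t ^ 2) (fun t => b t ^ 2)).
      + apply (filter_forall (F := Rbar_locally p_infty)). intros t. destruct (Hbb t) as [B1 B2]. specialize (HK t).
        destruct (rad_bounds nu t Hp) as (_ & Hr0 & _).
        rewrite <- rad_sq. rewrite <- (pow2_abs (dBK nu t)).
        assert (0 <= rad nu t * BK nu t) by (apply Rmult_le_pos; lra).
        pose proof (Rabs_pos (dBK nu t)).
        assert ((rad nu t * BK nu t) ^ 2 <= b t ^ 2) by (apply pow_incr; lra).
        assert (Rabs (dBK nu t) ^ 2 <= b t ^ 2) by (apply pow_incr; lra).
        pose proof (pow2_ge_0 (Rabs (dBK nu t))). pose proof (pow2_ge_0 (rad nu t * BK nu t)).
        replace (rad nu t * rad nu t * BK nu t ^ 2) with ((rad nu t * BK nu t) ^ 2) by ring. lra.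
      + apply (filterlim_eq _ _ (- 0)); [ring|]. apply filterlim_Ropp, Hb2.
      + exact Hb2. }
  rewrite <- rad_sq in HE. destruct (rad_bounds nu s Hp) as (_ & Hr & _).
  specialize (HB s). specialize (HK s). pose proof (wronskian nu s H Hp) as HW.
  pose proof (dBI_upper nu s Hp) as HI.
  assert (Hrk : 0 < rad nu s * BK nu s) by (apply Rmult_lt_0_compat; lra).
  (* The quadratic inequality bounds only |dK/ds| from below. Its sign follows from the Wronskian:
     if dK/ds >= rad K, then [dBI_upper] would make the Wronskian at most 0 instead of 1. *)
  apply Rnot_lt_le. intros Hlt.
  assert (Hge : rad nu s * BK nu s <= dBK nu s).
  { apply Rnot_lt_le. intros Hlt'. assert (Rabs (dBK nu s) < rad nu s * BK nu s) by (apply Rabs_def1; lra).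
    pose proof (Rabs_pos (dBK nu s)). rewrite <- (pow2_abs (dBK nu s)) in HE. nra. }
  assert (dBI nu s * BK nu s <= rad nu s * BI nu s * BK nu s) by (apply Rmult_le_compat_r; lra).
  assert (BI nu s * (rad nu s * BK nu s) <= BI nu s * dBK nu s) by (apply Rmult_le_compat_l; lra).
  lra.
Qed.

Lemma kappa_succ (nu : R) : kappa (nu + 1) = - kappa nu.
Proof.
  unfold kappa. replace (PI * (nu + 1)) with (PI * nu + PI) by ring.
  rewrite neg_sin. unfold Rdiv. replace (2 * - sin (PI * nu)) with (- (2 * sin (PI * nu))) by ring.
  rewrite Rinv_opp. ring.
Qed.

Lemma nonint_succ (nu : R) : nonint nu -> nonint (nu + 1).
Proof. intros H. apply (nonint_add nu 1 H). Qed.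

Lemma dBK_succ (nu s : R) : nonint nu -> dBK nu s = nu * BK nu s - 2 * exp s * BK (nu + 1) s.
Proof.
  intros H. pose proof (dBI_pred (- (nu + 1)) s (nonint_regular_opp _ (nonint_succ _ H))) as E.
  replace (- (nu + 1) + 1) with (- nu) in E by ring.
  unfold dBK, BK. rewrite E, kappa_succ. unfold dBI. ring.
Qed.

Lemma dBK_pred (nu s : R) : nonint nu -> dBK (nu + 1) s = - (nu + 1) * BK (nu + 1) s - 2 * exp s * BK nu s.
Proof.
  intros H. pose proof (dBI_pred nu s (nonint_regular _ H)) as E.
  unfold dBK, BK. rewrite E, kappa_succ. unfold dBI. replace (- (nu + 1) + 1) with (- nu) by ring. ring.
Qed.

(** The upper bound at nu says (rad + nu) K_nu <= x K_(nu+1). As x^2 = (rad - nu)(rad + nu), this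
    gives x K_nu <= (rad - nu) K_(nu+1), which goes into the recurrence for the derivative at order
    nu + 1. *)
Lemma dBK_lower (nu s : R) : nonint nu -> 0 < nu -> - ((rad nu s + 1) * BK (nu + 1) s) <= dBK (nu + 1) s.
Proof.
  intros H Hp. pose proof (dBK_upper nu s H Hp) as Hu. rewrite dBK_succ in Hu by exact H.
  rewrite dBK_pred by exact H. destruct (rad_bounds nu s Hp) as (_ & Hr & _).
  pose proof (rad_sq nu s) as E. rewrite exp_double in E. pose proof (exp_pos s).
  assert (2 * exp s * BK nu s <= (rad nu s - nu) * BK (nu + 1) s); [| lra].
  apply Rmult_le_reg_l with (rad nu s + nu); [lra|].
  replace ((rad nu s + nu) * ((rad nu s - nu) * BK (nu + 1) s)) with ((rad nu s * rad nu s - nu ^ 2) * BK (nu + 1) s) by ring.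
  rewrite E.
  assert (2 * exp s * ((rad nu s + nu) * BK nu s) <= 2 * exp s * (2 * exp s * BK (nu + 1) s)) by (apply Rmult_le_compat_l; lra).
  lra.
Qed.

(** * The product I_nu K_nu on the positive axis *)

Lemma bprod_pos (nu s : R) : nonint nu -> 0 < nu -> 0 < bprod nu s.
Proof. intros H Hp. apply Rmult_lt_0_compat; [apply BI_pos; lra | apply BK_pos; trivial]. Qed.

(** By the Wronskian, 1 / (I K) is the sum of x I'/I and - x K'/K, so bounds on these two bound the
    product. [bprod_lower] lives at order nu + 1 because [dBK_lower] does. *)
Lemma bprod_upper (nu s : R) : nonint nu -> 0 < nu -> bprod nu s * (rad nu s + (rad (nu + 1) s - 1)) <= 1.
Proof.
  intros H Hp. pose proof (wronskian nu s H Hp) as HW. pose proof (dBI_lower nu s Hp) as HI.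
  pose proof (dBK_upper nu s H Hp) as HK. pose proof (BI_pos nu s ltac:(lra)). pose proof (BK_pos nu s H Hp).
  apply Rmult_le_compat_r with (r := BK nu s) in HI; [|lra].
  apply Rmult_le_compat_l with (r := BI nu s) in HK; [|lra]. unfold bprod. lra.
Qed.

Lemma bprod_lower (nu s : R) : nonint nu -> 0 < nu -> 1 <= bprod (nu + 1) s * (rad (nu + 1) s + (rad nu s + 1)).
Proof.
  intros H Hp. pose proof (wronskian (nu + 1) s (nonint_succ _ H) ltac:(lra)) as HW.
  pose proof (dBI_upper (nu + 1) s ltac:(lra)) as HI.
  pose proof (dBK_lower nu s H Hp) as HK. pose proof (BI_pos (nu + 1) s ltac:(lra)).
  pose proof (BK_pos (nu + 1) s (nonint_succ _ H) ltac:(lra)).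
  apply Rmult_le_compat_r with (r := BK (nu + 1) s) in HI; [|lra].
  apply Rmult_le_compat_l with (r := BI (nu + 1) s) in HK; [|lra]. unfold bprod. lra.
Qed.

Lemma bprod_pinfty (nu : R) : nonint nu -> 0 < nu -> lim_pinfty (bprod nu) 0.
Proof.
  intros H Hp. apply (filterlim_squeeze _ (fun _ => 0) (fun s => exp (- (1 * s)))).
  - apply (filter_forall (F := Rbar_locally p_infty)). intros s. pose proof (bprod_pos nu s H Hp) as P.
    split; [lra|]. pose proof (bprod_upper nu s H Hp) as U.
    destruct (rad_bounds nu s Hp) as (R1 & _ & _). destruct (rad_bounds (nu + 1) s ltac:(lra)) as (_ & R2 & _).
    pose proof (exp_pos s). rewrite Rmult_1_l, exp_Ropp.
    apply Rmult_le_reg_r with (exp s); trivial. rewrite Rinv_l by lra. nra.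
  - apply filterlim_const.
  - apply exp_pinfty. lra.
Qed.

Lemma bprod_derive (nu s : R) : nonint nu -> is_derive (bprod nu) s (dBI nu s * BK nu s + BI nu s * dBK nu s).
Proof.
  intros H. apply is_derive_Rmult; [apply BI_derive, nonint_regular, H | apply BK_derive, H].
Qed.

(** The mixed products I_nu K_(nu+1) and I_(nu+1) K_nu cancel in the sum of two consecutive orders;
    this is what makes [Phi] telescope in nu. *)
Lemma bprod_derive_succ (nu s : R) : nonint nu ->
  dBI nu s * BK nu s + BI nu s * dBK nu s + (dBI (nu + 1) s * BK (nu + 1) s + BI (nu + 1) s * dBK (nu + 1) s)
  = 2 * nu * bprod nu s - 2 * (nu + 1) * bprod (nu + 1) s.
Proof.
  intros H. rewrite dBK_pred, dBK_succ, dBI_pred by (try apply nonint_regular; exact H).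
  unfold bprod, dBI. ring.
Qed.

Lemma PSeries_mult_entire (a b : nat -> R) (w : R) : entire a -> entire b ->
  PSeries (PS_mult a b) w = PSeries a w * PSeries b w.
Proof.
  intros Ha Hb. apply RtoC_inj. rewrite RtoC_mult, <- !CPSeries_real. symmetry. apply CPSeries_mult; trivial.
Qed.

Lemma bprod_series (nu s : R) : nonint nu ->
  bprod nu s = kappa nu * (PSeries (coef_d nu) (exp (2 * s)) - exp (2 * nu * s) * PSeries (coef_c nu) (exp (2 * s))).
Proof.
  intros H. unfold bprod, BK, BI, coef_d, coef_c.
  rewrite !PSeries_mult_entire by (apply entire_alpha; try apply nonint_regular_opp; try apply nonint_regular; exact H).
  replace (exp (2 * nu * s)) with (exp (nu * s) * exp (nu * s)) by (rewrite <- exp_plus; f_equal; ring).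
  replace (exp (- nu * s)) with (/ exp (nu * s)) by (rewrite <- exp_Ropp; f_equal; ring).
  pose proof (exp_pos (nu * s)). field. lra.
Qed.

Lemma bprod_minfty (nu : R) : nonint nu -> 0 < nu -> lim_minfty (bprod nu) (/ (2 * nu)).
Proof.
  intros H Hp. apply (filterlim_eq _ _ (kappa nu * (coef_d nu 0 + - (0 * coef_c nu 0)))).
  - rewrite <- (kappa_coef_d_0 nu H Hp). ring.
  - apply (filterlim_ext (fun s => kappa nu * (PSeries (coef_d nu) (exp (2 * s)) + - (exp (2 * nu * s) * PSeries (coef_c nu) (exp (2 * s)))))).
    + intros s. rewrite bprod_series by exact H. reflexivity.
    + apply lim_mult; [apply filterlim_const|].
      apply lim_plus; [apply PSeries_exp_minfty, entire_coef_d, H|].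
      apply filterlim_Ropp, lim_mult; [apply exp_minfty; lra|].
      apply PSeries_exp_minfty, entire_coef_c, nonint_regular, H.
Qed.

(* [Phi nu s] is [2 nu] times the non-constant part of the primitive at [x = 2 exp s]. *)
Definition Phi (nu s : R) : R :=
  nu * kappa nu * (exp (2 * nu * s) * PSeries (coef_b' nu) (exp (2 * s)) - PSeries (coef_d' nu) (exp (2 * s))) - s.

Lemma Phi_derive (nu s : R) : nonint nu -> 0 < nu -> is_derive (Phi nu) s (- (2 * nu * bprod nu s)).
Proof.
  intros H Hp. pose proof (is_derive_exp_PSeries (coef_b' nu) (2 * nu) s (entire_coef_b' nu Hp)) as D1.
  pose proof (is_derive_exp_PSeries (coef_d' nu) 0 s (entire_coef_d' nu H)) as D2.
  set (w := exp (2 * s)) in *.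
  assert (E1 : nu * PSeries (coef_b' nu) w + w * PSeries (PS_derive (coef_b' nu)) w = PSeries (coef_c nu) w).
  { apply RtoC_inj. rewrite RtoC_plus, !RtoC_mult, <- !CPSeries_real. apply CPSeries_coef_b', Hp. }
  assert (E2 : w * PSeries (PS_derive (coef_d' nu)) w = PSeries (coef_d nu) w - coef_d nu 0).
  { apply RtoC_inj. rewrite RtoC_minus, RtoC_mult, <- !CPSeries_real. apply CPSeries_coef_d', H. }
  rewrite bprod_series by exact H. fold w.
  pose proof (is_derive_Rminus (fun s => exp (2 * nu * s) * PSeries (coef_b' nu) (exp (2 * s)))
    (fun s => exp (0 * s) * PSeries (coef_d' nu) (exp (2 * s))) s _ _ D1 D2) as D3.
  pose proof (is_derive_Rminus _ (fun t => t) s _ _ (is_derive_scal _ s (nu * kappa nu) _ D3) (is_derive_id (K := R_AbsRing) s)) as D4.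
  eapply is_derive_ext; [| eapply is_derive_eq; [exact D4|]].
  - intros t. unfold Phi. cbv beta. rewrite Rmult_0_l, exp_0, Rmult_1_l. reflexivity.
  - rewrite Rmult_0_l, exp_0, Rmult_0_l. change (@one R_AbsRing) with 1.
    replace (2 * nu * PSeries (coef_b' nu) w + 2 * w * PSeries (PS_derive (coef_b' nu)) w) with (2 * PSeries (coef_c nu) w)
      by (rewrite <- E1; ring).
    replace (1 * (0 + 2 * w * PSeries (PS_derive (coef_d' nu)) w)) with (2 * (PSeries (coef_d nu) w - coef_d nu 0))
      by (rewrite <- E2; ring).
    pose proof (kappa_coef_d_0 nu H Hp) as K.
    transitivity (- (2 * nu * (kappa nu * (PSeries (coef_d nu) w - exp (2 * nu * s) * PSeries (coef_c nu) w)))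
       + (2 * nu * (kappa nu * coef_d nu 0) - 1)); [ring|].
    rewrite K. field. lra.
Qed.

Lemma Phi_minfty (nu : R) : nonint nu -> 0 < nu ->
  lim_minfty (fun s => Phi nu s + s) 0.
Proof.
  intros H Hp.
  apply (filterlim_eq _ _ (nu * kappa nu * (0 * coef_b' nu 0 + - coef_d' nu 0))).
  - unfold coef_d'. simpl. unfold Rdiv. rewrite Rinv_0. ring.
  - apply (filterlim_ext (fun s => nu * kappa nu * (exp (2 * nu * s) * PSeries (coef_b' nu) (exp (2 * s)) + - PSeries (coef_d' nu) (exp (2 * s))))).
    + intros s. unfold Phi. ring.
    + apply lim_mult; [apply filterlim_const|].
      apply lim_plus.
      * apply lim_mult; [apply exp_minfty; lra | apply PSeries_exp_minfty, entire_coef_b', Hp].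
      * apply filterlim_Ropp, PSeries_exp_minfty, entire_coef_d', H.
Qed.

(** The constant is evaluated at s -> -oo, where the logarithms of the two [Phi] cancel and each
    product tends to 1 over twice its order. *)
Lemma Phi_succ (nu s : R) : nonint nu -> 0 < nu ->
  Phi nu s = Phi (nu + 1) s + (/ (2 * nu) + / (2 * (nu + 1))) - (bprod nu s + bprod (nu + 1) s).
Proof.
  intros H Hp. pose proof (nonint_succ _ H) as H1.
  set (T := fun s => (Phi nu s - Phi (nu + 1) s) + (bprod nu s + bprod (nu + 1) s)).
  assert (E : T s = (0 + - 0) + (/ (2 * nu) + / (2 * (nu + 1)))).
  { apply constant_of_limit.
    - intros t. eapply is_derive_eq.
      + apply is_derive_Rplus; [apply is_derive_Rminus; apply Phi_derive; trivial; lra |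
          apply is_derive_Rplus; apply bprod_derive; trivial].
      + rewrite bprod_derive_succ by exact H. ring.
    - apply lim_plus.
      + apply (filterlim_ext (fun s => (Phi nu s + s) + - (Phi (nu + 1) s + s))); [intros; ring|].
        apply lim_plus; [apply Phi_minfty; trivial|].
        apply filterlim_Ropp, Phi_minfty; trivial. lra.
      + apply lim_plus; apply bprod_minfty; trivial. lra. }
  unfold T in E. lra.
Qed.

(** * The limit at infinity *)

Lemma rad_pos (mu s : R) : 0 < rad mu s.
Proof. apply sqrt_lt_R0. pose proof (exp_pos (2 * s)). pose proof (pow2_ge_0 mu). lra. Qed.

Lemma rad_derive (mu s : R) : is_derive (rad mu) s (4 * exp (2 * s) / rad mu s).
Proof.
  pose proof (exp_pos (2 * s)). pose proof (pow2_ge_0 mu). pose proof (rad_pos mu s) as Hr.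
  unfold rad in *. auto_derive; [simpl in *; lra|].
  replace (mu * (mu * 1)) with (mu ^ 2) by ring. field. lra.
Qed.

Lemma rad_minfty (mu : R) : 0 < mu -> lim_minfty (rad mu) mu.
Proof.
  intros H. apply (filterlim_eq _ _ (sqrt (4 * 0 + mu ^ 2))).
  - rewrite Rmult_0_r, Rplus_0_l. apply sqrt_pow2. lra.
  - apply (filterlim_Rcont _ sqrt); [apply continuous_sqrt|].
    apply lim_plus; [| apply filterlim_const].
    apply lim_mult; [apply filterlim_const | apply exp_minfty; lra].
Qed.

(* [arsinh_inv mu s] is [arsinh (mu / x)] at [x = 2 exp s]. *)
Definition arsinh_inv (mu s : R) : R := ln (mu + rad mu s) - ln 2 - s.

Lemma arsinh_inv_derive (mu s : R) : 0 < mu -> is_derive (arsinh_inv mu) s (- (mu / rad mu s)).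
Proof.
  intros H. pose proof (rad_derive mu s) as D. pose proof (rad_pos mu s) as Hr. unfold arsinh_inv.
  auto_derive; [split; [eexists; exact D | split; [lra | easy]]|].
  use_derive D. pose proof (rad_sq mu s) as E.
  replace (4 * exp (2 * s)) with ((rad mu s - mu) * (rad mu s + mu)) by lra.
  field. lra.
Qed.

Lemma arsinh_inv_bounds (mu s : R) : 0 < mu -> 0 <= arsinh_inv mu s <= mu * exp (- s).
Proof.
  intros H. destruct (rad_bounds mu s H) as (R1 & _ & R3). pose proof (exp_pos s) as He.
  assert (E : arsinh_inv mu s = ln ((mu + rad mu s) / (2 * exp s))).
  { unfold Rdiv, arsinh_inv. rewrite ln_mult, ln_Rinv, ln_mult, ln_exp by (try apply Rinv_0_lt_compat; lra). ring. }
  assert (Hq : 1 <= (mu + rad mu s) / (2 * exp s) <= 1 + mu * exp (- s)).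
  { rewrite exp_Ropp. split; apply Rmult_le_reg_r with (2 * exp s); try lra; field_simplify; lra. }
  rewrite E. split.
  - rewrite <- ln_1. apply ln_le; lra.
  - eapply Rle_trans; [apply ln_le_sub_1; lra | lra].
Qed.

(** With mu = nu + 1 and r = rad, 1 / (I_mu K_mu) lies between r_mu + r_(mu+1) - 1 and r_mu +
    r_(mu-1) + 1. The bound is minus the derivative of 1 / r_mu, so it integrates over all s to 1 /
    mu. *)
Lemma bprod_approx (nu s : R) : nonint nu -> 1 <= nu ->
  Rabs ((nu + 1) * (/ rad (nu + 1) s - 2 * bprod (nu + 1) s)) <= 4 * exp (2 * s) / rad (nu + 1) s ^ 3.
Proof.
  intros H Hn. set (mu := nu + 1). pose proof (nonint_succ _ H) as H1. fold mu in H1.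
  pose proof (bprod_lower nu s H ltac:(lra)) as HL. pose proof (bprod_upper mu s H1 ltac:(unfold mu; lra)) as HU.
  fold mu in HL. set (p := bprod mu s) in *.
  pose proof (rad_sq nu s) as E1. pose proof (rad_sq mu s) as E0. pose proof (rad_sq (mu + 1) s) as E2.
  destruct (rad_bounds nu s ltac:(lra)) as (_ & B1 & _). destruct (rad_bounds mu s ltac:(unfold mu; lra)) as (_ & B0 & _).
  destruct (rad_bounds (mu + 1) s ltac:(unfold mu; lra)) as (_ & B2 & _).
  set (r := rad mu s) in *. set (r1 := rad nu s) in *. set (r2 := rad (mu + 1) s) in *.
  set (X := 4 * exp (2 * s)) in *.
  assert (HX : 0 < X) by (unfold X; pose proof (exp_pos (2 * s)); lra).
  clearbody X r r1 r2 p.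
  assert (Hr : 0 < r) by (unfold mu in *; lra).
  assert (Hr3 : 0 < r ^ 3) by (apply pow_lt, Hr).
  assert (Hr12 : r <= r1 + 1) by (unfold mu in *; nra).
  assert (Hr2 : r <= r2) by (unfold mu in *; nra).
  assert (Hmu : mu = nu + 1) by reflexivity. clearbody mu.
  apply Rabs_le. split.
  (* Multiplying r + 1 - r2 by its conjugate gives 2 (r - mu), and X = (r - mu)(r + mu) supplies the
     same factor on the right; what remains compares products of positive terms. The other half is
     similar, with 1 + r1 - r and 2 (r1 - nu). *)
  - assert (HA : mu * (r + 1 - r2) * r ^ 2 <= X * (r + r2 - 1)).
    { apply Rmult_le_reg_r with (r + 1 + r2); [lra|].
      replace (mu * (r + 1 - r2) * r ^ 2 * (r + 1 + r2)) with (2 * mu * (r - mu) * r ^ 2).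
      2: { replace (mu * (r + 1 - r2) * r ^ 2 * (r + 1 + r2)) with (mu * r ^ 2 * ((r + 1) ^ 2 - r2 * r2)) by ring.
        rewrite E2. replace X with (r * r - mu ^ 2) by lra. ring. }
      replace X with ((r - mu) * (r + mu)) by lra.
      replace (2 * mu * (r - mu) * r ^ 2) with ((r - mu) * ((2 * mu) * (r * r))) by ring.
      replace ((r - mu) * (r + mu) * (r + r2 - 1) * (r + 1 + r2)) with ((r - mu) * ((r + mu) * ((r + r2 - 1) * (r + 1 + r2)))) by ring.
      apply Rmult_le_compat_l; [lra|]. apply Rmult_le_compat; try nra. }
    assert (HB : mu * (2 * p - / r) <= X / r ^ 3); [| lra].
    assert (Hp : p <= / (r + r2 - 1)).
    { apply Rmult_le_reg_r with (r + r2 - 1); [lra|]. rewrite Rinv_l; lra. }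
    apply Rle_trans with (mu * (2 * / (r + r2 - 1) - / r)).
    + apply Rmult_le_compat_l; lra.
    + apply Rmult_le_reg_r with (r ^ 3 * (r + r2 - 1)); [apply Rmult_lt_0_compat; lra|].
      replace (mu * (2 * / (r + r2 - 1) - / r) * (r ^ 3 * (r + r2 - 1))) with (mu * (r + 1 - r2) * r ^ 2) by (field; lra).
      replace (X / r ^ 3 * (r ^ 3 * (r + r2 - 1))) with (X * (r + r2 - 1)) by (field; lra). exact HA.
  - assert (HA : mu * (1 + r1 - r) * r ^ 2 <= X * (r + r1 + 1)).
    { apply Rmult_le_reg_r with (r + r1 + 1); [lra|].
      replace (mu * (1 + r1 - r) * r ^ 2 * (r + r1 + 1)) with (2 * mu * (r1 - nu) * r ^ 2).
      2: { replace (mu * (1 + r1 - r) * r ^ 2 * (r + r1 + 1)) with (mu * r ^ 2 * ((1 + r1) ^ 2 - r * r)) by ring.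
        rewrite E0. replace X with (r1 * r1 - nu ^ 2) by lra. rewrite Hmu. ring. }
      replace X with ((r1 - nu) * (r1 + nu)) by lra.
      replace (2 * mu * (r1 - nu) * r ^ 2) with ((r1 - nu) * ((mu / 2) * ((2 * r) * (2 * r)))) by field.
      replace ((r1 - nu) * (r1 + nu) * (r + r1 + 1) * (r + r1 + 1)) with ((r1 - nu) * ((r1 + nu) * ((r + r1 + 1) * (r + r1 + 1)))) by ring.
      apply Rmult_le_compat_l; [lra|]. apply Rmult_le_compat; try nra. }
    assert (Hp : / (r + r1 + 1) <= p).
    { apply Rmult_le_reg_r with (r + r1 + 1); [lra|]. rewrite Rinv_l; lra. }
    apply Rle_trans with (mu * (/ r - 2 * / (r + r1 + 1))).
    + apply Rmult_le_compat_l; lra.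
    + apply Rmult_le_reg_r with (r ^ 3 * (r + r1 + 1)); [apply Rmult_lt_0_compat; lra|].
      replace (mu * (/ r - 2 * / (r + r1 + 1)) * (r ^ 3 * (r + r1 + 1))) with (mu * (1 + r1 - r) * r ^ 2) by (field; lra).
      replace (X / r ^ 3 * (r ^ 3 * (r + r1 + 1))) with (X * (r + r1 + 1)) by (field; lra). exact HA.
Qed.

Lemma Phi_sub_arsinh_inv_minfty (mu : R) : nonint mu -> 0 < mu ->
  lim_minfty (fun s => Phi mu s - arsinh_inv mu s) (- ln mu).
Proof.
  intros H Hp. apply (filterlim_eq _ _ (0 + - (ln (mu + mu) + - ln 2))).
  - replace (mu + mu) with (2 * mu) by ring. rewrite ln_mult by lra. ring.
  - apply (filterlim_ext (fun s => (Phi mu s + s) + - (ln (mu + rad mu s) + - ln 2))); [intros s; unfold arsinh_inv; ring|].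
    apply lim_plus; [apply Phi_minfty; trivial|]. apply filterlim_Ropp.
    apply lim_plus; [| apply filterlim_const].
    apply (filterlim_Rcont _ ln); [apply continuous_derivable; auto_derive; lra|].
    apply lim_plus; [apply filterlim_const | apply rad_minfty, Hp].
Qed.

(* The derivative of [Phi - arsinh_inv] is bounded by that of [- 1 / rad], so [Phi - arsinh_inv + 1 / rad] decreases
   and [Phi - arsinh_inv - 1 / rad] increases. *)
Lemma Phi_compare (nu s : R) : nonint nu -> 1 <= nu ->
  Rabs (Phi (nu + 1) s - arsinh_inv (nu + 1) s + ln (nu + 1)) <= / (nu + 1).
Proof.
  intros H Hn. set (mu := nu + 1) in *. pose proof (nonint_succ _ H) as H1. fold mu in H1.
  assert (Hmu : 0 < mu) by (unfold mu; lra).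
  set (f := fun s => Phi mu s - arsinh_inv mu s).
  assert (Df : forall t, is_derive f t (mu * (/ rad mu t - 2 * bprod mu t))).
  { intros t. pose proof (rad_pos mu t). eapply is_derive_eq.
    - apply is_derive_Rminus; [apply Phi_derive | apply arsinh_inv_derive]; trivial.
    - field. lra. }
  assert (Di : forall t, is_derive (fun t => / rad mu t) t (- (4 * exp (2 * t) / rad mu t ^ 3))).
  { intros t. pose proof (rad_pos mu t). eapply is_derive_eq; [apply is_derive_inv; [apply rad_derive | lra]|].
    field. lra. }
  assert (Li : lim_minfty (fun t => / rad mu t) (/ mu)).
  { apply (filterlim_Rcont _ Rinv); [apply continuous_derivable; auto_derive; lra | apply rad_minfty, Hmu]. }
  assert (Lf : lim_minfty f (- ln mu)) by (apply Phi_sub_arsinh_inv_minfty; trivial).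
  assert (A1 : - ln mu + - / mu <= f s + - / rad mu s).
  { apply (nondecreasing_ge_limit (fun s => f s + - / rad mu s)
      (fun t => mu * (/ rad mu t - 2 * bprod mu t) + - - (4 * exp (2 * t) / rad mu t ^ 3))).
    - intros t. apply is_derive_Rplus; [apply Df | apply (is_derive_opp (fun t => / rad mu t)), Di].
    - intros t. pose proof (bprod_approx nu t H Hn) as B. fold mu in B. apply Rabs_le_between in B. lra.
    - apply lim_plus; [exact Lf | apply filterlim_Ropp, Li]. }
  assert (A2 : - - ln mu + - / mu <= - f s + - / rad mu s).
  { apply (nondecreasing_ge_limit (fun s => - f s + - / rad mu s)
      (fun t => - (mu * (/ rad mu t - 2 * bprod mu t)) + - - (4 * exp (2 * t) / rad mu t ^ 3))).
    - intros t. apply is_derive_Rplus; [apply (is_derive_opp f), Df | apply (is_derive_opp (fun t => / rad mu t)), Di].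
    - intros t. pose proof (bprod_approx nu t H Hn) as B. fold mu in B. apply Rabs_le_between in B. lra.
    - apply lim_plus; [apply filterlim_Ropp, Lf | apply filterlim_Ropp, Li]. }
  pose proof (Rinv_0_lt_compat _ (rad_pos mu s)). unfold f in *. apply Rabs_le. lra.
Qed.

(** The increments of [Phi_succ] sum like a trapezoidal rule: the harmonic sum with its end terms
    halved. [Q] collects the products I K, which vanish at infinity. *)
Lemma Phi_shift (nu : R) (n : nat) : nonint nu -> 0 < nu ->
  exists Q : R -> R, lim_pinfty Q 0 /\
    forall s, Phi nu s = Phi (nu + INR n) s + (harmonic nu n - / (2 * nu) + / (2 * (nu + INR n))) - Q s.
Proof.
  intros H Hp. induction n as [|n (Q & HQ & E)].
  - exists (fun _ => 0). split; [apply filterlim_const|]. intros s. simpl. rewrite Rplus_0_r. ring.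
  - exists (fun s => Q s + (bprod (nu + INR n) s + bprod (nu + INR n + 1) s)). pose proof (pos_INR n) as Hn.
    pose proof (nonint_add nu n H) as H1. pose proof (nonint_succ _ H1) as H2. split.
    + apply (filterlim_eq _ _ (0 + (0 + 0))); [ring|].
      apply lim_plus; [exact HQ|].
      apply lim_plus; apply bprod_pinfty; trivial; lra.
    + intros s. rewrite E, (Phi_succ (nu + INR n)) by (trivial; lra). rewrite S_INR. simpl harmonic.
      replace (nu + (INR n + 1)) with (nu + INR n + 1) by ring. field. lra.
Qed.

(** First n is fixed, from the digamma limit and the error 1 / mu; only then does s grow, since [Q]
    and the bound on [arsinh_inv] depend on n. The logarithms of mu cancel between [Phi_compare] and
    the digamma sequence. *)
Lemma Phi_pinfty (nu : R) : nonint nu -> 0 < nu ->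
  lim_pinfty (Phi nu) (- digamma nu - / (2 * nu)).
Proof.
  intros H Hp P [eps HP]. pose proof (cond_pos eps) as He.
  destruct (proj2 (is_lim_seq_spec _ _) (digamma_limit nu Hp) (mkposreal (eps / 5) ltac:(lra))) as [N1 HN1].
  destruct (proj2 (is_lim_seq_spec _ _) (is_lim_seq_div_shift 1 nu Hp) (mkposreal (eps / 5) ltac:(lra))) as [N2 HN2].
  assert (Hex : exists n, (2 <= n /\ N1 <= n /\ N2 <= n)%nat) by (exists (2 + N1 + N2)%nat; lia).
  destruct Hex as (n & Hn & HnN1 & HnN2).
  specialize (HN1 n HnN1). specialize (HN2 n HnN2). simpl in HN1, HN2.
  destruct (Phi_shift nu n H Hp) as (Q & HQ & E).
  assert (Hn2 : 2 <= INR n) by (change 2 with (INR 2); apply le_INR, Hn).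
  set (mu := nu + INR n) in *.
  assert (Hmu : 2 < mu) by (unfold mu; lra).
  assert (Hc : forall s, Rabs (Phi mu s - arsinh_inv mu s + ln mu) <= / mu).
  { intros s. assert (Hmm : nonint (mu - 1)).
    { intros m Hm. apply (nonint_add nu n H (m + 1)%Z). rewrite plus_IZR. unfold mu in Hm. lra. }
    pose proof (Phi_compare (mu - 1) s Hmm ltac:(lra)) as B. replace (mu - 1 + 1) with mu in B by ring. exact B. }
  assert (LA : lim_pinfty (fun s => mu * exp (- s) + Rabs (Q s)) 0).
  { apply (filterlim_eq _ _ (mu * 0 + Rabs 0)); [rewrite Rabs_R0; ring|].
    apply lim_plus.
    - apply lim_mult; [apply filterlim_const|].
      apply (filterlim_ext (fun s => 0 + 1 * exp (- s))); [intros; ring | apply exp_neg_pinfty].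
    - apply (filterlim_Rcont _ Rabs); [apply continuous_Rabs | exact HQ]. }
  assert (HS : Rbar_locally p_infty (fun s => mu * exp (- s) + Rabs (Q s) < eps / 5)).
  { exact (LA (fun y => y < eps / 5) (open_lt (eps / 5) 0 ltac:(lra))). }
  unfold filtermap. apply (filter_imp (F := Rbar_locally p_infty)) with (2 := HS). intros s Hs. apply HP.
  apply Rabs_ball; simpl.
  destruct (arsinh_inv_bounds mu s ltac:(lra)) as [B1 B2]. specialize (Hc s). rewrite E.
  fold mu in HN2. rewrite Rminus_0_r in HN2. unfold Rdiv in HN2. rewrite Rmult_1_l in HN2.
  assert (Hi : 0 < / mu) by (apply Rinv_0_lt_compat; lra). rewrite Rabs_pos_eq in HN2 by lra.
  assert (Hi2 : / (2 * mu) = / mu / 2) by (field; lra). rewrite Hi2.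
  pose proof (Rle_abs (Q s)). pose proof (Rle_abs (- Q s)). rewrite Rabs_Ropp in H1.
  apply Rabs_le_between in Hc. apply Rabs_lt_between in HN1. unfold Rdiv in *.
  apply Rabs_def1; lra.
Qed.

(** * The closed form *)

(** The half-angle quotient of [Carg_atan] changes sign under inversion: numerator and denominator
    are both divided by |w|^2, and Im is negated. *)
Lemma Clog_inv (w : C) : cut_plane w -> Clog (/ w) = (- Clog w)%C.
Proof.
  intros Hc. pose proof (cut_plane_neq_0 w Hc) as H0. pose proof (proj1 (Cmod_add_Re_pos w) Hc) as Hp.
  assert (Hm : 0 < Cmod w) by (apply Cmod_gt_0, H0).
  pose proof (Cmod2_alt w) as E. pose proof (Cmod_inv w H0) as Ei.
  assert (ER : Re (/ w) = Re w / Cmod w ^ 2) by (rewrite E; reflexivity).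
  assert (EI : Im (/ w) = - Im w / Cmod w ^ 2) by (rewrite E; reflexivity).
  assert (Hc' : cut_plane (/ w)).
  { apply Cmod_add_Re_pos. rewrite Ei, ER.
    replace (/ Cmod w + Re w / Cmod w ^ 2) with ((Cmod w + Re w) / Cmod w ^ 2) by (field; lra).
    apply Rdiv_lt_0_compat; [lra | apply pow_lt, Hm]. }
  apply C_eq; unfold Clog; simpl.
  - rewrite Ei. apply ln_Rinv, Hm.
  - rewrite !Carg_atan by trivial. rewrite Ei, ER, EI.
    replace (- Im w / Cmod w ^ 2 / (/ Cmod w + Re w / Cmod w ^ 2)) with (- (Im w / (Cmod w + Re w))) by (field; lra).
    rewrite atan_opp. ring.
Qed.

Lemma Clog_2_div (z : C) : cut_plane z -> Clog (2 / z) = (- Clog (z / 2))%C.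
Proof.
  intros H. rewrite <- Clog_inv by apply cut_plane_half, H. f_equal.
  field. repeat split; try apply cut_plane_neq_0, H; apply C2_neq_0.
Qed.

Lemma pFq_CPSeries (a b : list R) (z : C) :
  pFq a b (z ^ 2) = CPSeries (fun k => pochhammer_prod a k / pochhammer_prod b k * 4 ^ k / INR (fact k)) ((z / 2) ^ 2).
Proof.
  unfold pFq, CPSeries. apply CSeries_ext. intros k.
  rewrite Cdiv_RtoC by apply Rgt_not_eq, INR_fact_pos.
  assert (E : (z ^ 2 = RtoC 4 * (z / 2) ^ 2)%C).
  { replace (RtoC 4) with (RtoC 2 * RtoC 2)%C by (rewrite <- RtoC_mult; f_equal; ring). simpl. field. }
  rewrite E, Cpow_mult_l, <- RtoC_pow. unfold Rdiv. rewrite !RtoC_mult. ring.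
Qed.

(** Duplication splits (2nu+1)_(2k) into 4^k (nu+1/2)_k (nu+1)_k, and (nu)_k / (nu+1)_k = nu /
    (nu+k) is the factor left by the integration. *)
Lemma coef_b'_hypergeometric (nu : R) (k : nat) : 0 < nu ->
  pochhammer_prod [nu; nu + 1 / 2] k / pochhammer_prod [nu + 1; nu + 1; 2 * nu + 1] k * 4 ^ k / INR (fact k)
  = nu * Gamma (nu + 1) ^ 2 * coef_b' nu k.
Proof.
  intros H. pose proof (regular_gt nu ltac:(lra)) as Hr. unfold coef_b', coef_c. rewrite alpha_mult by exact Hr.
  unfold pochhammer_prod. simpl fold_right.
  replace (nu + INR k + 1) with (nu + 1 + INR k) by ring. rewrite Gamma_shift by exact Hr.
  replace (nu + nu + INR k + 1) with (2 * nu + 1 + INR k) by ring.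
  pose proof (pochhammer_add (2 * nu + 1) k k) as E1.
  pose proof (pochhammer_double (nu + 1 / 2) k) as E2.
  replace (2 * (nu + 1 / 2)) with (2 * nu + 1) in E2 by field. replace (nu + 1 / 2 + 1 / 2) with (nu + 1) in E2 by field.
  replace (2 * k)%nat with (k + k)%nat in E2 by lia. rewrite E1 in E2.
  pose proof (pochhammer_mul_shift nu k) as E3.
  pose proof (pochhammer_pos (nu + 1) k ltac:(lra)). pose proof (pochhammer_pos (2 * nu + 1) k ltac:(lra)).
  pose proof (INR_fact_pos k). pose proof (pos_INR k). pose proof (Gamma_pos (nu + 1) ltac:(lra)).
  assert (E2' : pochhammer (2 * nu + 1 + INR k) k = 4 ^ k * pochhammer (nu + 1 / 2) k * pochhammer (nu + 1) k / pochhammer (2 * nu + 1) k).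
  { rewrite <- E2. field. lra. }
  assert (E3' : pochhammer nu k = nu * pochhammer (nu + 1) k / (nu + INR k)) by (rewrite E3; field; lra).
  rewrite E2', E3'. field. repeat split; lra.
Qed.

Lemma Gamma_reflection_kappa (nu : R) : nonint nu -> 0 < nu -> Gamma (nu + 1) * Gamma (- nu + 1) = 2 * nu * kappa nu.
Proof.
  intros H Hp. destruct (Gamma_reflection nu H Hp) as [E Hs]. unfold kappa.
  rewrite (Rplus_comm nu), (Rplus_comm (- nu)). change (1 + - nu) with (1 - nu). rewrite E. field. exact Hs.
Qed.

(** The index is [S k] because the constant term became the logarithm. Of the two quotients (1)_k /
    (2)_k = 1 / (k+1), one comes from the integration and the other turns k! into (k+1)!. *)
Lemma coef_d'_hypergeometric (nu : R) (k : nat) : nonint nu -> 0 < nu ->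
  pochhammer_prod [1; 1; 3 / 2] k / pochhammer_prod [2; 2; 2 - nu; 2 + nu] k * 4 ^ k / INR (fact k)
  = nu * kappa nu * (1 - nu ^ 2) * coef_d' nu (S k).
Proof.
  intros H Hp. pose proof (nonint_regular _ H) as R0. pose proof (nonint_regular_opp _ H) as R1.
  unfold coef_d', coef_d. rewrite alpha_mult by trivial.
  unfold pochhammer_prod. simpl fold_right.
  replace (nu + INR (S k) + 1) with (nu + 1 + INR (S k)) by ring.
  replace (- nu + INR (S k) + 1) with (- nu + 1 + INR (S k)) by ring.
  rewrite !Gamma_shift by trivial.
  replace (nu + - nu + INR (S k) + 1) with (1 + INR (S k)) by ring.
  pose proof (pochhammer_add 1 (S k) (S k)) as E1.
  pose proof (pochhammer_double (1 / 2) (S k)) as E2.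
  replace (2 * (1 / 2)) with 1 in E2 by field. replace (1 / 2 + 1 / 2) with 1 in E2 by field.
  replace (2 * S k)%nat with (S k + S k)%nat in E2 by lia. rewrite E1, pochhammer_1 in E2.
  rewrite (pochhammer_succ_l (1 / 2)) in E2. replace (1 / 2 + 1) with (3 / 2) in E2 by field.
  pose proof (pochhammer_succ_l 1 k) as E3. rewrite pochhammer_1, Rmult_1_l in E3. replace (1 + 1) with 2 in E3 by ring.
  pose proof (INR_fact_pos (S k)) as F1. pose proof (INR_fact_pos k) as F0. pose proof (pos_INR k) as Hk.
  rewrite <- E3, pochhammer_1. rewrite (pochhammer_succ_l (nu + 1)), (pochhammer_succ_l (- nu + 1)).
  replace (nu + 1 + 1) with (2 + nu) by ring. replace (- nu + 1 + 1) with (2 - nu) by ring.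
  assert (E2' : pochhammer (1 + INR (S k)) (S k) = 4 ^ S k * (1 / 2 * pochhammer (3 / 2) k)).
  { apply Rmult_eq_reg_l with (INR (fact (S k))); [rewrite E2; ring | lra]. }
  rewrite E2'. pose proof (Gamma_reflection_kappa nu H Hp) as G.
  pose proof (Gamma_neq_0 _ R0) as G0. pose proof (Gamma_neq_0 _ R1) as G1. pose proof (kappa_neq_0 nu H Hp) as K0.
  assert (P0 : pochhammer (2 + nu) k <> 0) by (apply Rgt_not_eq, pochhammer_pos; lra).
  assert (P1 : pochhammer (2 - nu) k <> 0).
  { replace (2 - nu) with (- nu + 1 + 1) by ring. apply pochhammer_neq_0, Gamma_pole_succ, R1. }
  assert (N1 : - nu + 1 <> 0) by (intros E; apply (H 1%Z); lra).
  transitivity (nu * kappa nu * (1 - nu ^ 2) * (4 ^ S k * (1 / 2 * pochhammer (3 / 2) k) /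
    (INR (fact (S k)) * ((nu + 1) * pochhammer (2 + nu) k * ((- nu + 1) * pochhammer (2 - nu) k)) * (Gamma (nu + 1) * Gamma (- nu + 1))) / INR (S k))).
  - rewrite G, fact_succ, S_INR. simpl pow. field. repeat split; lra.
  - f_equal. f_equal. field. repeat split; trivial; lra.
Qed.

Lemma entire_shift (a : nat -> R) : entire a -> entire (fun k => a (S k)).
Proof.
  intros Ha. apply entire_le with (2 := entire_derive a Ha) (M := 1). intros k. unfold PS_derive.
  rewrite Rmult_1_l, Rabs_mult, (Rabs_pos_eq (INR _)) by apply pos_INR.
  rewrite S_INR. pose proof (pos_INR k). pose proof (Rabs_pos (a (S k))). nra.
Qed.

Lemma one_sub_sq_neq_0 (nu : R) : nonint nu -> 0 < nu -> 1 - nu ^ 2 <> 0.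
Proof.
  intros H Hp E. apply (H 1%Z). assert ((nu - 1) * (nu + 1) = 0) by lra.
  apply Rmult_integral in H0. lra.
Qed.

Lemma closed_form_primitive (nu psi : R) (z : C) : nonint nu -> 0 < nu -> cut_plane z ->
  (RtoC (1 / (2 * nu)) *
     (RtoC (PI * / sin (PI * nu)) * Cpower (z / 2) (RtoC (2 * nu))
        / RtoC (2 * Gamma (nu + 1) ^ 2)
        * pFq [nu; nu + 1 / 2]%R [nu + 1; nu + 1; 2 * nu + 1]%R (z ^ 2)
      - z ^ 2 / RtoC (4 * (1 - nu ^ 2))
        * pFq [1; 1; 3 / 2]%R [2; 2; 2 - nu; 2 + nu]%R (z ^ 2)
      + Clog (2 / z) + RtoC psi + RtoC (1 / (2 * nu))))%C = primitive nu psi z.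
Proof.
  intros H Hp Hc. destruct (Gamma_reflection nu H Hp) as [_ Hs].
  pose proof (Gamma_pos (nu + 1) ltac:(lra)) as HG. pose proof (one_sub_sq_neq_0 nu H Hp) as H1.
  rewrite !pFq_CPSeries, Clog_2_div by exact Hc.
  rewrite (CPSeries_ext _ _ _ (fun k => coef_b'_hypergeometric nu k Hp)).
  rewrite (CPSeries_ext _ _ _ (fun k => coef_d'_hypergeometric nu k H Hp)).
  rewrite !CPSeries_scal by (try apply entire_shift; try apply entire_coef_b'; try apply entire_coef_d'; assumption).
  unfold primitive.
  (* The prefactor z^2 of the second series undoes the shift of index, since [coef_d'] vanishes at
     0. *)
  rewrite (CPSeries_shift (fun k => coef_d' nu (S k)) (coef_d' nu)).
  2: apply entire_shift, entire_coef_d', H. 2: unfold coef_d'; simpl; unfold Rdiv; rewrite Rinv_0; ring. 2: reflexivity.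
  unfold Cpower. set (X := Cexp _). set (B := CPSeries (coef_b' nu) _). set (D := CPSeries (fun k => coef_d' nu (S k)) _).
  set (l := Clog (z / 2)).
  assert (G2 : 2 * Gamma (nu + 1) ^ 2 <> 0) by (apply Rgt_not_eq, Rmult_lt_0_compat; [lra | apply pow_lt, HG]).
  rewrite (Cdiv_RtoC _ (2 * Gamma (nu + 1) ^ 2)), (Cdiv_RtoC _ (4 * (1 - nu ^ 2))) by lra.
  replace (z ^ 2)%C with (RtoC 4 * (z / 2) ^ 2)%C.
  2: { replace (RtoC 4) with (RtoC 2 * RtoC 2)%C by (rewrite <- RtoC_mult; f_equal; ring). simpl. field. }
  set (q := ((z / 2) ^ 2)%C).
  assert (E1 : kappa nu / 2 = 1 / (2 * nu) * (PI * / sin (PI * nu)) * / (2 * Gamma (nu + 1) ^ 2) * (nu * Gamma (nu + 1) ^ 2)).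
  { unfold kappa. field. lra. }
  assert (E2 : kappa nu / 2 = 1 / (2 * nu) * / (4 * (1 - nu ^ 2)) * 4 * (nu * kappa nu * (1 - nu ^ 2))).
  { field. lra. }
  assert (E3 : / (2 * nu) = 1 / (2 * nu)) by (unfold Rdiv; ring).
  assert (E4 : (psi + 1 / (2 * nu)) / (2 * nu) = 1 / (2 * nu) * (psi + 1 / (2 * nu))) by (unfold Rdiv; ring).
  transitivity (RtoC (kappa nu / 2) * X * B - RtoC (kappa nu / 2) * (q * D) - RtoC (/ (2 * nu)) * l
    + RtoC ((psi + 1 / (2 * nu)) / (2 * nu)))%C; [| reflexivity].
  rewrite E1 at 1. rewrite E2. rewrite E3, E4. rewrite !RtoC_mult, !RtoC_plus. ring.
Qed.

(** * The primitive on the positive axis and the conclusion *)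

Lemma Clog_real (y : R) : 0 < y -> Clog (RtoC y) = RtoC (ln y).
Proof.
  intros H. unfold Clog. rewrite Cmod_R, Rabs_pos_eq by lra. unfold RtoC. f_equal.
  unfold Carg. simpl. destruct (Rle_dec 0 0) as [_|Hn]; [|lra].
  change (y, 0) with (RtoC y). rewrite Cmod_R, Rabs_pos_eq by lra. rewrite Rdiv_diag by lra. apply acos_1.
Qed.

Lemma Cexp_real (y : R) : Cexp (RtoC y) = RtoC (exp y).
Proof. unfold Cexp, RtoC; simpl. rewrite cos_0, sin_0. f_equal; ring. Qed.

Lemma primitive_real (nu psi s : R) : 0 < nu ->
  primitive nu psi (RtoC (2 * exp s)) = RtoC ((Phi nu s + (psi + 1 / (2 * nu))) / (2 * nu)).
Proof.
  intros Hp. unfold primitive.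
  assert (E : (RtoC (2 * exp s) / 2)%C = RtoC (exp s)).
  { rewrite RtoC_mult. field. }
  rewrite E, Clog_real, ln_exp by apply exp_pos.
  rewrite <- RtoC_pow. replace (exp s ^ 2) with (exp (2 * s)) by (rewrite exp_double; ring).
  rewrite !CPSeries_real, <- RtoC_mult, Cexp_real. rewrite <- !RtoC_mult, <- !RtoC_minus, <- RtoC_plus. f_equal.
  unfold Phi. field. lra.
Qed.

Lemma primitive_pinfty (nu : R) : nonint nu -> 0 < nu ->
  limC (Rbar_locally p_infty) (fun x : R => (- primitive nu (digamma nu) (RtoC x))%C) (RtoC 0).
Proof.
  intros H Hp.
  assert (L : lim_pinfty (fun x => - ((Phi nu (ln (x / 2)) + (digamma nu + 1 / (2 * nu))) * / (2 * nu))) 0).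
  { apply (filterlim_eq _ _ (- ((- digamma nu - / (2 * nu) + (digamma nu + 1 / (2 * nu))) * / (2 * nu)))); [unfold Rdiv; ring|].
    apply filterlim_Ropp, lim_mult; [| apply filterlim_const].
    apply lim_plus; [| apply filterlim_const].
    apply (filterlim_comp _ _ _ (fun x => ln (x / 2)) (Phi nu) _ (Rbar_locally p_infty)); [| apply Phi_pinfty; trivial].
    intros P [M HM]. exists (2 * exp M). intros x Hx. apply HM. rewrite <- (ln_exp M).
    pose proof (exp_pos M). apply ln_increasing; lra. }
  apply limC_components; [typeclasses eauto|].
  assert (Hloc : Rbar_locally p_infty (fun x : R => RtoC (- ((Phi nu (ln (x / 2)) + (digamma nu + 1 / (2 * nu))) * / (2 * nu)))
     = (- primitive nu (digamma nu) (RtoC x))%C)).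
  { exists 0. intros x Hx. rewrite RtoC_opp. f_equal.
    pose proof (primitive_real nu (digamma nu) (ln (x / 2)) Hp) as E. rewrite exp_ln in E by lra.
    replace (2 * (x / 2)) with x in E by field. rewrite E. reflexivity. }
  split.
  - apply (filterlim_ext_loc (F := Rbar_locally p_infty)) with (2 := L).
    apply (filter_imp (F := Rbar_locally p_infty)) with (2 := Hloc). intros x Hx. rewrite <- Hx. reflexivity.
  - apply (filterlim_ext_loc (F := Rbar_locally p_infty)) with (2 := filterlim_const 0).
    apply (filter_imp (F := Rbar_locally p_infty)) with (2 := Hloc). intros x Hx. rewrite <- Hx. reflexivity.
Qed.

Theorem theorem5 (z : C) (hz : z <> RtoC 0) (harg : Rabs (Carg z) < PI)
    (nu : R) (hnu : 0 < nu) (hnuZ : forall m : Z, nu <> IZR m)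
    (g : R -> C) (hg : path_to_infinity z g) :
  is_path_integral (fun t : C => (BesselI nu t * BesselK nu t / t)%C) g
    (RtoC (1 / (2 * nu)) *
     (RtoC (PI * / sin (PI * nu)) * Cpower (z / 2) (RtoC (2 * nu))
        / RtoC (2 * Gamma (nu + 1) ^ 2)
        * pFq [nu; nu + 1 / 2]%R [nu + 1; nu + 1; 2 * nu + 1]%R (z ^ 2)
      - z ^ 2 / RtoC (4 * (1 - nu ^ 2))
        * pFq [1; 1; 3 / 2]%R [2; 2; 2 - nu; 2 + nu]%R (z ^ 2)
      + Clog (2 / z) + RtoC (digamma nu) + RtoC (1 / (2 * nu))))%C.
Proof.
  (* z is the starting point of a path that avoids the cut. *)
  assert (Hc : cut_plane z).
  { destruct hg as (H0 & _ & Hcut & _). rewrite <- H0. apply Hcut. lra. }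
  rewrite closed_form_primitive by trivial.
  (* The primitive of the integrand is the negative of [primitive]; it vanishes at infinity, so the
     integral is minus its value at z. *)
  replace (primitive nu (digamma nu) z) with (- - primitive nu (digamma nu) z)%C by ring.
  apply (path_to_infinity_integral cut_plane (fun z => (- primitive nu (digamma nu) z)%C)); trivial.
  - apply path_primitive_bessel_IK; trivial.
  - apply primitive_pinfty; trivial.
Qed.
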